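(* Let $\mathbf{A}\in\mathbb{R}^{n\times d}$, $\mathbf{\Sigma}=\mathbf{A}^\top\mathbf{A}$ with eigenvalues $\lambda_1\ge\lambda_2\ge\dots$, $\mathrm{gap}=(\lambda_1-\lambda_2)/\lambda_1>0$, $(1+\frac{\mathrm{gap}}{150})\lambda_1<\lambda\le(1+\frac{\mathrm{gap}}{100})\lambda_1$, $\mathbf{B}=\lambda\mathbf{I}-\mathbf{\Sigma}$, and assume $\mathrm{nnz}(\mathbf{A})\le\frac{d\,\mathrm{sr}(\mathbf{A})}{\mathrm{gap}^2}$. There is a randomized solver (SVRG applied to regularized problems, combined with accelerated approximate proximal point acceleration) which, given $b\in\mathbb{R}^d$ and $x_0\in\mathbb{R}^d$, returns $x$ with $$\mathbb{E}\|x-x^{*}\|_{\mathbf{B}}^2\le\frac12\|x_0-x^{*}\|_{\mathbf{B}}^2,\qquad x^{*}=\mathbf{B}^{-1}b,$$ in time $O\left(\frac{\mathrm{nnz}(\mathbf{A})^{3/4}(d\,\mathrm{sr}(\mathbf{A}))^{1/4}}{\sqrt{\mathrm{gap}}}\cdot\log\left(\frac d{\mathrm{gap}}\right)\right)$.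
   Context: $\|y\|_{\mathbf{B}}=\sqrt{y^\top\mathbf{B}y}$. $\mathrm{nnz}(\mathbf{A})$ is the number of nonzero entries of $\mathbf{A}$ and $\mathrm{sr}(\mathbf{A})=\|\mathbf{A}\|_F^2/\|\mathbf{A}\|_2^2$ its stable rank.
   Formalization: The time does not count the d constant-size evaluations that write out x; this matters only when d exceeds the stated time (A with many zero columns, e.g. A=e1e1^T), where writing x alone breaks the bound. Also d≥2 is assumed, and gap is given to the solver. *)

(* Defs.v *)
From HB Require Import structures.
From mathcomp Require Import all_boot all_order all_algebra.
From mathcomp Require Import boolp classical_sets reals exp.

Set Implicit Arguments.
Unset Strict Implicit.
Unset Printing Implicit Defensive.

Import Order.TTheory GRing.Theory Num.Theory.
Local Open Scope ring_scope.

Section MatrixQuantities.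
Variable R : realType.

Definition nonzeros (n d : nat) (A : 'M[R]_(n, d)) : {set 'I_n * 'I_d} :=
  [set p | A p.1 p.2 != 0].

Definition nnz (n d : nat) (A : 'M[R]_(n, d)) : nat := #|nonzeros A|.

Definition norm2 (d : nat) (x : 'cV[R]_d) : R := Num.sqrt (\sum_i x i 0 ^+ 2).

Definition frobenius_norm (n d : nat) (A : 'M[R]_(n, d)) : R :=
  Num.sqrt (\sum_i \sum_j A i j ^+ 2).

Definition spectral_norm (n d : nat) (A : 'M[R]_(n, d)) : R :=
  sup [set norm2 (A *m x) | x in [set x : 'cV[R]_d | norm2 x = 1]]%classic.

Definition stable_rank (n d : nat) (A : 'M[R]_(n, d)) : R :=
  frobenius_norm A ^+ 2 / spectral_norm A ^+ 2.

Definition normB (d : nat) (B : 'M[R]_d) (y : 'cV[R]_d) : R :=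
  Num.sqrt ((y^T *m B *m y) 0 0).

(* Eigenvalues are listed with multiplicity, largest first. *)
Definition sorted_eigenvalues (d : nat) (M : 'M[R]_d) (s : seq R) : Prop :=
  sorted >=%O s /\ char_poly M = \prod_(a <- s) ('X - a%:P).

End MatrixQuantities.

(* Randomized algorithms are programs for a real RAM: unit-cost exact field   *)
(* operations and comparisons on reals, unit-cost index arithmetic, indirect  *)
(* addressing, and random choices.  The memory consists of real arrays and of *)
(* index arrays, both named by numbers; a scalar is cell 0 of some array.     *)
(* There is no conversion between reals and indices and no rounding.  The     *)
(* syntax does not mention the type of reals, so a program cannot have        *)
(* arbitrary real constants built in.                                         *)

Inductive iexpr : Type :=
| IConst of nat
| IGet of nat & iexpr
| IAdd of iexpr & iexpr
| ISub of iexpr & iexpr.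

Inductive rexpr : Type :=
| RConst of nat
| RGet of nat & iexpr
| RAdd of rexpr & rexpr
| RSub of rexpr & rexpr
| RMul of rexpr & rexpr
| RDiv of rexpr & rexpr.

Inductive bexpr : Type :=
| BLeI of iexpr & iexpr
| BLeR of rexpr & rexpr
| BNot of bexpr
| BAnd of bexpr & bexpr.

(* [RandI a i m] stores in cell [i] of the index array [a] a uniform element  *)
(* of {0, ..., m-1} (0 if m = 0).  [Flip a i p] stores there a Bernoulli(p)   *)
(* bit, with p clipped to [0, 1]; it is the comparison of a uniform real of   *)
(* [0, 1] with p.                                                             *)
Inductive cmd : Type :=
| Skip
| Seq of cmd & cmd
| SetI of nat & iexpr & iexpr
| SetR of nat & iexpr & rexpr
| If of bexpr & cmd & cmd
| While of bexpr & cmd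
| RandI of nat & iexpr & iexpr
| Flip of nat & iexpr & rexpr.

(* After [body] has stopped, coordinate j of the returned vector is the value *)
(* of the expression [ret] when the scalar index variable [ret_var] holds j.  *)
(* Thus a vector stored in the array [a] is returned by                       *)
(* [RGet a (IGet ret_var (IConst 0))].  The d evaluations of [ret], of        *)
(* constant size each, print the answer and are not part of the running time; *)
(* this only matters when d exceeds nnz(A), i.e. when A has zero columns,     *)
(* where merely writing down x may take longer than the claimed time.         *)
Definition ret_var : nat := 3.

Record solver : Type := Solver { body : cmd; ret : rexpr }.

Section Semantics.
Variable R : realType.

Record state : Type := State { imem : nat -> nat -> nat; rmem : nat -> nat -> R }.

Definition upd (T : Type) (m : nat -> nat -> T) (a i : nat) (v : T) :
    nat -> nat -> T :=
  fun a' i' => if (a' == a) && (i' == i) then v else m a' i'.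

Definition seti (s : state) (a i v : nat) : state :=
  State (upd (imem s) a i v) (rmem s).

Definition setr (s : state) (a i : nat) (v : R) : state :=
  State (imem s) (upd (rmem s) a i v).

Fixpoint evali (s : state) (e : iexpr) : nat :=
  match e with
  | IConst k => k
  | IGet a e1 => imem s a (evali s e1)
  | IAdd e1 e2 => (evali s e1 + evali s e2)%N
  | ISub e1 e2 => (evali s e1 - evali s e2)%N
  end.

Fixpoint evalr (s : state) (e : rexpr) : R :=
  match e with
  | RConst k => k%:R
  | RGet a e1 => rmem s a (evali s e1)
  | RAdd e1 e2 => evalr s e1 + evalr s e2
  | RSub e1 e2 => evalr s e1 - evalr s e2
  | RMul e1 e2 => evalr s e1 * evalr s e2
  | RDiv e1 e2 => evalr s e1 / evalr s e2
  end.

Fixpoint evalb (s : state) (e : bexpr) : bool :=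
  match e with
  | BLeI e1 e2 => (evali s e1 <= evali s e2)%N
  | BLeR e1 e2 => evalr s e1 <= evalr s e2
  | BNot e1 => ~~ evalb s e1
  | BAnd e1 e2 => evalb s e1 && evalb s e2
  end.

(* Finitely supported distributions, as lists of (probability, outcome). *)
Definition dist (T : Type) : Type := seq (R * T).

Definition dret (T : Type) (x : T) : dist T := [:: (1, x)].

Definition dbind (T U : Type) (mu : dist T) (f : T -> dist U) : dist U :=
  flatten [seq [seq (w.1 * v.1, v.2) | v <- f w.2] | w <- mu].

Definition expect (T : Type) (mu : dist T) (f : T -> R) : R :=
  \sum_(w <- mu) w.1 * f w.2.

Definition almost_surely (T : Type) (mu : dist T) (Q : T -> bool) : Prop :=
  all (fun w => (w.1 == 0) || Q w.2) mu.

(* A configuration is the stack of commands still to be run and the memory. *)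
Definition config : Type := (seq cmd * state)%type.

Definition halted (c : config) : bool := nilp c.1.

(* The expressions of a fixed program have bounded size, so one step is a     *)
(* bounded number of primitive operations.                                    *)
Definition step (c : config) : dist config :=
  let: (k, s) := c in
  match k with
  | [::] => dret c
  | Skip :: k' => dret (k', s)
  | Seq c1 c2 :: k' => dret (c1 :: c2 :: k', s)
  | SetI a i e :: k' => dret (k', seti s a (evali s i) (evali s e))
  | SetR a i e :: k' => dret (k', setr s a (evali s i) (evalr s e))
  | If e c1 c2 :: k' => dret ((if evalb s e then c1 else c2) :: k', s)
  | While e c1 :: k' =>
      dret (if evalb s e then c1 :: k else k', s)
  | RandI a i e :: k' =>
      let m := evali s e in
      if m == 0%N then dret (k', seti s a (evali s i) 0)
      else [seq (m%:R^-1, (k', seti s a (evali s i) v)) | v <- iota 0 m]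
  | Flip a i e :: k' =>
      let p := Num.max 0 (Num.min 1 (evalr s e)) in
      [:: (p, (k', seti s a (evali s i) 1));
          (1 - p, (k', seti s a (evali s i) 0))]
  end.

Fixpoint steps (t : nat) (c : config) : dist config :=
  if t is t'.+1 then dbind (step c) (steps t') else dret c.

Definition run (P : solver) (t : nat) (s : state) : dist config :=
  steps t ([:: body P], s).

Definition output (P : solver) (d : nat) (c : config) : 'cV[R]_d :=
  \col_(j < d) evalr (seti c.2 ret_var 0 j) (ret P).

(* The nonzero entries of A, row by row. *)
Definition entries (n d : nat) (A : 'M[R]_(n, d)) : seq ('I_n * 'I_d) :=
  [seq p <- [seq (i, j) | i <- enum 'I_n, j <- enum 'I_d] | p \in nonzeros A].

(* Initial memory:                                                            *)
(*   index arrays: 0 = (n, d, nnz A), 1 = row indices and 2 = column indices  *)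
(*                 of the nonzero entries of A;                               *)
(*   real arrays:  0 = (lambda, gap), 1 = values of the nonzero entries of A, *)
(*                 2 = b, 3 = x0;                                             *)
(* every other cell holds 0.                                                  *)
Definition input (n d : nat) (A : 'M[R]_(n, d)) (lambda gap : R)
    (b x0 : 'cV[R]_d) : state :=
  State
    (fun a i => nth 0%N (nth [::]
       [:: [:: n; d; nnz A];
           [seq nat_of_ord p.1 | p <- entries A];
           [seq nat_of_ord p.2 | p <- entries A]] a) i)
    (fun a i => nth 0 (nth [::]
       [:: [:: lambda; gap];
           [seq A p.1 p.2 | p <- entries A];
           [seq b j 0 | j <- enum 'I_d];
           [seq x0 j 0 | j <- enum 'I_d]] a) i).

End Semantics.

(* Main.v *)
Require Import Defs.
From HB Require Import structures.
From mathcomp Require Import all_boot all_order all_algebra.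
From mathcomp Require Import boolp classical_sets reals exp.
From mathcomp Require Import zify ring lra.
Import Order.TTheory GRing.Theory Num.Theory.
Local Open Scope ring_scope.

(* The solver runs an accelerated proximal point method on
   f(x) = x^T B x / 2 - b^T x, which is mu-strongly convex for
   mu = gap lambda / 200. With tau = 1 / N and gamma = mu N^2 / 2, one iteration
   sets y = (x + tau v) / (1 + tau), takes for x' an approximate minimiser of
   f + gamma / 2 |. - y|^2, and sets
   v' = (1 - tau) v + tau x' - (tau / mu) grad f(x'). The Lyapunov function
   V = f(x) - min f + mu / 2 |v - argmin f|^2 then satisfies
   V' <= (1 - tau) V + |r|^2 / gamma, where r is the residual of the proximal
   problem at x'; so 6 N iterations suffice if E |r|^2 is polynomially small.

   The proximal problem is solved by K = O(log(d / gap)) epochs of SVRG started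
   at y. A step corrects the gradient at a snapshot by one row of A, drawn with
   probability at least |a_r|^2 / (2 W) for W = |A|_F^2, so the variance is at
   most 2 W lambda |z - w|^2 although the components -(a_r^T x)^2 / 2 are
   concave. An epoch of 12 M steps halves the squared error once
   gamma^2 M >= 32 W lambda. With D nonzero columns and M = ceil(nnz / D) an epoch
   costs O(nnz), and the least admissible N satisfies
   N^4 = O(d sr / (nnz gap^2)). *)

Set Implicit Arguments.
Unset Strict Implicit.
Unset Printing Implicit Defensive.

(** * A quantitative program logic *)

(** The machine has no square root, logarithm, rounding or conversion between reals and indices.
    Hence [tau] is the reciprocal of an integer, [gamma] is rational in it, and M, N, K and the
    sampling table come from counting loops that advance an index counter and its real copy
    together. Apart from the walk along a sampled row, which has at most D entries, every loop
    length is fixed by the input, so the time bound holds on every random path and only the error is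
    averaged. The program knows [lambda] and [gap] but not lambda_1. The computable mu = gap lambda
    / 200 is at most 1.01 gap lambda_1 / 200, hence below gap lambda_1 / 150 < lambda - lambda_1. A
    step costs O(D) and an epoch has 12 M steps with M D of order nnz, so snapshots and steps are
    balanced. The total nnz N K, with N^4 of order d sr / (nnz gap^2), is the claimed nnz^(3/4) (d
    sr)^(1/4) / sqrt(gap) times a logarithm. Zero rows and columns must cost nothing: on a zero
    column the solution is b / lambda, so the iterates minus b / lambda vanish there, and the zeros
    of the initial memory replace initialisation loops. *)

Section Logic.
Variable R : realType.
Implicit Types (s : state R) (Phi : config R -> R) (t : nat).

Lemma expect_dret (T : Type) (x : T) (f : T -> R) : expect (dret R x) f = f x.
Proof. by rewrite /expect /dret big_seq1 mul1r. Qed.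

Lemma expect_dbind (T U : Type) (mu : dist R T) (f : T -> dist R U) (g : U -> R) :
  expect (dbind mu f) g = expect mu (fun x => expect (f x) g).
Proof.
rewrite /expect /dbind big_flatten big_map; apply: eq_bigr => w _.
by rewrite big_map mulr_sumr; apply: eq_bigr => v _; rewrite mulrA.
Qed.

Lemma almost_surely_dbind (T U : Type) (mu : dist R T) (f : T -> dist R U)
    (Q : U -> bool) :
  almost_surely (dbind mu f) Q <->
  all (fun w => (w.1 == 0) || all (fun v => (v.1 == 0) || Q v.2) (f w.2)) mu.
Proof.
rewrite /almost_surely /dbind.
suff -> : all (fun w => (w.1 == 0) || Q w.2)
    (flatten [seq [seq (w.1 * v.1, v.2) | v <- f w.2] | w <- mu]) =
  all (fun w => (w.1 == 0) || all (fun v => (v.1 == 0) || Q v.2) (f w.2)) mu by [].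
elim: mu => //= w mu IH; rewrite all_cat IH; congr (_ && _); rewrite all_map.
have [->|w0] := eqVneq w.1 0 => /=.
  by rewrite (@eq_all _ _ xpredT) ?all_predT // => v /=; rewrite mul0r eqxx.
by apply: eq_all => v /=; rewrite mulf_eq0 (negPf w0).
Qed.

Definition ok t (c : config R) Phi (v : R) : Prop :=
  almost_surely (steps t c) (@halted R) /\ expect (steps t c) Phi <= v.

(** A halted configuration steps to itself, and an outcome of weight 0 contributes nothing to
    [expect], so one more step changes nothing. This is what makes step counts usable as upper
    bounds in [ok_leq]. *)
Lemma halted_steps1 t (c : config R) :
  almost_surely (steps t c) (@halted R) ->
  almost_surely (steps t.+1 c) (@halted R) /\
  forall Phi, expect (steps t.+1 c) Phi = expect (steps t c) Phi.
Proof.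
elim: t c => [|t IH] c.
  case: c => [[|k0 k] s]; last by rewrite /almost_surely /= oner_eq0.
  move=> _; split => [|Phi]; first by rewrite /almost_surely /= orbT.
  by rewrite [steps 1 _]/= expect_dbind !expect_dret.
move=> /almost_surely_dbind H; split => [|Phi].
  apply/almost_surely_dbind; apply: sub_all H => w /= /orP [->//|H].
  by apply/orP; right; apply: (IH w.2 H).1.
rewrite [steps t.+2 c]/= -/(steps t.+1) [steps t.+1 c]/= !expect_dbind.
rewrite /expect; elim: (step c) H => [|w mu IHmu] /=; first by rewrite !big_nil.
move=> /andP [Hw /IHmu IHm]; rewrite !big_cons IHm; congr (_ + _).
case/orP: Hw => [/eqP ->|Hw]; first by rewrite !mul0r.
by congr (_ * _); apply: (IH w.2 Hw).2.
Qed.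

Lemma ok_leq t t' c Phi v : (t <= t')%N -> ok t c Phi v -> ok t' c Phi v.
Proof.
move=> /subnK <-; elim: (t' - t)%N => [//|k IH] /IH [h1 h2].
have [h3 h4] := halted_steps1 h1.
by split; rewrite addSn // h4.
Qed.

Lemma ok_step1 t c c' Phi v : step c = dret R c' -> ok t c' Phi v -> ok t.+1 c Phi v.
Proof.
move=> E [h1 h2]; rewrite /ok [steps _ _]/= E; split.
  by apply/almost_surely_dbind; rewrite /= andbT; apply/orP; right.
by rewrite expect_dbind expect_dret.
Qed.

(* [wp c s t I g v]: run from [s], the command [c] stops within [t] steps in a
   state satisfying [I], and the expectation of [g] there is at most [v]. It is
   phrased through an arbitrary continuation [k]; quantifying over the affine
   images of [g] is what makes the bound usable under linear recurrences. *)
Definition wp (c : cmd) s t (I : state R -> Prop) (g : state R -> R) (v : R) :=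
  forall k t' Phi al be, 0 <= be ->
  (forall s', I s' -> ok t' (k, s') Phi (al + be * g s')) ->
  ok (t + t') (c :: k, s) Phi (al + be * v).

(** With a zero payoff only the step bound and the postcondition remain; [wp_of_wpd] recovers any
    constant payoff from it. *)
Definition wpd (c : cmd) s t I := wp c s t I (fun _ => 0) 0.

Lemma wp_weaken c s t t2 (I I2 : state R -> Prop) g g2 v v2 :
  wp c s t I g v -> (t <= t2)%N ->
  (forall s', I s' -> I2 s' /\ g2 s' <= g s') -> v <= v2 -> wp c s t2 I2 g2 v2.
Proof.
move=> H lt HI lv k t' Phi al be be0 Hk.
apply: (@ok_leq (t + t')); first by rewrite leq_add2r.
have [|h1 h2] := H k t' Phi al be be0.
  move=> s' /HI [/Hk [h1 h2] lg]; split=> //.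
  by apply: (le_trans h2); rewrite lerD2l ler_wpM2l.
by split=> //; apply: (le_trans h2); rewrite lerD2l ler_wpM2l.
Qed.

Lemma wpd_weaken c s t t2 (I I2 : state R -> Prop) :
  wpd c s t I -> (t <= t2)%N -> (forall s', I s' -> I2 s') -> wpd c s t2 I2.
Proof. by move=> H lt HI; apply: wp_weaken H lt _ _ => // s' /HI. Qed.

(** The composition of two affine maps with nonnegative slopes is again one. Loop proofs use this to
    multiply the bound for one iteration by the contraction factor of the iterations still to
    come. *)
Lemma wp_affine c s t I g v a b : 0 <= b ->
  wp c s t I g v -> wp c s t I (fun s' => a + b * g s') (a + b * v).
Proof.
move=> b0 H k t' Phi al be be0 Hk.
have E x : al + be * (a + b * x) = (al + be * a) + (be * b) * x by ring.
rewrite E; apply: H; first exact: mulr_ge0.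
by move=> s' /Hk; rewrite E.
Qed.

Lemma wp_of_wpd c s t I v : wpd c s t I -> wp c s t I (fun _ => v) v.
Proof.
move=> /(@wp_affine _ _ _ _ _ _ v 0 (lexx _)) H.
by apply: wp_weaken H _ _ _ => // [s' Is'|]; rewrite mul0r addr0.
Qed.

Lemma wp_skip s (I : state R -> Prop) g : I s -> wp Skip s 1 I g (g s).
Proof. by move=> Is k t' Phi al be be0 /(_ s Is) H; apply: ok_step1 H. Qed.

Lemma wpd_skip s t (I : state R -> Prop) : (0 < t)%N -> I s -> wpd Skip s t I.
Proof. by move=> t0 Is; apply: wp_weaken (wp_skip (g := fun=> 0) Is) _ _ _. Qed.

Lemma wp_seq c1 c2 s t1 t2 I1 I2 g1 g2 v :
  wp c1 s t1 I1 g1 v -> (forall s', I1 s' -> wp c2 s' t2 I2 g2 (g1 s')) ->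
  wp (Seq c1 c2) s (t1 + t2).+1 I2 g2 v.
Proof.
move=> H1 H2 k t' Phi al be be0 Hk; rewrite addSn.
apply: (ok_step1 (c' := (c1 :: c2 :: k, s))) => //.
by rewrite -addnA; apply: H1 => // s' /H2; apply.
Qed.

Lemma wpd_seq c1 c2 s t1 t2 I1 I2 g v :
  wpd c1 s t1 I1 -> (forall s', I1 s' -> wp c2 s' t2 I2 g v) ->
  wp (Seq c1 c2) s (t1 + t2).+1 I2 g v.
Proof. by move=> /(@wp_of_wpd _ _ _ _ v) H1 H2; apply: wp_seq H1 _. Qed.

Lemma wp_seti a i e s (I : state R -> Prop) g :
  I (seti s a (evali s i) (evali s e)) ->
  wp (SetI a i e) s 1 I g (g (seti s a (evali s i) (evali s e))).
Proof. by move=> Is k t' Phi al be be0 /(_ _ Is) H; apply: ok_step1 H. Qed.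

Lemma wpd_seti a i e s (I : state R -> Prop) :
  I (seti s a (evali s i) (evali s e)) -> wpd (SetI a i e) s 1 I.
Proof. by move=> Is k t' Phi al be be0 /(_ _ Is) H; apply: ok_step1 H. Qed.

Lemma wpd_setr a i e s (I : state R -> Prop) :
  I (setr s a (evali s i) (evalr s e)) -> wpd (SetR a i e) s 1 I.
Proof. by move=> Is k t' Phi al be be0 /(_ _ Is) H; apply: ok_step1 H. Qed.

Lemma wp_if e c1 c2 s t I g v :
  (evalb s e -> wp c1 s t I g v) -> (~~ evalb s e -> wp c2 s t I g v) ->
  wp (If e c1 c2) s t.+1 I g v.
Proof.
move=> H1 H2 k t' Phi al be be0 Hk; rewrite addSn.
apply: ok_step1; first by [].
by case: ifPn => [/H1|/H2]; apply.
Qed.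

Lemma wp_randi a i e s (I : state R -> Prop) g m :
  evali s e = m -> (0 < m)%N ->
  (forall x, (x < m)%N -> I (seti s a (evali s i) x)) ->
  wp (RandI a i e) s 1 I g (m%:R^-1 * \sum_(x < m) g (seti s a (evali s i) x)).
Proof.
move=> Em m0 HI k t' Phi al be be0 Hk; rewrite add1n /ok [steps _ _]/= Em gtn_eqF //.
have HH x : (x < m)%N -> ok t' (k, seti s a (evali s i) x) Phi
    (al + be * g (seti s a (evali s i) x)) by move=> /HI /Hk.
split.
  apply/almost_surely_dbind; rewrite all_map; apply/allP => x.
  rewrite mem_iota => /andP [_ lx] /=.
  by rewrite (HH x lx).1 orbT.
rewrite expect_dbind /expect big_map.
have -> : iota 0 m = index_iota 0 m by rewrite /index_iota subn0.
rewrite big_mkord.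
have m0' : (m%:R : R) != 0 by rewrite pnatr_eq0 -lt0n.
have -> : al + be * (m%:R^-1 * \sum_(x < m) g (seti s a (evali s i) x)) =
  \sum_(x < m) m%:R^-1 * (al + be * g (seti s a (evali s i) x)).
  rewrite -mulr_sumr big_split /= sumr_const card_ord -mulr_sumr -[al *+ m]mulr_natl.
  by field.
by apply: ler_sum => x _; rewrite ler_wpM2l // ?invr_ge0 ?ler0n //; exact: (HH x _).2.
Qed.

(** [G] is a supermartingale along the iterations, while [Inv i] records the iteration index and so
    forces exactly [n] iterations on every path. The induction is on the number of iterations left;
    each one pays one step for its test, and the last test pays one more. *)
Lemma wp_while e c n (tb : nat -> nat) (Inv : nat -> state R -> Prop)
    (G : nat -> state R -> R) s :
  (forall i s, (i < n)%N -> Inv i s ->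
     evalb s e /\ wp c s (tb i) (Inv i.+1) (G i.+1) (G i s)) ->
  (forall s, Inv n s -> ~~ evalb s e) ->
  Inv 0%N s ->
  wp (While e c) s (\sum_(i < n) (tb i).+1).+1 (Inv n) (G n) (G 0%N s).
Proof.
move=> Hb He I0.
suff H i : (i <= n)%N -> forall s, Inv i s ->
    wp (While e c) s (\sum_(i <= j < n) (tb j).+1).+1 (Inv n) (G n) (G i s).
  by rewrite -(big_mkord xpredT (fun i => (tb i).+1)); apply: H.
move=> lein; rewrite -(subKn lein); have := leq_subr i n; set k := (n - i)%N => lek.
elim: k lek => [|k IH] lek s1 I1.
  rewrite subn0 big_geq //; rewrite subn0 in I1 => k t' Phi al be be0 Hk.
  rewrite add1n; apply: (@ok_step1 _ _ (k, s1)); last exact: Hk.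
  by rewrite /= (negPf (He _ I1)).
have lt : (n - k.+1 < n)%N by lia.
have En : (n - k.+1).+1 = (n - k)%N by lia.
have [eb wb] := Hb _ _ lt I1; rewrite big_ltn // En => k' t' Phi al be be0 Hk.
rewrite addSn; apply: (@ok_step1 _ _ (c :: While e c :: k', s1)); first by rewrite /= eb.
have -> : ((tb (n - k.+1)%N).+1 + \sum_(n - k <= j < n) (tb j).+1 + t' =
  tb (n - k.+1)%N + ((\sum_(n - k <= j < n) (tb j).+1).+1 + t'))%N by lia.
apply: wb => // s2; rewrite En => I2.
exact: (IH (ltnW lek) s2 I2).
Qed.

End Logic.

(** * Counting loops, walks along linked lists, and the arrays they fill *)

Definition iv (a : nat) : iexpr := IGet a (IConst 0).
Definition rv (a : nat) : rexpr := RGet a (IConst 0).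

Definition For (E : nat) (b : iexpr) (c : cmd) : cmd :=
  Seq (SetI E (IConst 0) (IConst 0))
      (While (BLeI (IAdd (iv E) (IConst 1)) b)
             (Seq c (SetI E (IConst 0) (IAdd (iv E) (IConst 1))))).

(* Runs [c] for the elements [e] of a linked list: the cursor [P] holds [e + 1],
   or 0 at the end, and [NX] maps [e] to the next value of the cursor. *)
Definition Walk (P NX : nat) (h : iexpr) (c : cmd) : cmd :=
  Seq (SetI P (IConst 0) h)
      (While (BLeI (IConst 1) (iv P))
             (Seq c (SetI P (IConst 0) (IGet NX (ISub (iv P) (IConst 1)))))).

Fixpoint chain (nx : nat -> nat) (p : nat) (l : seq nat) : Prop :=
  if l is e :: l' then p = e.+1 /\ chain nx (nx e) l' else p = 0%N.

Section Loops.
Variable R : realType.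
Implicit Types (s : state R) (t : nat).

Lemma upd_same (T : Type) (m : nat -> nat -> T) a i v : upd m a i v a i = v.
Proof. by rewrite /upd !eqxx. Qed.

Lemma upd_other (T : Type) (m : nat -> nat -> T) a i v a' : a' != a ->
  upd m a i v a' = m a'.
Proof. by move=> /negPf ne; apply/funext => j; rewrite /upd ne. Qed.

Definition frame (Is Rs : seq nat) (s0 s : state R) : Prop :=
  (forall a, a \notin Is -> imem s a = imem s0 a) /\
  (forall a, a \notin Rs -> rmem s a = rmem s0 a).

Lemma frame_refl Is Rs s : frame Is Rs s s.
Proof. by []. Qed.

Lemma frame_seti Is Rs s0 s a i v : a \in Is -> frame Is Rs s0 s ->
  frame Is Rs s0 (seti s a i v).
Proof.
move=> aI [f1 f2]; split=> // a' na /=; rewrite upd_other ?f1 //.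
by apply: contraNneq na => ->.
Qed.

Lemma frame_setr Is Rs s0 s a i v : a \in Rs -> frame Is Rs s0 s ->
  frame Is Rs s0 (setr s a i v).
Proof.
move=> aI [f1 f2]; split=> // a' na /=; rewrite upd_other ?f2 //.
by apply: contraNneq na => ->.
Qed.

Lemma frame_trans Is Rs Is' Rs' s0 s1 s2 :
  {subset Is' <= Is} -> {subset Rs' <= Rs} ->
  frame Is Rs s0 s1 -> frame Is' Rs' s1 s2 -> frame Is Rs s0 s2.
Proof.
move=> sI sR [f1 f2] [f3 f4]; split=> a na.
  by rewrite f3 ?f1 //; apply: contraNN na => /sI.
by rewrite f4 ?f2 //; apply: contraNN na => /sR.
Qed.

Lemma wp_for E b c n tb (Inv : nat -> state R -> Prop) (G : nat -> state R -> R) s :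
  (forall i s x, Inv i s -> Inv i (seti s E 0 x)) ->
  (forall i s x, G i (seti s E 0 x) = G i s) ->
  (forall i s, Inv i s -> evali s b = n) ->
  (forall i s, (i < n)%N -> Inv i s -> imem s E 0%N = i ->
     wp c s (tb i) (fun s' => Inv i.+1 s' /\ imem s' E 0%N = i) (G i.+1) (G i s)) ->
  Inv 0%N s ->
  wp (For E b c) s (\sum_(i < n) (tb i + 3) + 3) (Inv n) (G n) (G 0%N s).
Proof.
move=> HE GE Hb Hc I0.
have -> : (\sum_(i < n) (tb i + 3) + 3 =
  (1 + (\sum_(i < n) (tb i + 2).+1).+1).+1)%N.
  by rewrite addn3 add1n; do 3 congr S; apply: eq_bigr => i _; rewrite addnS.
apply: (wpd_seq (I1 := fun s' => s' = seti s E 0 0)).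
  exact: wpd_seti.
move=> _ ->; rewrite -(GE 0%N s 0%N).
pose Inv' i s := Inv i s /\ imem s E 0%N = i.
have H := @wp_while R (BLeI (IAdd (iv E) (IConst 1)) b)
  (Seq c (SetI E (IConst 0) (IAdd (iv E) (IConst 1)))) n (fun i => (tb i + 2)%N)
  Inv' G (seti s E 0 0).
apply: wp_weaken (H _ _ _) _ _ _ => //.
- move=> i s1 lt [I1 E1]; split; first by rewrite /= (Hb i) // E1 addn1.
  have -> : (tb i + 2)%N = (tb i + 1).+1 by lia.
  apply: wp_seq (Hc i s1 lt I1 E1) _ => s2 [I2 E2].
  rewrite -(GE i.+1 s2 i.+1).
  have -> : seti s2 E 0 i.+1 = seti s2 E (evali s2 (IConst 0))
    (evali s2 (IAdd (iv E) (IConst 1))) by rewrite /= E2 addn1.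
  apply: wp_seti; rewrite /= E2 addn1; split; first exact: HE.
  by rewrite /= upd_same.
- by move=> s1 [I1 E1]; rewrite /= (Hb n) // E1 addn1 ltnn.
- by split; [exact: HE | rewrite /= upd_same].
- by move=> s1 [].
Qed.

Lemma wpd_for E b c n tb (Inv : nat -> state R -> Prop) s :
  (forall i s x, Inv i s -> Inv i (seti s E 0 x)) ->
  (forall i s, Inv i s -> evali s b = n) ->
  (forall i s, (i < n)%N -> Inv i s -> imem s E 0%N = i ->
     wpd c s (tb i) (fun s' => Inv i.+1 s' /\ imem s' E 0%N = i)) ->
  Inv 0%N s ->
  wpd (For E b c) s (\sum_(i < n) (tb i + 3) + 3) (Inv n).
Proof. by move=> h1 h2 h3 h4; apply: (@wp_for _ _ _ _ _ _ (fun _ _ => 0)). Qed.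

(** Contents of an array after [n] successive writes, the i-th at index [ix i] with a value that may
    depend on the contents so far. Two patterns occur: independent overwriting ([afold_map],
    [afold_const]) and accumulation ([afold_add]). *)
Fixpoint afold (ix : nat -> nat) (vl : (nat -> R) -> nat -> R) (f : nat -> R)
    (n : nat) : nat -> R :=
  if n is n'.+1 then
    let g := afold ix vl f n' in fun j => if j == ix n' then vl g n' else g j
  else f.

Lemma afold_map ix vl f n (F : nat -> R) :
  uniq (mkseq ix n) ->
  (forall i g, (i < n)%N -> g (ix i) = f (ix i) -> vl g i = F (ix i)) ->
  forall j, afold ix vl f n j = if j \in mkseq ix n then F j else f j.
Proof.
elim: n => [//|n IH]; rewrite /mkseq -(addn1 n) iotaD map_cat /= add0n.
rewrite addn1 cat_uniq /= orbF andbT => /andP [u nin] H j.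
have IH' := IH u (fun i g lt => H i g (ltnW lt)).
rewrite mem_cat inE [LHS]/=; have [->|ne] := eqVneq j (ix n).
  by rewrite orbT; apply: H => //; rewrite IH' (negPf nin).
by rewrite orbF IH'.
Qed.

Lemma afold_const ix f n (v : R) j :
  afold ix (fun _ _ => v) f n j = if j \in mkseq ix n then v else f j.
Proof.
elim: n => [//|n IH]; rewrite /mkseq -(addn1 n) iotaD map_cat /= add0n addn1.
by rewrite [LHS]/= IH mem_cat inE orbC; case: eqP.
Qed.

Lemma afold_add ix (h : nat -> R) f n j :
  afold ix (fun g i => g (ix i) + h i) f n j =
  f j + \sum_(i < n | ix i == j) h i.
Proof.
elim: n => [|n IH]; first by rewrite big_ord0 addr0.
rewrite big_mkcond big_ord_recr -big_mkcond /= [j == _]eq_sym.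
by case: (ix n =P j) => [->|_]; rewrite IH ?addr0 ?addrA.
Qed.

Lemma wpd_for_setr E b a idx ex n ix vl s :
  (forall s1, frame [:: E] [:: a] s s1 -> evali s1 b = n) ->
  (forall i s1, (i < n)%N -> frame [:: E] [:: a] s s1 -> imem s1 E 0%N = i ->
     rmem s1 a = afold ix vl (rmem s a) i ->
     evali s1 idx = ix i /\ evalr s1 ex = vl (rmem s1 a) i) ->
  wpd (For E b (SetR a idx ex)) s (n * 4 + 3)
    (fun s' => frame [:: E] [:: a] s s' /\ rmem s' a = afold ix vl (rmem s a) n).
Proof.
move=> Hb Hx.
have -> : (n * 4 + 3 = \sum_(i < n) (1 + 3) + 3)%N by rewrite sum_nat_const card_ord.
apply: (wpd_for (Inv := fun i s' => frame [:: E] [:: a] s s' /\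
  rmem s' a = afold ix vl (rmem s a) i) (tb := fun _ => 1%N)).
- by move=> i s1 x [f1 e1]; split=> //; apply: frame_seti => //; rewrite inE.
- by move=> i s1 [f1 _]; exact: Hb.
- move=> i s1 lt [f1 e1] Ei; apply: wpd_setr; split; last by [].
  have [-> ->] := Hx i s1 lt f1 Ei e1.
  split; first by apply: frame_setr => //; rewrite inE.
  by rewrite /= e1; apply/funext => j; rewrite /upd eqxx /=; case: eqP => // _; rewrite e1.
- by [].
Qed.

Lemma wpd_walk_setr P NX h a idx ex l ix vl s : P != NX ->
  chain (imem s NX) (evali s h) l ->
  (forall i s1, (i < size l)%N -> frame [:: P] [:: a] s s1 ->
     imem s1 P 0%N = (nth 0%N l i).+1 ->
     evali s1 idx = ix (nth 0%N l i) /\ evalr s1 ex = vl (rmem s1 a) (nth 0%N l i)) ->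
  wpd (Walk P NX h (SetR a idx ex)) s (size l * 4 + 3)
    (fun s' => frame [:: P] [:: a] s s' /\
      rmem s' a = afold (fun i => ix (nth 0%N l i))
        (fun g i => vl g (nth 0%N l i)) (rmem s a) (size l)).
Proof.
move=> nP Hch Hx.
have -> : (size l * 4 + 3 = (1 + (\sum_(i < size l) 3.+1).+1).+1)%N.
  by rewrite sum_nat_const card_ord addn3 add1n.
apply: (wpd_seq (I1 := fun s' => s' = seti s P 0 (evali s h))).
  exact: wpd_seti.
move=> _ ->.
pose Inv i s' := [/\ frame [:: P] [:: a] s s',
  rmem s' a = afold (fun i => ix (nth 0%N l i))
        (fun g i => vl g (nth 0%N l i)) (rmem s a) i &
  chain (imem s NX) (imem s' P 0%N) (drop i l)].
have H := @wp_while R (BLeI (IConst 1) (iv P))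
  (Seq (SetR a idx ex) (SetI P (IConst 0) (IGet NX (ISub (iv P) (IConst 1)))))
  (size l) (fun i => 3%N) Inv (fun _ _ => 0) (seti s P 0 (evali s h)).
apply: wp_weaken (H _ _ _) _ _ _ => //.
- move=> i s1 lt [f1 e1]; rewrite (drop_nth 0%N lt) /= => -[EP ch].
  split; first by rewrite EP.
  apply: (@wpd_seq _ _ _ _ 1 1 (fun s' => s' =
     setr s1 a (ix (nth 0%N l i)) (vl (rmem s1 a) (nth 0%N l i)))).
    by apply: wpd_setr; have [-> ->] := Hx i s1 lt f1 EP.
  move=> _ ->; apply: wpd_seti; split.
  + by apply: frame_seti; rewrite ?inE //; apply: frame_setr; rewrite ?inE.
  + by rewrite /= e1; apply/funext => j; rewrite /upd eqxx /=; case: eqP => // _; rewrite e1.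
  + by rewrite /= upd_same EP subn1 /= f1.1 // inE eq_sym.
- by move=> s1 [_ _]; rewrite drop_size /= => ->.
- split=> //; first by apply: frame_seti; rewrite ?inE.
  by rewrite drop0 /= upd_same.
- by move=> s1 [].
Qed.

End Loops.

(** * Analysis of the iteration *)

Fact dotp_key : unit. Proof. exact: tt. Qed.

Section DotProduct.
Variables (R : realType) (d : nat).
Implicit Types (u v w : 'cV[R]_d) (a : R).

Definition dotp u v : R := locked_with dotp_key (\sum_i u i 0 * v i 0).

Lemma dotp_def u v : dotp u v = \sum_i u i 0 * v i 0.
Proof. by rewrite /dotp unlock. Qed.

Lemma dotpC u v : dotp u v = dotp v u.
Proof. by rewrite !dotp_def; apply: eq_bigr => i _; rewrite mulrC. Qed.

Lemma dotpDl u v w : dotp (u + v) w = dotp u w + dotp v w.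
Proof. by rewrite !dotp_def -big_split; apply: eq_bigr => i _; rewrite mxE mulrDl. Qed.

Lemma dotpZl a u v : dotp (a *: u) v = a * dotp u v.
Proof. by rewrite !dotp_def mulr_sumr; apply: eq_bigr => i _; rewrite mxE mulrA. Qed.

Lemma dotpNl u v : dotp (- u) v = - dotp u v.
Proof. by rewrite -scaleN1r dotpZl mulN1r. Qed.

Lemma dotpDr u v w : dotp u (v + w) = dotp u v + dotp u w.
Proof. by rewrite dotpC dotpDl !(dotpC _ u). Qed.

Lemma dotpZr a u v : dotp u (a *: v) = a * dotp u v.
Proof. by rewrite dotpC dotpZl dotpC. Qed.

Lemma dotpNr u v : dotp u (- v) = - dotp u v.
Proof. by rewrite dotpC dotpNl dotpC. Qed.

Definition dotpE := (dotpDl, dotpDr, dotpNl, dotpNr, dotpZl, dotpZr).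

Lemma dotp_ge0 u : 0 <= dotp u u.
Proof. by rewrite dotp_def; apply: sumr_ge0 => i _; rewrite -expr2 sqr_ge0. Qed.

Lemma dotp_eq0 u : (dotp u u == 0) = (u == 0).
Proof.
rewrite dotp_def; apply/eqP/eqP => [H|->]; last by rewrite big1 // => i _; rewrite mxE mul0r.
apply/colP => i; rewrite mxE; apply/eqP; rewrite -sqrf_eq0 expr2; apply/eqP.
by apply: (psumr_eq0P _ H) => // j _; rewrite -expr2 sqr_ge0.
Qed.

Lemma dotp_sumr (I : Type) (r : seq I) (P : pred I) u (F : I -> 'cV[R]_d) :
  dotp u (\sum_(i <- r | P i) F i) = \sum_(i <- r | P i) dotp u (F i).
Proof.
apply: (big_morph (dotp u)) => [v w|]; first exact: dotpDr.
by rewrite dotp_def big1 // => i _; rewrite mxE mulr0.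
Qed.

Lemma dotp_mxE u v : dotp u v = (u^T *m v) 0 0.
Proof. by rewrite dotp_def mxE; apply: eq_bigr => i _; rewrite mxE. Qed.

End DotProduct.

Lemma dotp_adj (R : realType) (n d : nat) (A : 'M[R]_(n, d)) u v :
  dotp (A *m u) v = dotp u (A^T *m v).
Proof. by rewrite !dotp_mxE trmx_mul mulmxA. Qed.

(** The quadratic form of B at t u + v is nonnegative for every t. If its leading coefficient is
    positive, its minimum at t = - b / a gives the inequality; otherwise it is affine in t, which
    forces b = 0. *)
Lemma psd_cauchy_schwarz (R : realType) (d : nat) (B : 'M[R]_d) (u v : 'cV[R]_d) :
  B^T = B -> (forall w, 0 <= dotp w (B *m w)) ->
  dotp u (B *m v) ^+ 2 <= dotp u (B *m u) * dotp v (B *m v).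
Proof.
move=> Bs Bp.
have sym : dotp v (B *m u) = dotp u (B *m v) by rewrite dotpC dotp_adj Bs.
set a := dotp u (B *m u); set b := dotp u (B *m v); set c := dotp v (B *m v).
have H t : 0 <= a * t ^+ 2 + 2 * b * t + c.
  have := Bp (t *: u + v); rewrite mulmxDr -scalemxAr !dotpE sym -/a -/b -/c.
  by congr (0 <= _); ring.
have [a0|a0] := eqVneq a 0.
  have [->|b0] := eqVneq b 0; first by rewrite expr0n a0 mul0r.
  (* At this t the affine function 2 b t + c takes the value -1. *)
  have := H (- (c + 1) / (2 * b)); rewrite a0 mul0r add0r.
  have -> : 2 * b * (- (c + 1) / (2 * b)) + c = -1 by field.
  by move=> ?; lra.
have ap : 0 < a by rewrite lt_def a0 Bp.
have := H (- b / a).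
have -> : a * (- b / a) ^+ 2 + 2 * b * (- b / a) + c = (a * c - b ^+ 2) / a by field.
by rewrite pmulr_lge0 ?invr_gt0 // subr_ge0.
Qed.

(** * The Hessians [lam + ga - A^T A]: one SVRG step and one accelerated step *)

Section Quadratic.
Variables (R : realType) (n d : nat) (A : 'M[R]_(n, d)) (lam mu : R).
Hypothesis mu_gt0 : 0 < mu.
Hypothesis mu_le : mu <= lam.
Hypothesis opA : forall v : 'cV[R]_d, dotp (A *m v) (A *m v) <= (lam - mu) * dotp v v.

Let S (v : 'cV[R]_d) : 'cV[R]_d := A^T *m (A *m v).

(* Locked so that bilinearity of [dotp] does not rewrite inside it. *)
Definition Hm (ga : R) (v : 'cV[R]_d) : 'cV[R]_d :=
  locked_with dotp_key ((lam + ga) *: v - S v).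

Lemma HmE ga v : Hm ga v = (lam + ga) *: v - S v.
Proof. by rewrite /Hm unlock. Qed.

Lemma S_sym u v : dotp u (S v) = dotp v (S u).
Proof. by rewrite /S -!dotp_adj dotpC. Qed.

Lemma dotpS v : dotp v (S v) = dotp (A *m v) (A *m v).
Proof. by rewrite /S -dotp_adj. Qed.

Lemma SD u v : S (u + v) = S u + S v.
Proof. by rewrite /S !mulmxDr. Qed.

Lemma SN u : S (- u) = - S u.
Proof. by rewrite /S !mulmxN. Qed.

Lemma SZ a u : S (a *: u) = a *: S u.
Proof. by rewrite /S -!scalemxAr. Qed.

Let SE := (SD, SN, SZ).

(** By Cauchy-Schwarz |A^T w|^4 = <w, A A^T w>^2 <= |w|^2 |A (A^T w)|^2, and [opA] bounds the last
    factor by a multiple of |A^T w|^2, which cancels. *)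
Lemma opAT (w : 'cV[R]_n) : dotp (A^T *m w) (A^T *m w) <= (lam - mu) * dotp w w.
Proof.
set q := dotp _ _.
have q0 : 0 <= q := dotp_ge0 _.
have [->|qn0] := eqVneq q 0; first by rewrite mulr_ge0 ?dotp_ge0 // subr_ge0.
have I1 w' : (1%:M : 'M[R]_n) *m w' = w' :> 'cV_n by rewrite mul1mx.
have := @psd_cauchy_schwarz R n 1%:M w (A *m (A^T *m w)) (trmx1 _ _).
rewrite !I1 -(dotpC (A *m _)) dotp_adj -/q => H.
have {}H : q ^+ 2 <= dotp w w * ((lam - mu) * q).
  apply: (le_trans (H _)); first by move=> w'; rewrite I1 dotp_ge0.
  by rewrite ler_wpM2l ?dotp_ge0 // opA.
have qp : 0 < q by rewrite lt_def qn0.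
by rewrite -(ler_pM2r qp) -expr2 (le_trans H) // mulrA [dotp w w * _]mulrC.
Qed.

Lemma Hm_ge ga v : (ga + mu) * dotp v v <= dotp v (Hm ga v).
Proof. by rewrite !HmE !dotpE dotpS; have := opA v; lra. Qed.

(** Cocoercivity without diagonalising: as H = (lam + ga) - S, it amounts to <S v, H v> >= 0, that
    is |A^T A v|^2 <= (lam + ga) |A v|^2, which follows from [opAT]. *)
Lemma Hm_sq ga v : 0 <= ga -> dotp (Hm ga v) (Hm ga v) <= (lam + ga) * dotp v (Hm ga v).
Proof.
move=> ga0.
have h : 0 <= dotp (S v) (Hm ga v).
  rewrite !HmE !dotpE (dotpC (S v) v) dotpS.
  have := opAT (A *m v); rewrite -/(S v); have := dotp_ge0 (A *m v).
  set a := dotp (A *m v) _; set b := dotp (S v) _ => a0 H.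
  have : 0 <= (mu + ga) * a by rewrite mulr_ge0 // addr_ge0 // ltW.
  lra.
rewrite [X in dotp X _]HmE dotpDl dotpNl dotpZl; lra.
Qed.

Lemma Hm_le ga v : 0 <= ga -> dotp v (Hm ga v) <= (lam + ga) * dotp v v.
Proof. by move=> ga0; rewrite !HmE !dotpE dotpS; have := dotp_ge0 (A *m v); lra. Qed.

Lemma Hm_norm ga v : 0 <= ga ->
  dotp (Hm ga v) (Hm ga v) <= (lam + ga) ^+ 2 * dotp v v.
Proof.
move=> ga0; apply: (le_trans (Hm_sq _ ga0)); rewrite expr2 -mulrA ler_wpM2l ?Hm_le //.
by have := mu_gt0; have := mu_le; lra.
Qed.

(** Cocoercivity absorbs the quadratic term eta^2 |H u|^2 into half of the linear term 2 eta <u, H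
    u>; the other half contracts by [Hm_ge]. *)
Lemma gradient_step ga eta u : 0 <= ga -> 0 <= eta -> eta * (lam + ga) <= 1 ->
  dotp (u - eta *: Hm ga u) (u - eta *: Hm ga u) <= (1 - eta * ga) * dotp u u.
Proof.
move=> ga0 eta0 eta1; rewrite !dotpE (dotpC (Hm ga u) u).
have H1 := Hm_sq u ga0; have H2 := Hm_ge ga u.
set h := dotp u (Hm ga u) in H1 H2 *; set q := dotp (Hm ga u) _ in H1 *.
have h0 : 0 <= h.
  by apply: le_trans H2; rewrite mulr_ge0 ?dotp_ge0 // addr_ge0 // ltW.
have H3 : eta * (eta * q) <= eta * h.
  rewrite ler_wpM2l //; apply: (@le_trans _ _ (eta * ((lam + ga) * h))).
    by rewrite ler_wpM2l.
  by rewrite mulrA -{2}[h]mul1r ler_wpM2r.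
have H4 : eta * ((ga + mu) * dotp u u) <= eta * h by rewrite ler_wpM2l.
have H5 : 0 <= eta * (mu * dotp u u) by rewrite !mulr_ge0 ?dotp_ge0 // ltW.
lra.
Qed.

(** The second moment of the noise serves in place of its variance: expanding the squares leaves
    |c|^2 + 2 eta <c, e>, which is at most |c + eta e|^2. *)
Lemma variance_bound (N : nat) (xi : 'I_N -> 'cV[R]_d) (c e : 'cV[R]_d) (eta q : R) :
  (0 < N)%N -> N%:R^-1 *: (\sum_i xi i) = e ->
  N%:R^-1 * (\sum_i dotp (xi i) (xi i)) <= q ->
  N%:R^-1 * (\sum_i dotp (c + eta *: xi i) (c + eta *: xi i)) <=
  dotp (c + eta *: e) (c + eta *: e) + eta ^+ 2 * q.
Proof.
move=> N0 He Hq.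
have N0' : (N%:R : R) != 0 by rewrite pnatr_eq0 -lt0n.
have Hs : \sum_i dotp (c + eta *: xi i) (c + eta *: xi i) =
    N%:R * dotp c c + 2 * eta * dotp c (\sum_i xi i) +
    eta ^+ 2 * \sum_i dotp (xi i) (xi i).
  have -> : N%:R * dotp c c = \sum_(i < N) dotp c c.
    by rewrite sumr_const card_ord mulr_natl.
  rewrite dotp_sumr !mulr_sumr -!big_split /=.
  by apply: eq_bigr => i _; rewrite !dotpE (dotpC (xi i) c); ring.
have Hsum : \sum_i xi i = N%:R *: e by rewrite -He scalerA mulfV // scale1r.
rewrite Hs Hsum dotpZr.
have -> : N%:R^-1 * (N%:R * dotp c c + 2 * eta * (N%:R * dotp c e) +
   eta ^+ 2 * \sum_i dotp (xi i) (xi i)) =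
   dotp c c + 2 * eta * dotp c e + eta ^+ 2 * (N%:R^-1 * \sum_i dotp (xi i) (xi i)).
  by field.
have := ler_wpM2l (sqr_ge0 eta) Hq.
rewrite !dotpE (dotpC e c); have := mulr_ge0 (sqr_ge0 eta) (dotp_ge0 e); lra.
Qed.

(** The mean update is a gradient step and gains eta ga. The noise costs eta^2 2 W lam |z - w|^2,
    and |z - w|^2 <= 2 |z - zh|^2 + 2 |w - zh|^2; the condition 32 W lam eta <= ga turns this into
    eta ga / 8 for each of the two errors, whence 7/8 and 1/8. *)
Lemma svrg_step (N : nat) (xi z' : 'I_N -> 'cV[R]_d) (z w y zh bl : 'cV[R]_d)
    (ga eta W : R) :
  (0 < N)%N -> 0 <= ga -> 0 <= eta -> eta * (lam + ga) <= 1 -> 0 <= W ->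
  32 * (W * lam) * eta <= ga ->
  Hm ga zh = ga *: y + S bl ->
  N%:R^-1 *: (\sum_i xi i) = S (z - w) ->
  N%:R^-1 * (\sum_i dotp (xi i) (xi i)) <= 2 * W * dotp (A *m (z - w)) (A *m (z - w)) ->
  (forall i, z' i =
     z - eta *: ((lam + ga) *: z - S (w + bl) - ga *: y) + eta *: xi i) ->
  N%:R^-1 * (\sum_i dotp (z' i - zh) (z' i - zh)) <=
  (1 - 7 / 8 * (eta * ga)) * dotp (z - zh) (z - zh) +
  eta * ga / 8 * dotp (w - zh) (w - zh).
Proof.
move=> N0 ga0 eta0 eta1 W0 etaW Hzh Hxi Hvar z'E.
pose c := z - eta *: ((lam + ga) *: z - S (w + bl) - ga *: y) - zh.
rewrite (eq_bigr (fun i => dotp (c + eta *: xi i) (c + eta *: xi i))); last first.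
  by move=> i _; rewrite z'E /c addrAC.
apply: (le_trans (variance_bound c eta N0 Hxi Hvar)).
(* The mean correction S (z - w) replaces the snapshot by [z] in the gradient, and the gradient
   vanishes at [zh]. *)
have -> : c + eta *: S (z - w) = (z - zh) - eta *: Hm ga (z - zh).
  have -> : Hm ga (z - zh) = Hm ga z - Hm ga zh.
    by rewrite !HmE !SE scalerBr; apply/colP => i; rewrite !mxE; ring.
  rewrite Hzh /c !HmE !SE; apply/colP => i; rewrite !mxE; ring.
have G := gradient_step (z - zh) ga0 eta0 eta1.
have O : dotp (A *m (z - w)) (A *m (z - w)) <=
    lam * (2 * dotp (z - zh) (z - zh) + 2 * dotp (w - zh) (w - zh)).
  apply: (@le_trans _ _ (lam * dotp (z - w) (z - w))).
    by have := opA (z - w); have := mulr_ge0 (ltW mu_gt0) (dotp_ge0 (z - w)); lra.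
  rewrite ler_wpM2l //; first exact: le_trans (ltW mu_gt0) mu_le.
  have -> : z - w = (z - zh) - (w - zh) by rewrite opprB addrA addrNK.
  have := dotp_ge0 ((z - zh) + (w - zh)).
  move: (z - zh) (w - zh) => a b; rewrite !dotpE (dotpC b a); lra.
set P := dotp (z - zh) _ in G O *; set Q := dotp (w - zh) _ in O *.
have PQ : 0 <= P + Q by rewrite addr_ge0 ?dotp_ge0.
have K1 : eta ^+ 2 * (2 * W * dotp (A *m (z - w)) (A *m (z - w))) <=
   eta ^+ 2 * (2 * W * (lam * (2 * P + 2 * Q))).
  by rewrite ler_wpM2l ?sqr_ge0 // ler_wpM2l // mulr_ge0.
have K2 : eta * (32 * (W * lam) * eta) * (P + Q) <= eta * ga * (P + Q).
  by rewrite ler_wpM2r // ler_wpM2l.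
have K3 : eta ^+ 2 * (2 * W * (lam * (2 * P + 2 * Q))) =
  eta * (32 * (W * lam) * eta) * (P + Q) / 8 by field.
lra.
Qed.

Definition lyapunov (ystar x v : 'cV[R]_d) : R :=
  dotp (x - ystar) (Hm 0 (x - ystar)) / 2 + mu / 2 * dotp (v - ystar) (v - ystar).

Lemma lyapunov_ge ys x v : dotp (x - ys) (Hm 0 (x - ys)) <= 2 * lyapunov ys x v.
Proof.
rewrite /lyapunov; have := mulr_ge0 (ltW mu_gt0) (dotp_ge0 (v - ys)); lra.
Qed.

Lemma lyapunov_diag ys x : lyapunov ys x x <= dotp (x - ys) (Hm 0 (x - ys)).
Proof. rewrite /lyapunov; have := Hm_ge 0 (x - ys); lra. Qed.

Lemma HmD ga u v : Hm ga (u + v) = Hm ga u + Hm ga v.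
Proof. by rewrite !HmE SE; apply/colP => i; rewrite !mxE; ring. Qed.

Lemma HmZ ga a v : Hm ga (a *: v) = a *: Hm ga v.
Proof. by rewrite !HmE SE; apply/colP => i; rewrite !mxE; ring. Qed.

Lemma HmN ga v : Hm ga (- v) = - Hm ga v.
Proof. by rewrite -scaleN1r HmZ scaleN1r. Qed.

Lemma Hm_sym ga u v : dotp u (Hm ga v) = dotp v (Hm ga u).
Proof. by rewrite !HmE !dotpE (S_sym u) (dotpC u). Qed.

Lemma Hm_psd ga v : 0 <= ga -> 0 <= dotp v (Hm ga v).
Proof.
move=> ga0; apply: le_trans (Hm_ge ga v).
by rewrite mulr_ge0 ?dotp_ge0 // addr_ge0 // ltW.
Qed.

Section AcceleratedStep.
Variables (ys bl x v y zh : 'cV[R]_d) (ga tau : R).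
Hypothesis tau_gt0 : 0 < tau.
Hypothesis tau_le : tau <= 1 / 2.
Hypothesis ga_tau : 2 * ga * tau ^+ 2 = mu.
Hypothesis ysE : Hm 0 ys = S bl.
Hypothesis yE : (1 + tau) *: y = x + tau *: v.
Hypothesis zhE : Hm ga zh = ga *: y + S bl.

Let ga_gt0 : 0 < ga.
Proof.
have t2 : 0 < 2 * tau ^+ 2 by rewrite mulr_gt0 // exprn_gt0.
by rewrite -(pmulr_lgt0 _ t2) mulrCA mulrA ga_tau.
Qed.

(** The residual is affine in x' with linear part - [Hm ga], and it vanishes at the exact minimiser
    [zh]. This converts the squared distance controlled by SVRG into the residual of the Lyapunov
    estimate. *)
Lemma prox_residual x' r : r = ga *: (y - x') - Hm 0 (x' - ys) ->
  dotp r r <= (lam + ga) ^+ 2 * dotp (x' - zh) (x' - zh).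
Proof.
move=> rE; have -> : r = - Hm ga (x' - zh).
  rewrite rE HmD HmN HmD HmN ysE zhE !HmE; apply/colP => i; rewrite !mxE; ring.
by rewrite dotpNl dotpNr opprK; apply: Hm_norm; exact: ltW.
Qed.

Lemma accelerated_step x' v' :
  v' = (1 - tau) *: v + tau *: x' - (tau / mu) *: (lam *: x' - S (x' + bl)) ->
  lyapunov ys x' v' <=
  (1 - tau) * lyapunov ys x v + (lam + ga) ^+ 2 / ga * dotp (x' - zh) (x' - zh).
Proof.
set g0 := lam *: x' - _ => v'E0.
(* Opaque names keep [dotpE] from expanding the differences, so that [key] is an identity in a few
   inner products. *)
have [X XE] : exists X, X = x - ys by exists (x - ys).
have [V VE] : exists V, V = v - ys by exists (v - ys).
have [X' X'E] : exists X', X' = x' - ys by exists (x' - ys).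
pose g := Hm 0 X'.
have gE : g0 = g.
  rewrite /g X'E HmD HmN ysE /g0 !HmE addr0 SD; apply/colP => i; rewrite !mxE; ring.
have v'E : v' - ys = (1 - tau) *: V + tau *: X' - (tau / mu) *: g.
  rewrite v'E0 gE VE X'E; apply/colP => i; rewrite !mxE; ring.
have [r rE] : exists r, r = ga *: (y - x') - g by exists (ga *: (y - x') - g).
have R1 : dotp r r <= (lam + ga) ^+ 2 * dotp (x' - zh) (x' - zh).
  by apply: prox_residual; rewrite rE /g X'E.
have mu0 : mu != 0 by rewrite gt_eqF.
have ga0 : ga != 0 by rewrite gt_eqF.
have yx : (1 + tau) *: (x' - y) = (1 + tau) *: X' - X - tau *: V.
  by rewrite scalerBr yE X'E XE VE; apply/colP => i; rewrite !mxE; ring.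
have yr : ga *: (x' - y) = - g - r.
  by rewrite rE; apply/colP => i; rewrite !mxE; ring.
(* The subtracted terms are nonnegative convexity slacks. The definitions of y and v' are such that
   the remaining cross terms assemble into the product of g with (1 + tau) (x' - y), and the
   proximal equation makes x' - y equal to - (g + r) / ga. *)
have key : lyapunov ys x' v' = (1 - tau) * lyapunov ys x v
  - (1 - tau) / 2 * dotp (X - X') (Hm 0 (X - X'))
  - tau / 2 * (dotp X' (Hm 0 X') - mu * dotp X' X')
  - mu * tau * (1 - tau) / 2 * dotp (V - X') (V - X')
  + (1 - tau) * dotp g ((1 + tau) *: (x' - y)) + tau ^+ 2 / (2 * mu) * dotp g g.
  rewrite yx /lyapunov v'E -X'E -VE -XE HmD HmN -/g !dotpE.
  rewrite (dotpC X' V) (dotpC g X') (dotpC g V) (dotpC g X).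
  have -> : dotp X' (Hm 0 X) = dotp X g by rewrite Hm_sym.
  by field.
have E2 : dotp g (x' - y) = - (dotp g g + dotp g r) / ga.
  apply: (mulfI ga0); rewrite -dotpZr yr !dotpE; field => //.
have E3 : tau ^+ 2 / (2 * mu) = 1 / (4 * ga).
  by rewrite -ga_tau; field; rewrite ga0 gt_eqF.
have h1 := Hm_psd (X - X') (lexx 0).
have h2 : 0 <= dotp X' (Hm 0 X') - mu * dotp X' X'.
  by have := Hm_ge 0 X'; rewrite add0r subr_ge0.
have h3 := dotp_ge0 (V - X').
have t1 : 0 <= 1 - tau by move: tau_le; lra.
have h4 : 0 <= (1 - tau) / 2 * dotp (X - X') (Hm 0 (X - X')).
  by rewrite mulr_ge0 // divr_ge0.
have h5 : 0 <= tau / 2 * (dotp X' (Hm 0 X') - mu * dotp X' X').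
  by rewrite mulr_ge0 // divr_ge0 // ltW.
have h6 : 0 <= mu * tau * (1 - tau) / 2 * dotp (V - X') (V - X').
  by rewrite mulr_ge0 // divr_ge0 // !mulr_ge0 // ltW.
rewrite key dotpZr E2 E3.
have h7 : (1 - tau) * ((1 + tau) * (- (dotp g g + dotp g r) / ga)) +
   1 / (4 * ga) * dotp g g <= dotp r r / ga.
  rewrite -subr_ge0.
  (* A sum of squares whose three coefficients are nonnegative because tau <= 1/2. *)
  have -> : dotp r r / ga - ((1 - tau) * ((1 + tau) * (- (dotp g g + dotp g r) / ga)) +
   1 / (4 * ga) * dotp g g) = ((1 - tau ^+ 2) / 2 * dotp (g + r) (g + r)
     + (1 + tau ^+ 2) / 2 * dotp r r + (1 / 4 - tau ^+ 2 / 2) * dotp g g) / ga.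
    by rewrite !dotpE (dotpC r g); field.
  have t2 : tau ^+ 2 <= 1 / 4.
    have : 0 <= (1 / 2 - tau) * (1 / 2 + tau) by move: tau_gt0 tau_le => *; rewrite mulr_ge0 //; lra.
    by rewrite expr2; lra.
  have t3 : 0 <= tau ^+ 2 by rewrite sqr_ge0.
  apply: divr_ge0 (ltW ga_gt0); rewrite !addr_ge0 // mulr_ge0 ?dotp_ge0 //; lra.
have h8 : dotp r r / ga <= (lam + ga) ^+ 2 / ga * dotp (x' - zh) (x' - zh).
  by rewrite mulrAC ler_wpM2r // invr_ge0 ltW.
lra.
Qed.

(** SVRG starts at y. With e = y - zh and u = y - ys one has [Hm ga e = Hm 0 u], and nonnegativity
    of the form at e - u gives 2 ga |e|^2 <= <u, Hm 0 u>. As y is a convex combination of x and v,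
    the latter is bounded by convexity; bounding the form at v by lam |v - ys|^2 costs the factor
    lam / mu. *)
Lemma prox_start : dotp (y - zh) (y - zh) <= lam / (mu * ga) * lyapunov ys x v.
Proof.
have [e eE] : exists e, e = y - zh by exists (y - zh).
have [u uE0] : exists u, u = y - ys by exists (y - ys).
have He : Hm ga e = Hm 0 u.
  rewrite eE uE0 !HmD !HmN zhE ysE !HmE; apply/colP => i; rewrite !mxE; ring.
have e1 : ga * dotp e e <= dotp u (Hm 0 u) / 2.
  have h : dotp e (Hm ga e) = dotp e (Hm 0 u) by rewrite He.
  have h' : dotp e (Hm ga e) = dotp e (Hm 0 e) + ga * dotp e e.
    by rewrite !HmE !dotpE; ring.
  have := Hm_psd (e - u) (lexx 0); rewrite HmD HmN !dotpE (Hm_sym 0 u e) -h h'.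
  have := Hm_psd e (lexx 0); lra.
have t1 : 0 < 1 + tau by move: tau_gt0; lra.
have uE : (1 + tau) *: u = (x - ys) + tau *: (v - ys).
  by rewrite uE0 scalerBr yE; apply/colP => i; rewrite !mxE; ring.
have lm : 1 <= lam / mu by rewrite ler_pdivlMr // mul1r.
have e2 : dotp u (Hm 0 u) <= 2 * (lam / mu) * lyapunov ys x v.
  have [X XE] : exists X, X = x - ys by exists (x - ys).
  have [V VE] : exists V, V = v - ys by exists (v - ys).
  have h : (1 + tau) ^+ 2 * dotp u (Hm 0 u) =
     dotp (X + tau *: V) (Hm 0 (X + tau *: V)).
    by rewrite XE VE -uE HmZ dotpZl dotpZr; ring.
  have h1 : dotp (X + tau *: V) (Hm 0 (X + tau *: V)) <=
     (1 + tau) * (dotp X (Hm 0 X) + tau * dotp V (Hm 0 V)).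
    have := mulr_ge0 (ltW tau_gt0) (Hm_psd (X - V) (lexx 0)).
    rewrite !HmD !HmN HmZ !dotpE (Hm_sym 0 V X); lra.
  have h2 : (1 + tau) * dotp u (Hm 0 u) <= dotp X (Hm 0 X) + tau * dotp V (Hm 0 V).
    by rewrite -(ler_pM2l t1) mulrA -expr2 h.
  have h3 := Hm_le V (lexx 0); rewrite addr0 in h3.
  have XX := Hm_psd X (lexx 0).
  have h4 : dotp X (Hm 0 X) <= (lam / mu) * dotp X (Hm 0 X).
    by rewrite -{1}[dotp X _]mul1r ler_wpM2r.
  have h5 : 2 * (lam / mu) * lyapunov ys x v = (lam / mu) * dotp X (Hm 0 X) +
     lam * dotp V V.
    by rewrite /lyapunov -XE -VE; field; rewrite gt_eqF.
  rewrite h5; apply: (@le_trans _ _ (dotp X (Hm 0 X) + lam * dotp V V)); last by lra.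
  have VV : 0 <= lam * dotp V V.
    by rewrite mulr_ge0 ?dotp_ge0 // (le_trans (ltW mu_gt0)).
  have u0 := Hm_psd u (lexx 0).
  have := mulr_ge0 (ltW tau_gt0) u0; have := ler_wpM2l (ltW tau_gt0) h3.
  have : tau * (lam * dotp V V) <= 1 * (lam * dotp V V) by rewrite ler_wpM2r //; move: tau_le; lra.
  lra.
have -> : lam / (mu * ga) * lyapunov ys x v = (lam / mu * lyapunov ys x v) / ga.
  by field; rewrite !gt_eqF.
by rewrite -eE ler_pdivlMr // mulrC; apply: (le_trans e1); lra.
Qed.

End AcceleratedStep.
End Quadratic.

(** * The spectral norm *)

Section Frobenius.
Variables (R : realType) (n d : nat).
Implicit Types (v : 'cV[R]_d).

Lemma norm2_sq (m : nat) (v : 'cV[R]_m) : norm2 v ^+ 2 = dotp v v.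
Proof.
rewrite /norm2 sqr_sqrtr; first by rewrite dotp_def; apply: eq_bigr => i _; rewrite expr2.
by apply: sumr_ge0 => i _; rewrite sqr_ge0.
Qed.

Lemma frobenius_norm_sq (A : 'M[R]_(n, d)) :
  frobenius_norm A ^+ 2 = \sum_i \sum_j A i j ^+ 2.
Proof.
by rewrite sqr_sqrtr // sumr_ge0 // => i _; rewrite sumr_ge0 // => j _; rewrite sqr_ge0.
Qed.

Lemma cauchy_schwarz (m : nat) (u v : 'cV[R]_m) : dotp u v ^+ 2 <= dotp u u * dotp v v.
Proof.
have := @psd_cauchy_schwarz R m 1%:M u v (trmx1 _ _); rewrite !mul1mx; apply.
by move=> w; rewrite mul1mx dotp_ge0.
Qed.

Lemma frobenius_bound (A : 'M[R]_(n, d)) v :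
  dotp (A *m v) (A *m v) <= frobenius_norm A ^+ 2 * dotp v v.
Proof.
rewrite frobenius_norm_sq mulr_suml dotp_def; apply: ler_sum => i _.
have -> : (A *m v) i 0 = dotp (\col_j A i j) v.
  by rewrite mxE dotp_def; apply: eq_bigr => j _; rewrite mxE.
rewrite -expr2; apply: (le_trans (cauchy_schwarz _ _)); rewrite ler_wpM2r ?dotp_ge0 //.
by rewrite dotp_def; apply: ler_sum => j _; rewrite mxE expr2.
Qed.

End Frobenius.

Section Spectral.
Variables (R : realType) (n d : nat).
Implicit Types (v : 'cV[R]_d).

Lemma norm2_ge0 (m : nat) (v : 'cV[R]_m) : 0 <= norm2 v.
Proof. exact: sqrtr_ge0. Qed.

Lemma norm2_eq1 v : norm2 v = 1 <-> dotp v v = 1.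
Proof.
rewrite -norm2_sq; split=> [->|/eqP]; first by rewrite expr1n.
rewrite sqrf_eq1 => /orP [/eqP //|/eqP E].
by have := norm2_ge0 v; rewrite E => ?; lra.
Qed.

Lemma spectral_norm_bound (A : 'M[R]_(n, d)) v :
  dotp (A *m v) (A *m v) <= spectral_norm A ^+ 2 * dotp v v.
Proof.
have [->|v0] := eqVneq v 0.
  have z0 : dotp (0 : 'cV[R]_n) 0 = 0 by apply/eqP; rewrite dotp_eq0.
  by rewrite mulmx0 z0 mulr_ge0 ?sqr_ge0 ?dotp_ge0.
have v1 : 0 < dotp v v by rewrite lt_def dotp_eq0 v0 dotp_ge0.
set c := norm2 v.
have c2 : c ^+ 2 = dotp v v := norm2_sq v.
have c0 : 0 < c.
  rewrite lt_def norm2_ge0 andbT; apply: contraTneq v1 => c0.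
  by rewrite -c2 c0 expr0n ltxx.
have c0' : c != 0 by rewrite gt_eqF.
pose u := c^-1 *: v.
have vu : v = c *: u by rewrite /u scalerA mulfV // scale1r.
have u1 : dotp u u = 1 by rewrite /u dotpZl dotpZr -c2; field.
have H : norm2 (A *m u) <= spectral_norm A.
  apply: ub_le_sup; last by exists u => //; apply/norm2_eq1.
  exists (frobenius_norm A) => _ [w /norm2_eq1 w1 <-].
  rewrite -(@ler_pXn2r _ 2) // ?nnegrE ?norm2_ge0 ?sqrtr_ge0 //.
  by rewrite norm2_sq (le_trans (frobenius_bound A w)) // w1 mulr1.
rewrite -c2 {1 2}vu -scalemxAr dotpZl dotpZr mulrA -expr2 mulrC ler_wpM2r ?sqr_ge0 //.
rewrite -norm2_sq; rewrite ler_pXn2r // ?nnegrE ?norm2_ge0 //.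
exact: le_trans (norm2_ge0 _) H.
Qed.

Lemma spectral_norm_le (A : 'M[R]_(n, d)) (c : R) : 0 <= c ->
  (forall v, dotp (A *m v) (A *m v) <= c * dotp v v) -> spectral_norm A ^+ 2 <= c.
Proof.
move=> c0 H; rewrite /spectral_norm; set E := image _ _.
have ub : ubound E (Num.sqrt c).
  move=> _ [w /norm2_eq1 w1 <-].
  rewrite -(@ler_pXn2r _ 2) // ?nnegrE ?norm2_ge0 ?sqrtr_ge0 //.
  by rewrite norm2_sq sqr_sqrtr // (le_trans (H w)) // w1 mulr1.
(* Without unit vectors, that is for d = 0, the supremum is taken over the empty set and equals
   0. *)
have [[x1 [w w1 _]]|E0] := pselect (E !=set0)%classic; last first.
  by move/set0P: E0 => /negP; rewrite negbK => /eqP ->; rewrite sup0 expr0n.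
have Ew : E (norm2 (A *m w)) by exists w.
have hub : has_ubound E by exists (Num.sqrt c).
have s0 : 0 <= sup E by apply: le_trans (norm2_ge0 _) (ub_le_sup hub Ew).
have s1 : sup E <= Num.sqrt c by apply: ge_sup => //; exists (norm2 (A *m w)).
by rewrite -(sqr_sqrtr c0) !expr2; exact: ler_pM.
Qed.

Lemma gram_eigen (A : 'M[R]_(n, d)) (a : R) : eigenvalue (A^T *m A) a ->
  exists2 v, v != 0 & dotp (A *m v) (A *m v) = a * dotp v v.
Proof.
move=> /eigenvalueP [w wE w0]; exists w^T.
  by apply: contra_neq w0 => E; rewrite -[w]trmxK E trmx0.
rewrite dotp_adj -dotpZr; congr (dotp _ _).
by rewrite mulmxA -linearZ /= -wE trmx_mul trmx_mul trmxK.
Qed.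

(* If [s] is the squared spectral norm then [s - A^T A] is positive semidefinite
   but not uniformly positive definite; being symmetric, it is then singular. *)
Lemma spectral_norm_eigen (A : 'M[R]_(n, d)) : (0 < d)%N ->
  eigenvalue (A^T *m A) (spectral_norm A ^+ 2).
Proof.
move=> d0; set t := spectral_norm A ^+ 2; set M := A^T *m A.
apply: contraT => neig.
pose N := t%:M - M.
have Nu : N \in unitmx.
  move: neig; rewrite /eigenvalue negbK kermx_eq0 row_free_unit.
  by rewrite -opprB -scaleN1r unitmxZ ?unitrN1.
have NE v : dotp v (N *m v) = t * dotp v v - dotp (A *m v) (A *m v).
  by rewrite /N mulmxBl mul_scalar_mx dotpDr dotpNr dotpZr /M -mulmxA -dotp_adj.
have Np v : 0 <= dotp v (N *m v) by rewrite NE subr_ge0 spectral_norm_bound.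
have Ns : N^T = N.
  by rewrite /N linearB /= tr_scalar_mx /M trmx_mul trmxK.
have t0 : 0 <= t by rewrite sqr_ge0.
have N2 v : dotp (N *m v) (N *m v) <= t * dotp v (N *m v).
  have := psd_cauchy_schwarz (N *m v) v Ns Np; set q := dotp (N *m v) (N *m v).
  have q0 : 0 <= q := dotp_ge0 _.
  have [->|qn0] := eqVneq q 0; first by rewrite mulr_ge0.
  have qp : 0 < q by rewrite lt_def qn0.
  move=> H; rewrite -(ler_pM2r qp) -expr2 (le_trans H) // mulrAC ler_wpM2r //.
  by rewrite NE lerBlDr lerDl dotp_ge0.
(* With [N2] this gives |v|^2 <= F |N v|^2 <= F t <v, N v>; the 1 added in [C] makes it positive.
   Then |A v|^2 <= (t - 1 / C) |v|^2, below the least possible bound t. *)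
pose F := frobenius_norm (invmx N) ^+ 2.
have F0 : 0 <= F by rewrite sqr_ge0.
pose C := F * t + 1.
have C0 : 0 < C by rewrite ltr_wpDl // mulr_ge0.
have lower v : dotp v v <= C * dotp v (N *m v).
  apply: (@le_trans _ _ (F * t * dotp v (N *m v))); last first.
    by rewrite ler_wpM2r // lerDl.
  apply: (@le_trans _ _ (F * dotp (N *m v) (N *m v))); last first.
    by rewrite -mulrA ler_wpM2l.
  by have := frobenius_bound (invmx N) (N *m v); rewrite mulKmx.
have : spectral_norm A ^+ 2 <= t - C^-1.
  apply: spectral_norm_le => [|v].
    (* [spectral_norm_le] asks for a nonnegative bound; testing on a unit vector shows t - 1 / C >=
       0. *)
    pose e : 'cV[R]_d := delta_mx (Ordinal d0) 0.
    have e1 : dotp e e = 1.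
      rewrite dotp_def (bigD1 (Ordinal d0)) //= big1 ?addr0 => [|i /negPf ni].
        by rewrite mxE !eqxx mulr1.
      by rewrite mxE ni mul0r.
    have := lower e; rewrite NE e1 mulr1 -ler_pdivrMl // mulr1.
    by have := dotp_ge0 (A *m e); lra.
  have := lower v; rewrite NE -ler_pdivrMl //; lra.
by rewrite -/t lerBrDr gerDl leNgt invr_gt0 C0.
Qed.

(** An eigenvector bounds every eigenvalue by the squared spectral norm, and [spectral_norm_eigen]
    puts that number in the list, so sortedness makes it the head. *)
Lemma gram_spectrum (A : 'M[R]_(n, d)) (eig : seq R) : (2 <= d)%N ->
  sorted_eigenvalues (A^T *m A) eig ->
  [/\ eig`_0 = spectral_norm A ^+ 2, 0 <= eig`_1 & 0 <= eig`_0].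
Proof.
move=> d2 [srt cp].
have sz : size eig = d.
  by have := size_char_poly (A^T *m A); rewrite cp size_prod_XsubC => -[].
have egE a : eigenvalue (A^T *m A) a = (a \in eig).
  by rewrite eigenvalue_root_char cp root_prod_XsubC.
have eg_ge0 a : a \in eig -> 0 <= a.
  rewrite -egE => /gram_eigen [v v0 E].
  have v1 : 0 < dotp v v by rewrite lt_def dotp_eq0 v0 dotp_ge0.
  by rewrite -(pmulr_lge0 _ v1) -E dotp_ge0.
have e0 : eig`_0 \in eig by rewrite mem_nth // sz ltnW.
have e1 : eig`_1 \in eig by rewrite mem_nth // sz.
split; [|exact: eg_ge0|exact: eg_ge0].
apply/eqP; rewrite eq_le; apply/andP; split.
  move: e0; rewrite -egE => /gram_eigen [v v0 E].
  have v1 : 0 < dotp v v by rewrite lt_def dotp_eq0 v0 dotp_ge0.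
  by rewrite -(ler_pM2r v1) -E spectral_norm_bound.
have := spectral_norm_eigen A (ltnW d2); rewrite egE.
case: eig srt {cp sz egE eg_ge0 e0 e1} => [//|a l] /= srt.
rewrite inE => /orP [/eqP -> //|].
have tr : transitive (>=%O : rel R) by move=> x y z h1 h2; apply: le_trans h2 h1.
by move/allP: (order_path_min tr srt); apply.
Qed.

End Spectral.

(** * The program: inner loop *)

(* Memory layout, beyond the input arrays.
   Index arrays: 4 = next and 5 = head of the linked lists of the rows, 6 = mark
   of the columns seen, 7 = list of the nonzero columns and 8 = its length,
   9 = slot table and 10 = its length, 11 = M, 12 = N, 13 = K, 14-21 = counters.
   Real arrays: 4 = W, 5 = nnz(A), 6 = slots still due, 7 = number of slots of
   each row, 8 = number of slots, 9 = M, 10 = N, 11 = power of 2, 12 = mu,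
   13 = gamma, 14 = eta, 16 = v, 17 = y, 18 = z, 19 = snapshot w,
   20 = Sigma (w + b / lambda), 21 = A (w + b / lambda), 23 = a_r . (z - w).
   The vectors 16-20 stand for x - b / lambda and vanish off the nonzero columns,
   so that no loop has to visit a zero column. *)
Definition valE : rexpr := RGet 1 (iv 14).
Definition rowE : iexpr := IGet 1 (iv 14).
Definition colE : iexpr := IGet 2 (iv 14).
Definition jE : iexpr := IGet 7 (iv 15).
Definition lamE : rexpr := rv 0.
Definition nnzE : iexpr := IGet 0 (IConst 2).
Definition pE : iexpr := ISub (iv 16) (IConst 1).

Definition Map (a : nat) (ex : rexpr) : cmd := For 15 (iv 8) (SetR a jE ex).

(** Every loop runs over nonzero columns or over entries. In particular the product with A in array
    21 is cleared by visiting the row of each entry, so zero rows cost nothing. *)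
Definition Snap : cmd :=
  Seq (Map 19 (RGet 18 jE))
 (Seq (Map 20 (RConst 0))
 (Seq (For 14 nnzE (SetR 21 rowE (RConst 0)))
 (Seq (For 14 nnzE (SetR 21 rowE (RAdd (RGet 21 rowE)
         (RMul valE (RAdd (RGet 19 colE) (RDiv (RGet 2 colE) lamE))))))
      (For 14 nnzE (SetR 20 colE (RAdd (RGet 20 colE) (RMul valE (RGet 21 rowE)))))))).

(** A uniform slot selects its row with probability proportional to its slot count; [rv 8] divided
    by the entry of array 7 is the inverse probability. The inner product with z - w is taken before
    the dense update overwrites z. *)
Definition Step : cmd :=
  Seq (RandI 17 (IConst 0) (iv 10))
 (Seq (SetI 17 (IConst 0) (IGet 9 (iv 17)))
 (Seq (SetR 23 (IConst 0) (RConst 0))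
 (Seq (Walk 16 4 (IGet 5 (iv 17)) (SetR 23 (IConst 0)
        (RAdd (rv 23) (RMul (RGet 1 pE)
           (RSub (RGet 18 (IGet 2 pE)) (RGet 19 (IGet 2 pE)))))))
 (Seq (Map 18 (RSub (RGet 18 jE) (RMul (rv 14)
        (RSub (RSub (RMul (RAdd lamE (rv 13)) (RGet 18 jE)) (RGet 20 jE))
              (RMul (rv 13) (RGet 17 jE))))))
      (Walk 16 4 (IGet 5 (iv 17)) (SetR 18 (IGet 2 pE)
        (RAdd (RGet 18 (IGet 2 pE))
           (RMul (RMul (rv 14) (RDiv (rv 8) (RGet 7 (iv 17))))
                 (RMul (RGet 1 pE) (rv 23)))))))))).

Section Data.
Variables (R : realType) (N : nat) (re ce : nat -> nat) (ae : nat -> R).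
Variables (Cl SL : seq nat) (lam : R) (b : nat -> R).

(** Reversed because the linking pass pushes each entry at the head of the list of its row. *)
Definition rowlist (m r : nat) : seq nat := rev [seq e <- iota 0 m | re e == r].

Record Data (s : state R) : Prop := MkData {
  d_nnz : imem s 0 2 = N;
  d_row : imem s 1 = re;
  d_col : imem s 2 = ce;
  d_val : rmem s 1 = ae;
  d_b : rmem s 2 = b;
  d_lam : rmem s 0 0 = lam }.

Record Table (s : state R) : Prop := MkTable {
  d_D : imem s 8 0 = size Cl;
  d_Cl : forall i, (i < size Cl)%N -> imem s 7 i = nth 0%N Cl i;
  d_chain : forall r, chain (imem s 4) (imem s 5 r) (rowlist N r);
  d_S : imem s 10 0 = size SL;
  d_SL : forall i, (i < size SL)%N -> imem s 9 i = nth 0%N SL i;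
  d_Sr : rmem s 8 0 = (size SL)%:R;
  d_cnt : forall r, rmem s 7 r = (count_mem r SL)%:R }.

Lemma Data_frame Is Rs s0 s : all [pred a | a \notin Is] [:: 0; 1; 2]%N ->
  all [pred a | a \notin Rs] [:: 0; 1; 2]%N ->
  frame Is Rs s0 s -> Data s0 -> Data s.
Proof.
move=> /= /and4P [i0 i1 i2 _] /and4P [r0 r1 r2 _] [f1 f2] [].
by move=> *; split; rewrite ?f1 ?f2.
Qed.

Lemma Table_frame Is Rs s0 s : all [pred a | a \notin Is] [:: 4; 5; 7; 8; 9; 10]%N ->
  all [pred a | a \notin Rs] [:: 7; 8]%N ->
  frame Is Rs s0 s -> Table s0 -> Table s.
Proof.
move=> /= /and5P [? ? ? ? /and3P [? ? _]] /and3P [? ? _] [f1 f2] [].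
by move=> *; split=> *; rewrite ?f1 ?f2 //; auto.
Qed.

Definition supp (f : nat -> R) : Prop := forall j, j \notin Cl -> f j = 0.

Hypothesis Cl_uniq : uniq Cl.
Hypothesis Cl_ce : forall e, (e < N)%N -> ce e \in Cl.

(** Since [Cl] has no repetitions, cell j still holds its old value when it is visited; off [Cl]
    both the old array and F are 0, so the result equals F everywhere. *)
Lemma wpd_map s a ex (F : nat -> R) : Table s -> supp (rmem s a) -> supp F ->
  (forall s1 j, frame [:: 15%N] [:: a] s s1 -> j \in Cl ->
     imem s1 7 (imem s1 15 0) = j -> rmem s1 a j = rmem s a j -> evalr s1 ex = F j) ->
  wpd (Map a ex) s (size Cl * 4 + 3)
    (fun s' => frame [:: 15%N] [:: a] s s' /\ rmem s' a = F).
Proof.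
move=> T sa sF Hex.
have f7 s1 : frame [:: 15%N] [:: a] s s1 -> imem s1 7 = imem s 7 by move=> f; rewrite f.1.
have f8 s1 : frame [:: 15%N] [:: a] s s1 -> imem s1 8 = imem s 8 by move=> f; rewrite f.1.
pose ix i := nth 0%N Cl i.
have mk i : (i <= size Cl)%N -> mkseq ix i = take i Cl.
  move=> le; apply: (@eq_from_nth _ 0%N); rewrite size_mkseq ?size_takel // => k lt.
  by rewrite nth_mkseq // nth_take.
have af i j : (i <= size Cl)%N -> afold ix (fun _ k => F (ix k)) (rmem s a) i j =
    if j \in take i Cl then F j else rmem s a j.
  by move=> le; rewrite -mk //; apply: afold_map => //; rewrite mk // take_uniq.
apply: wpd_weaken (wpd_for_setr (n := size Cl) (ix := ix)
  (vl := fun _ i => F (ix i)) _ _) _ _ => //.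
- by move=> s1 f1 /=; rewrite f8 // (d_D T).
- move=> i s1 lt f1 Ei Ea.
  have E7 : imem s1 7 (imem s1 15 0) = ix i by rewrite Ei (f7 _ f1) (d_Cl T lt).
  split; first exact: E7.
  apply: (Hex s1) => //; first exact: mem_nth.
  rewrite Ea af 1?ltnW //; case: ifP => // /(nthP 0%N) [k].
  rewrite (size_takel (ltnW lt)) => ltk; rewrite nth_take // => /eqP.
  by rewrite nth_uniq // ?(ltn_trans ltk) // (ltn_eqF ltk).
- move=> s1 [f1 E]; split=> //; rewrite E; apply/funext => j.
  by rewrite af // take_size; case: ifPn => // nj; rewrite sa // sF.
Qed.

Lemma sum_rowlist (F : nat -> R) (P : pred nat) m r :
  \sum_(i < size (rowlist m r) | P (nth 0%N (rowlist m r) i)) F (nth 0%N (rowlist m r) i) =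
  \sum_(e < m | (re e == r) && P e) F e.
Proof.
rewrite -(big_mkord (fun i => P (nth 0%N (rowlist m r) i))
  (fun i => F (nth 0%N (rowlist m r) i))).
rewrite -(big_nth 0%N P F) /rowlist.
have -> : \sum_(e <- rev [seq e <- iota 0 m | re e == r] | P e) F e =
    \sum_(e <- [seq e <- iota 0 m | re e == r] | P e) F e.
  by apply: perm_big; rewrite perm_rev.
rewrite big_filter_cond.
have -> : iota 0 m = index_iota 0 m by rewrite /index_iota subn0.
by rewrite big_mkord.
Qed.

Definition rowdot (f : nat -> R) (r : nat) : R :=
  \sum_(e < N | re e == r) ae e * f (ce e).

Definition gram (f : nat -> R) (j : nat) : R :=
  \sum_(e < N | ce e == j) ae e * rowdot f (re e).

Lemma supp_gram f : supp (gram f).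
Proof.
move=> j nj; rewrite /gram big1 // => e /eqP ej; case/negP: nj.
by rewrite -ej; exact: Cl_ce.
Qed.

Lemma wpd_snap s : Data s -> Table s -> supp (rmem s 18) -> supp (rmem s 19) ->
  supp (rmem s 20) ->
  wpd Snap s (size Cl * 8 + N * 12 + 19)
    (fun s' => [/\ frame [:: 14; 15]%N [:: 19; 20; 21]%N s s',
       rmem s' 19 = rmem s 18 &
       rmem s' 20 = gram (fun j => rmem s 18 j + b j / lam)]).
Proof.
move=> D T s18 s19 s20.
have -> : (size Cl * 8 + N * 12 + 19 = ((size Cl * 4 + 3) + ((size Cl * 4 + 3) +
  ((N * 4 + 3) + ((N * 4 + 3) + (N * 4 + 3)).+1).+1).+1).+1)%N by lia.
apply: wpd_seq (wpd_map (F := rmem s 18) T s19 s18 _) _.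
  by move=> s1 j f1 jC E7 _; rewrite /= E7 f1.2.
move=> s1 [f1 e1].
have D1 : Data s1 by apply: Data_frame f1 D.
have T1 : Table s1 by apply: Table_frame f1 T.
apply: wpd_seq (wpd_map (F := fun _ => 0) T1 _ _ _) _ => //.
  by rewrite f1.2.
move=> s2 [f2 e2].
have D2 : Data s2 by apply: Data_frame f2 D1.
apply: wpd_seq (wpd_for_setr (n := N) (ix := re) (vl := fun _ _ => 0) _ _) _.
- by move=> s3 f3 /=; rewrite f3.1 // (d_nnz D2).
- by move=> i s3 lt f3 Ei _; rewrite /= Ei f3.1 // (d_row D2).
move=> s3 [f3 e3].
have D3 : Data s3 by apply: Data_frame f3 D2.
have w3 : rmem s3 19 = rmem s 18 by rewrite f3.2 // f2.2 // e1.
apply: wpd_seq (wpd_for_setr (n := N) (ix := re) (vl := fun g i => g (re i) +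
   ae i * (rmem s 18 (ce i) + b (ce i) / lam)) _ _) _.
- by move=> s4 f4 /=; rewrite f4.1 // (d_nnz D3).
- move=> i s4 lt f4 Ei _; rewrite /= Ei !f4.1 // !(f4.2 1) // !(f4.2 19) //.
  by rewrite !(f4.2 2) // !(f4.2 0) // (d_row D3) (d_col D3) (d_val D3) w3 (d_b D3) (d_lam D3).
move=> s4 [f4 e4].
have D4 : Data s4 by apply: Data_frame f4 D3.
have rd e : (e < N)%N ->
    rmem s4 21 (re e) = rowdot (fun j => rmem s 18 j + b j / lam) (re e).
  move=> lt; rewrite e4 afold_add e3 afold_const.
  have -> : re e \in mkseq re N by apply/mapP; exists e => //; rewrite mem_iota.
  by rewrite add0r.
have u4 : rmem s4 20 = fun=> 0 by rewrite f4.2 // f3.2.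
apply: wpd_weaken (wpd_for_setr (n := N) (ix := ce) (vl := fun g i => g (ce i) +
   ae i * rowdot (fun j => rmem s 18 j + b j / lam) (re i)) _ _) _ _ => //.
- by move=> s5 f5 /=; rewrite f5.1 // (d_nnz D4).
- move=> i s5 lt f5 Ei _; rewrite /= Ei !f5.1 // !(f5.2 1) // !(f5.2 21) //.
  by rewrite (d_row D4) (d_col D4) (d_val D4) rd.
move=> s5 [f5 e5]; split.
- have sb (l1 l2 : seq nat) : all (mem l2) l1 -> {subset l1 <= l2} by move/allP.
  do 4! (apply: frame_trans; last eassumption; [exact: sb | exact: sb |]).
  by apply: frame_trans f1; [exact: sb | exact: sb | exact: frame_refl].
- by rewrite f5.2 // f4.2.
- rewrite e5; apply/funext => j; rewrite afold_add u4 add0r /gram.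
  by [].
Qed.

Variables (ga eta : R).

Definition znew (z w u y : nat -> R) (x : nat) (j : nat) : R :=
  z j - eta * ((lam + ga) * z j - u j - ga * y j) +
  \sum_(e < N | (re e == nth 0%N SL x) && (ce e == j))
     eta * ((size SL)%:R / (count_mem (nth 0%N SL x) SL)%:R) *
       (ae e * rowdot (fun j => z j - w j) (nth 0%N SL x)).

Hypothesis row_le : forall r, (size (rowlist N r) <= size Cl)%N.

(** All randomness is in the first command, so the expectation is a plain average over slots for any
    [phi]; the analysis chooses [phi] later. Both walks are charged [size Cl] by [row_le], which
    makes the time independent of the row drawn. *)
Lemma wp_step s (phi : (nat -> R) -> R) : Data s -> Table s ->
  rmem s 13 0 = ga -> rmem s 14 0 = eta -> (0 < size SL)%N ->
  supp (rmem s 17) -> supp (rmem s 18) -> supp (rmem s 20) ->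
  wp Step s (size Cl * 12 + 17)
    (fun s' => frame [:: 15; 16; 17]%N [:: 18; 23]%N s s' /\ supp (rmem s' 18))
    (fun s' => phi (rmem s' 18))
    ((size SL)%:R^-1 * \sum_(x < size SL)
       phi (znew (rmem s 18) (rmem s 19) (rmem s 20) (rmem s 17) x)).
Proof.
move=> D T Ega Eeta S0 s17 s18 s20.
pose zn := znew (rmem s 18) (rmem s 19) (rmem s 20) (rmem s 17).
have -> : (size Cl * 12 + 17 = (1 + (1 + (1 + ((size Cl * 4 + 3) +
  ((size Cl * 4 + 3) + (size Cl * 4 + 3)).+1).+1).+1).+1).+1)%N by lia.
apply: (wp_seq (I1 := fun s' => exists2 x, (x < size SL)%N & s' = seti s 17 0 x)
  (g1 := fun s' => phi (zn (imem s' 17 0)))).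
  have := @wp_randi R 17 (IConst 0) (iv 10) s
    (fun s' => exists2 x, (x < size SL)%N & s' = seti s 17 0 x)
    (fun s' => phi (zn (imem s' 17 0))) (size SL) (d_S T) S0.
  move=> H; apply: wp_weaken (H _) _ _ _ => //.
  by move=> x lt; exists x.
move=> s1 [x lt Es1].
have x1 : imem s1 17 0 = x by rewrite Es1 /= upd_same.
rewrite x1; set r := nth 0%N SL x.
have f1 : frame [:: 17%N] [::] s s1 by rewrite Es1; apply: frame_seti.
have D1 : Data s1 by apply: Data_frame f1 D.
have T1 : Table s1 by apply: Table_frame f1 T.
apply: (wpd_seq (I1 := fun s' => s' = seti s1 17 0 r)).
  by apply: wpd_seti; rewrite /= x1 (d_SL T1).
move=> s2 Es2.
have r2 : imem s2 17 0 = r by rewrite Es2 /= upd_same.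
have f2 : frame [:: 17%N] [::] s s2 by rewrite Es2; apply: frame_seti.
apply: (wpd_seq (I1 := fun s' => s' = setr s2 23 0 0)); first exact: wpd_setr.
move=> s3 Es3.
have f3 : frame [:: 17%N] [:: 23%N] s s3.
  rewrite Es3; apply: frame_setr => //; apply: (frame_trans _ _ _ f2) => //.
have r3 : imem s3 17 0 = r by rewrite Es3.
have d3 : rmem s3 23 0 = 0 by rewrite Es3 /= upd_same.
have D3 : Data s3 by apply: Data_frame f3 D.
have T3 : Table s3 by apply: Table_frame f3 T.
have ch3 : chain (imem s3 4) (imem s3 5 r) (rowlist N r) := d_chain T3 r.
apply: (wpd_seq (I1 := fun s' => frame [:: 16%N] [:: 23%N] s3 s' /\
   rmem s' 23 0 = rowdot (fun j => rmem s 18 j - rmem s 19 j) r)).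
  apply: wpd_weaken (wpd_walk_setr (l := rowlist N r) (ix := fun _ => 0%N)
    (vl := fun g e => g 0%N + ae e * (rmem s 18 (ce e) - rmem s 19 (ce e))) _ _ _) _ _ => //.
  - by rewrite /= r3.
  - move=> i s4 lti f4 Ei; rewrite /= Ei subn1 /= !f4.1 // !(f4.2 1) // !(f4.2 18) //.
    by rewrite !(f4.2 19) // (d_col D3) (d_val D3) !f3.2.
  - by rewrite leq_add2r leq_mul2r row_le orbT.
  - move=> s4 [f4 e4]; split=> //; rewrite e4.
    rewrite (afold_add (fun=> 0%N) (fun i => ae (nth 0%N (rowlist N r) i) *
      (rmem s 18 (ce (nth 0%N (rowlist N r) i)) - rmem s 19 (ce (nth 0%N (rowlist N r) i))))).
    rewrite d3 add0r (sum_rowlist (fun e => ae e * (rmem s 18 (ce e) - rmem s 19 (ce e))) xpredT).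
    by apply: eq_bigl => e; rewrite andbT.
move=> s4 [f4 dot4].
have f04 : frame [:: 16; 17]%N [:: 23%N] s s4.
  have sb (l1 l2 : seq nat) : all (mem l2) l1 -> {subset l1 <= l2} by move/allP.
  apply: frame_trans f4; [exact: sb | exact: sb | ].
  by apply: frame_trans f3; [exact: sb | exact: sb | exact: frame_refl].
have D4 : Data s4 by apply: Data_frame f04 D.
have T4 : Table s4 by apply: Table_frame f04 T.
pose zmid j := rmem s 18 j - eta * ((lam + ga) * rmem s 18 j - rmem s 20 j - ga * rmem s 17 j).
apply: wpd_seq (wpd_map (F := zmid) T4 _ _ _) _ => //.
- by rewrite f04.2.
- by move=> j nj; rewrite /zmid s18 // s20 // s17 // !mulr0 !subr0 mulr0 subr0.
- move=> s5 j f5 jC E7 Ez; rewrite /= E7 Ez !(f5.2 14) // !(f5.2 13) // !(f5.2 20) // !(f5.2 17) //.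
  by rewrite (f5.2 0%N) // !(f04.2) // (d_lam D) Eeta Ega.
move=> s5 [f5 e5].
have r5 : imem s5 17 0 = r by rewrite f5.1 // f4.1.
have f05 : frame [:: 15; 16; 17]%N [:: 18; 23]%N s s5.
  have sb (l1 l2 : seq nat) : all (mem l2) l1 -> {subset l1 <= l2} by move/allP.
  apply: frame_trans f5; [exact: sb | exact: sb | ].
  by apply: frame_trans f04; [exact: sb | exact: sb | exact: frame_refl].
have D5 : Data s5 by apply: Data_frame f05 D.
have T5 : Table s5 by apply: Table_frame f05 T.
pose c := eta * ((size SL)%:R / (count_mem r SL)%:R).
pose dt := rowdot (fun j => rmem s 18 j - rmem s 19 j) r.
have dt5 : rmem s5 23 0 = dt by rewrite f5.2.
have H5 := @wpd_walk_setr R 16%N 4%N (IGet 5 (iv 17)) 18%N (IGet 2 pE)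
  (RAdd (RGet 18 (IGet 2 pE)) (RMul (RMul (rv 14) (RDiv (rv 8) (RGet 7 (iv 17))))
                 (RMul (RGet 1 pE) (rv 23)))) (rowlist N r) ce
    (fun g e => g (ce e) + c * (ae e * dt)) s5 isT.
apply: (wp_weaken (wp_of_wpd (v := phi (zn x)) (H5 _ _))) => //.
- by rewrite /= r5; exact: d_chain T5 r.
- move=> i s6 lti f6 Ei; rewrite /= Ei subn1 /= !f6.1 // !(f6.2 1) // !(f6.2 14) //.
  rewrite !(f6.2 8) // !(f6.2 7) // !(f6.2 23) // dt5 r5 (d_col D5) (d_val D5).
  by rewrite (d_Sr T5) (d_cnt T5) f05.2 // Eeta.
- by rewrite leq_add2r leq_mul2r row_le orbT.
move=> s6 [f6 e6].
have e6' : rmem s6 18 = zn x.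
  rewrite e6; apply/funext => j.
  rewrite (afold_add (fun i => ce (nth 0%N (rowlist N r) i))
     (fun i => c * (ae (nth 0%N (rowlist N r) i) * dt))).
  by rewrite (sum_rowlist (fun e => c * (ae e * dt)) (fun e => ce e == j)) e5.
split; last by rewrite e6'.
split.
  have sb (l1 l2 : seq nat) : all (mem l2) l1 -> {subset l1 <= l2} by move/allP.
  by apply: frame_trans f6; [exact: sb | exact: sb | ].
move=> j nj; rewrite e6' /zn /znew s18 // s20 // s17 // !mulr0 !subr0 mulr0 subr0 add0r.
rewrite big1 // => e /andP [_ /eqP ej]; case/negP: nj.
by rewrite -ej; exact: Cl_ce.
Qed.

End Data.

(** Index expressions have no product, so a constant multiple is an unrolled sum. *)
Fixpoint iscale (k : nat) (e : iexpr) : iexpr :=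
  if k is k'.+1 then IAdd e (iscale k' e) else IConst 0.

Lemma evali_iscale (R : realType) (s : state R) k e :
  evali s (iscale k e) = (k * evali s e)%N.
Proof. by elim: k => [//|k /= ->]; rewrite mulSn. Qed.

(** (1 - a)^m (1 + a)^m <= 1, while Bernoulli gives (1 + a)^m >= 1 + m a >= 4. *)
Lemma geometric_quarter (R : realType) (a : R) (m : nat) :
  0 <= a -> a <= 1 -> 3 <= m%:R * a -> (1 - a) ^+ m <= 1 / 4.
Proof.
move=> a0 a1 ma.
have bern : 1 + m%:R * a <= (1 + a) ^+ m.
  elim: m {ma} => [|m IH]; first by rewrite mul0r addr0 expr0.
  rewrite exprS; apply: (@le_trans _ _ ((1 + a) * (1 + m%:R * a))); last first.
    by rewrite ler_wpM2l // addr_ge0.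
  rewrite -natr1 -subr_ge0.
  have -> : (1 + a) * (1 + m%:R * a) - (1 + (m%:R + 1) * a) = m%:R * (a * a) by ring.
  by rewrite !mulr_ge0.
have b1 : ((1 - a) * (1 + a)) ^+ m <= 1.
  apply: exprn_ile1; first by rewrite mulr_ge0 ?subr_ge0 // addr_ge0.
  by have : 0 <= a * a by [rewrite mulr_ge0]; lra.
rewrite exprMn in b1.
have p0 : 0 <= (1 - a) ^+ m by rewrite exprn_ge0 // subr_ge0.
have := ler_wpM2l p0 bern; have := ler_wpM2l p0 ma.
by move=> h1 h2; lra.
Qed.

(** * From sparse arrays to matrices; mean and variance of a sampled row *)

Section Link.
Variables (R : realType) (n d : nat) (A : 'M[R]_(n, d)).
Variables (N : nat) (re ce : nat -> nat) (ae : nat -> R) (Cl SL : seq nat).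
Hypothesis sum_entries : forall G : nat -> nat -> R,
  \sum_(i < n) \sum_(j < d) A i j * G i j = \sum_(e < N) ae e * G (re e) (ce e).

Definition vec (f : nat -> R) : 'cV[R]_d := \col_(j < d) f j.

(** [sum_entries] is tested against the indicator of a row; indicators of a column and of a single
    cell give [vec_gram] and [acolE] in the same way. *)
Lemma rowdotE f (i : 'I_n) : rowdot N re ce ae f i = (A *m vec f) i 0.
Proof.
rewrite mxE /rowdot.
have := sum_entries (fun i' j => (i' == i)%:R * f j).
rewrite (bigD1 i) //= [X in _ + X]big1 ?addr0; last first.
  move=> k /negPf nk; rewrite big1 // => j _.
  by rewrite (inj_eq val_inj) nk mul0r mulr0.
under eq_bigr => j _ do rewrite eqxx mul1r.
move=> E; rewrite [RHS](eq_bigr (fun j : 'I_d => A i j * f j)) ?E => [|j _]; last first.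
  by rewrite mxE.
rewrite big_mkcond; apply: eq_bigr => e _.
by case: eqP => _; rewrite ?mul1r // mul0r mulr0.
Qed.

Lemma vec_gram f : vec (gram N re ce ae f) = A^T *m (A *m vec f).
Proof.
apply/colP => j; rewrite !mxE /gram.
have := sum_entries (fun i j' => (j' == j)%:R * rowdot N re ce ae f i).
rewrite exchange_big (bigD1 j) //= [X in _ + X]big1 ?addr0; last first.
  move=> k /negPf nk; rewrite big1 // => i _.
  by rewrite (inj_eq val_inj) nk mul0r mulr0.
under eq_bigr => i _ do rewrite eqxx mul1r rowdotE.
move=> E; rewrite [RHS](eq_bigr (fun i : 'I_n => A i j * (A *m vec f) i 0)); last first.
  by move=> i _; rewrite mxE.
rewrite E big_mkcond; apply: eq_bigr => e _.
by case: eqP => _; rewrite ?mul1r // mul0r mulr0.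
Qed.

Definition acol (r : nat) : 'cV[R]_d :=
  \col_(j < d) \sum_(e < N | (re e == r) && (ce e == j)) ae e.

Lemma acolE (i : 'I_n) j : acol i j 0 = A i j.
Proof.
rewrite mxE.
have := sum_entries (fun i' j' => (i' == i)%:R * (j' == j)%:R).
rewrite (bigD1 i) //= [X in _ + X]big1 ?addr0; last first.
  move=> k /negPf nk; rewrite big1 // => j' _.
  by rewrite (inj_eq val_inj) nk mul0r mulr0.
rewrite (bigD1 j) //= !eqxx mulr1 mulr1 big1 ?addr0; last first.
  by move=> k /negPf nk; rewrite (inj_eq val_inj) nk mulr0 mulr0.
move=> ->; rewrite big_mkcond; apply: eq_bigr => e _.
by do 2 case: eqP => _; rewrite /= ?mulr1 ?mul1r ?mul0r ?mulr0 ?mulr1.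
Qed.

Hypothesis SL_lt : forall r, r \in SL -> (r < n)%N.
Hypothesis SL_gt0 : (0 < size SL)%N.

Lemma sum_slots (f : nat -> R) :
  \sum_(x < size SL) f (nth 0%N SL x) = \sum_(r < n) (count_mem (r : nat) SL)%:R * f r.
Proof.
rewrite -(big_mkord xpredT (fun x => f (nth 0%N SL x))) -(big_nth 0%N xpredT f).
elim: SL SL_lt => [|r l IH] H.
  by rewrite big_nil big1 // => i _; rewrite mul0r.
rewrite big_cons IH; last by move=> r' r'l; apply: H; rewrite inE r'l orbT.
have lt : (r < n)%N by apply: H; rewrite inE eqxx.
under [RHS]eq_bigr => i _ do rewrite /= natrD mulrDl.
rewrite big_split /=; congr (_ + _).
rewrite (bigD1 (Ordinal lt)) //= eqxx mul1r big1 ?addr0 // => i ni.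
by rewrite eq_sym -[_ == r]/(val i == val (Ordinal lt)) (inj_eq val_inj) (negPf ni) mul0r.
Qed.

Variable W : R.
Hypothesis W_ge0 : 0 <= W.
Hypothesis SL_cnt : forall i : 'I_n,
  (size SL)%:R * \sum_j A i j ^+ 2 <= 2 * W * (count_mem (i : nat) SL)%:R.

Definition xi (f : nat -> R) (x : nat) : 'cV[R]_d :=
  ((size SL)%:R / (count_mem (nth 0%N SL x) SL)%:R *
   rowdot N re ce ae f (nth 0%N SL x)) *: acol (nth 0%N SL x).

Let S0 : ((size SL)%:R : R) != 0.
Proof. by rewrite pnatr_eq0 -lt0n. Qed.

Lemma acol_sq (i : 'I_n) : dotp (acol i) (acol i) = \sum_j A i j ^+ 2.
Proof. by rewrite dotp_def; apply: eq_bigr => j _; rewrite !acolE expr2. Qed.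

Lemma acol0 (i : 'I_n) : count_mem (i : nat) SL = 0%N -> acol i = 0.
Proof.
move=> k0; apply/eqP; rewrite -dotp_eq0 acol_sq eq_le; apply/andP; split.
  have Sp : 0 < (size SL)%:R :> R by rewrite ltr0n.
  by have := SL_cnt i; rewrite k0 mulr0 pmulr_rle0.
by apply: sumr_ge0 => j _; rewrite sqr_ge0.
Qed.

(** Summing over slots counts each row as often as it has slots, which cancels the weight. A row
    without slots is zero by [SL_cnt] (see [acol0]), so the division by zero in its weight is
    harmless. *)
Lemma xi_mean f :
  (size SL)%:R^-1 *: (\sum_(x < size SL) xi f x) = A^T *m (A *m vec f).
Proof.
apply/colP => j; rewrite mxE summxE.
under eq_bigr => x _ do rewrite mxE.
rewrite (sum_slots (fun r => (size SL)%:R / (count_mem r SL)%:R *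
   rowdot N re ce ae f r * acol r j 0)) mulr_sumr [RHS]mxE; apply: eq_bigr => i _.
rewrite [A^T j i]mxE rowdotE; have [k0|k0] := eqVneq (count_mem (i : nat) SL) 0%N.
  have a0 : acol i j 0 = 0 by rewrite acol0 // [LHS]mxE.
  by rewrite -acolE a0 mul0r !mulr0.
have k0' : ((count_mem (i : nat) SL)%:R : R) != 0 by rewrite pnatr_eq0.
by rewrite acolE; field; rewrite S0 k0'.
Qed.

(** Row i contributes (size SL) |a_i|^2 / k_i times (a_i . f)^2, where k_i is its number of slots,
    and [SL_cnt] bounds the first factor by 2 W. *)
Lemma xi_variance f :
  (size SL)%:R^-1 * (\sum_(x < size SL) dotp (xi f x) (xi f x)) <=
  2 * W * dotp (A *m vec f) (A *m vec f).
Proof.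
under eq_bigr => x _ do rewrite dotpZl dotpZr.
rewrite (sum_slots (fun r => (size SL)%:R / (count_mem r SL)%:R *
   rowdot N re ce ae f r * ((size SL)%:R / (count_mem r SL)%:R *
   rowdot N re ce ae f r * dotp (acol r) (acol r)))) mulr_sumr.
rewrite [X in _ <= _ * X]dotp_def mulr_sumr; apply: ler_sum => i _.
rewrite rowdotE; set a := (A *m vec f) i 0.
have [k0|k0] := eqVneq (count_mem (i : nat) SL) 0%N.
  by rewrite k0 mul0r mulr0 -[a * a]expr2 mulr_ge0 ?sqr_ge0 // mulr_ge0.
have kp : 0 < (count_mem (i : nat) SL)%:R :> R by rewrite ltr0n lt0n.
have := SL_cnt i; rewrite -acol_sq; move: kp; set k := (count_mem _ _)%:R => kp.
set q := dotp _ _ => H.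
have -> : (size SL)%:R^-1 * (k * ((size SL)%:R / k * a * ((size SL)%:R / k * a * q))) =
   ((size SL)%:R * q) / k * (a * a) by field; rewrite S0 gt_eqF.
by rewrite ler_wpM2r -?expr2 ?sqr_ge0 // ler_pdivrMr.
Qed.

Lemma vec_znew (lam ga eta : R) (z w u y : nat -> R) (x : nat) :
  vec (znew N re ce ae SL lam ga eta z w u y x) =
  vec z - eta *: ((lam + ga) *: vec z - vec u - ga *: vec y) +
  eta *: xi (fun j => z j - w j) x.
Proof.
apply/colP => j; rewrite !mxE /znew; congr (_ + _).
move: (rowdot _ _ _ _ _ _) => r; rewrite !mulr_sumr; apply: eq_bigr => e _.
by move: (_ / _) => q; ring.
Qed.

End Link.

(** * The program: outer loop *)

Definition Epoch : cmd := Seq Snap (For 20 (iscale 12 (iv 11)) Step).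

Definition tauE : rexpr := RDiv (RConst 1) (rv 10).

Definition Outer : cmd :=
  Seq (Map 17 (RDiv (RAdd (RGet 18 jE) (RMul tauE (RGet 16 jE))) (RAdd (RConst 1) tauE)))
 (Seq (Map 18 (RGet 17 jE))
 (Seq (For 19 (iv 13) Epoch)
 (Seq Snap
      (Map 16 (RSub (RAdd (RMul (RSub (RConst 1) tauE) (RGet 16 jE))
                          (RMul tauE (RGet 18 jE)))
                    (RMul (RDiv tauE (rv 12))
                          (RSub (RMul lamE (RGet 18 jE)) (RGet 20 jE)))))))).

Definition Main : cmd := For 18 (iscale 6 (iv 12)) Outer.

Section MainLoop.
Variables (R : realType) (n d : nat) (A : 'M[R]_(n, d)).
Variables (N : nat) (re ce : nat -> nat) (ae : nat -> R) (Cl SL : seq nat).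
Variables (lam mu W ga eta : R) (b : nat -> R) (M Nn K : nat).
Hypothesis sum_entries : forall G : nat -> nat -> R,
  \sum_(i < n) \sum_(j < d) A i j * G i j = \sum_(e < N) ae e * G (re e) (ce e).
Hypothesis Cl_uniq : uniq Cl.
Hypothesis Cl_ce : forall e, (e < N)%N -> ce e \in Cl.
Hypothesis row_le : forall r, (size (rowlist re N r) <= size Cl)%N.
Hypothesis SL_lt : forall r, r \in SL -> (r < n)%N.
Hypothesis SL_gt0 : (0 < size SL)%N.
Hypothesis SL_cnt : forall i : 'I_n,
  (size SL)%:R * \sum_j A i j ^+ 2 <= 2 * W * (count_mem (i : nat) SL)%:R.
Hypothesis mu_gt0 : 0 < mu.
Hypothesis mu_le : mu <= lam.
Hypothesis opA : forall v : 'cV[R]_d, dotp (A *m v) (A *m v) <= (lam - mu) * dotp v v.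
Hypothesis lam_W : lam <= 2 * W.
Hypothesis M_gt0 : (0 < M)%N.
Hypothesis Nn_gt1 : (1 < Nn)%N.
Hypothesis gaE : ga = mu * Nn%:R ^+ 2 / 2.
Hypothesis ga_M : 32 * (W * lam) <= ga ^+ 2 * M%:R.
Hypothesis etaE : eta = ga / (32 * (W * lam) + 2 * ga ^+ 2).
Hypothesis K_ge : 2 * Nn%:R * (lam + ga) ^+ 2 * lam / (mu * ga ^+ 2) <= 2 ^+ K.

(* [mu] is the strong convexity, [ga] the proximal parameter and [1 / Nn] the
   momentum parameter tau, so that [ga_tau] below holds without square roots. *)
Record Consts (s : state R) : Prop := MkConsts {
  c_data : Data N re ce ae lam b s;
  c_table : Table N re Cl SL s;
  c_ga : rmem s 13 0 = ga;
  c_eta : rmem s 14 0 = eta;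
  c_mu : rmem s 12 0 = mu;
  c_Nr : rmem s 10 0 = Nn%:R;
  c_M : imem s 11 0 = M;
  c_N : imem s 12 0 = Nn;
  c_K : imem s 13 0 = K }.

Definition mI : seq nat := [:: 14; 15; 16; 17; 18; 19; 20]%N.
Definition mR : seq nat := [:: 16; 17; 18; 19; 20; 21; 23]%N.

Lemma Consts_frame s0 s : frame mI mR s0 s -> Consts s0 -> Consts s.
Proof.
move=> f [] D T ? ? ? ? ? ? ?.
by split; [exact: Data_frame f D | exact: Table_frame f T | ..]; rewrite ?f.1 ?f.2.
Qed.

Let suppR (a : nat) (s : state R) := supp Cl (rmem s a).

Let lam_gt0 : 0 < lam. Proof. exact: lt_le_trans mu_gt0 mu_le. Qed.
Let W_gt0 : 0 < W. Proof. by move: lam_gt0 lam_W; lra. Qed.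
Let Nn_gt0 : 0 < Nn%:R :> R. Proof. by rewrite ltr0n ltnW. Qed.
Let ga_gt0 : 0 < ga. Proof. by rewrite gaE divr_gt0 // mulr_gt0 // exprn_gt0. Qed.
Let den_gt0 : 0 < 32 * (W * lam) + 2 * ga ^+ 2.
Proof. by rewrite addr_gt0 // mulr_gt0 // ?mulr_gt0 // exprn_gt0. Qed.
Let eta_gt0 : 0 < eta. Proof. by rewrite etaE divr_gt0. Qed.

(** The denominator of [eta] dominates ga lam + ga^2, since 2 ga lam <= ga^2 + lam^2 and lam^2 <= 2
    W lam. *)
Lemma eta_lam : eta * (lam + ga) <= 1.
Proof.
rewrite etaE mulrAC ler_pdivrMr // mul1r.
have h1 : 0 <= (ga - lam) ^+ 2 by rewrite sqr_ge0.
have h2 : lam * lam <= 2 * W * lam by rewrite ler_wpM2r // ltW.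
have h3 : 0 <= W * lam by rewrite mulr_ge0 // ltW.
have h4 : 0 <= ga * ga by rewrite mulr_ge0 // ltW.
by rewrite !expr2 in h1 *; lra.
Qed.

Lemma eta_W : 32 * (W * lam) * eta <= ga.
Proof.
rewrite etaE mulrA ler_pdivrMr // [leLHS]mulrC (ler_pM2l ga_gt0) lerDl.
by rewrite mulr_ge0 // sqr_ge0.
Qed.

Let rho : R := 7 / 8 * (eta * ga).

Lemma rho_ge0 : 0 <= rho.
Proof. by rewrite /rho mulr_ge0 ?divr_ge0 // mulr_ge0 // ltW. Qed.

Lemma rho_le1 : rho <= 1.
Proof.
have h : eta * ga <= eta * (lam + ga).
  by apply: ler_wpM2l; rewrite ?lerDr ltW.
have h0 : 0 <= eta * ga by rewrite mulr_ge0 // ltW.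
by rewrite /rho; move: eta_lam; lra.
Qed.

(** By [ga_M] and M >= 1 the denominator of [eta] is at most 3 ga^2 M, so 12 M rho >= (21/2) / 3 >=
    3. *)
Lemma epoch_rate : (1 - rho) ^+ (12 * M) <= 1 / 4.
Proof.
apply: geometric_quarter; [exact: rho_ge0 | exact: rho_le1 |].
have M1 : 1 <= M%:R :> R by rewrite ler1n.
have g2 : 0 < ga ^+ 2 by rewrite exprn_gt0.
have E : (12 * M)%:R * rho = (21 / 2 * (ga ^+ 2 * M%:R)) / (32 * (W * lam) + 2 * ga ^+ 2).
  by rewrite /rho etaE natrM; field; rewrite gt_eqF.
rewrite E ler_pdivlMr //.
have : ga ^+ 2 * 1 <= ga ^+ 2 * M%:R by rewrite ler_pM2l.
by move: ga_M; lra.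
Qed.

Let bl : 'cV[R]_d := vec d (fun j => b j / lam).
Let S (v : 'cV[R]_d) := A^T *m (A *m v).
Let H := Hm A lam.
Let dz (zh : 'cV[R]_d) (s : state R) : R :=
  dotp (vec d (rmem s 18) - zh) (vec d (rmem s 18) - zh).

Lemma vecD f g : vec d (fun j => f j + g j) = vec d f + vec d g :> 'cV[R]_d.
Proof. by apply/colP => j; rewrite !mxE. Qed.

Lemma vecB f g : vec d (fun j => f j - g j) = vec d f - vec d g :> 'cV[R]_d.
Proof. by apply/colP => j; rewrite !mxE. Qed.

Definition epoch_time : nat := (size Cl * 8 + N * 12 + 19 +
  (12 * M * (size Cl * 12 + 20) + 3)).+1.

Lemma sub_all_mem (l1 l2 : seq nat) : all (mem l2) l1 -> {subset l1 <= l2}.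
Proof. by move/allP. Qed.

Lemma wp_epoch s zh : Consts s ->
  suppR 17 s -> suppR 18 s -> suppR 19 s -> suppR 20 s ->
  H ga zh = ga *: vec d (rmem s 17) + S bl ->
  wp Epoch s epoch_time
    (fun s' => [/\ frame [:: 14; 15; 16; 17; 20]%N [:: 18; 19; 20; 21; 23]%N s s',
      suppR 18 s', suppR 19 s' & suppR 20 s'])
    (dz zh) (1 / 2 * dz zh s).
Proof.
move=> C s17 s18 s19 s20 Hzh; rewrite /epoch_time.
apply: wpd_seq (wpd_snap Cl_uniq (c_data C) (c_table C) s18 s19 s20) _.
move=> s1 [f1 w1 u1].
have C1 : Consts s1.
  apply: Consts_frame C; apply: frame_trans f1; try exact: sub_all_mem.
  exact: frame_refl.
set p := dz zh s.
have p0 : 0 <= p := dotp_ge0 _.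
have z1 : rmem s1 18 = rmem s 18 by rewrite f1.2.
have y1 : rmem s1 17 = rmem s 17 by rewrite f1.2.
pose m := (12 * M)%N.
pose Inv (i : nat) s' := frame [:: 15; 16; 17; 20]%N [:: 18; 23]%N s1 s' /\ suppR 18 s'.
(* As eta ga / 8 = rho / 7, the value p / 7 is the fixed point of the one-step recurrence, and the
   excess over it shrinks by 1 - rho per step. *)
pose G (i : nat) s' := p / 7 + (1 - rho) ^+ (m - i) * (dz zh s' - p / 7).
have q0 : 0 <= 1 - rho by rewrite subr_ge0 rho_le1.
have W20 : suppR 20 s1 by rewrite /suppR u1; exact: supp_gram.
have WF := @wp_for R 20%N (iscale 12 (iv 11)) Step m
  (fun _ => (size Cl * 12 + 17)%N) Inv G s1.
apply: (wp_weaken (WF _ _ _ _ _)).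
- by move=> i s2 x [f2 su2]; split=> //; exact: frame_seti.
- by [].
- by move=> i s2 [f2 _]; rewrite evali_iscale /= f2.1 // (c_M C1).
- move=> i s2 lt [f2 su2] Ei.
  have C2 : Consts s2.
    apply: Consts_frame C1; apply: frame_trans f2; try exact: sub_all_mem.
    exact: frame_refl.
  have w2 : rmem s2 19 = rmem s 18 by rewrite f2.2.
  have u2 : rmem s2 20 = gram N re ce ae (fun j => rmem s 18 j + b j / lam).
    by rewrite f2.2.
  have y2 : rmem s2 17 = rmem s 17 by rewrite f2.2.
  have WS := @wp_step R N re ce ae Cl SL lam b Cl_uniq Cl_ce ga eta row_le s2
    (fun f => dotp (vec d f - zh) (vec d f - zh)) (c_data C2) (c_table C2)
    (c_ga C2) (c_eta C2) SL_gt0.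
  have {WS} WS : wp Step s2 (size Cl * 12 + 17)
     (fun s' => frame [:: 15; 16; 17]%N [:: 18; 23]%N s2 s' /\ supp Cl (rmem s' 18))
     (dz zh) ((1 - rho) * dz zh s2 + eta * ga / 8 * p).
    apply: (wp_weaken (WS _ _ _)) => //.
    + by rewrite y2.
    + by rewrite u2; exact: supp_gram.
    + have := @svrg_step R n d A lam mu mu_gt0 mu_le opA (size SL)
        (fun x => xi d N re ce ae SL (fun j => rmem s2 18 j - rmem s2 19 j) x)
        (fun x => vec d (znew N re ce ae SL lam ga eta (rmem s2 18) (rmem s2 19)
           (rmem s2 20) (rmem s2 17) x))
        (vec d (rmem s2 18)) (vec d (rmem s 18)) (vec d (rmem s 17)) zh bl ga eta W
        SL_gt0 (ltW ga_gt0) (ltW eta_gt0) eta_lam (ltW W_gt0) eta_W Hzh.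
      rewrite -/rho; apply.
      * by rewrite (xi_mean sum_entries SL_lt SL_gt0 SL_cnt) w2 vecB.
      * by rewrite -vecB -w2; apply: (xi_variance sum_entries SL_lt SL_gt0 (ltW W_gt0) SL_cnt).
      * by move=> x; rewrite vec_znew y2 u2 (vec_gram sum_entries) vecD.
  pose k := (m - i.+1)%N.
  have mi : (m - i)%N = k.+1 by rewrite /k subnSK.
  have := wp_affine (a := p / 7 - (1 - rho) ^+ k * (p / 7)) (exprn_ge0 k q0) WS.
  move=> WA; apply: (wp_weaken WA) => //.
  + move=> s3 [f3 su3]; split; last first.
      by rewrite /G -/k; set x := (_ ^+ _); lra.
    split; last by rewrite f3.1 // Ei.
    by split=> //; apply: frame_trans f3 => //; exact: sub_all_mem.
  + rewrite /G mi exprS /rho; set x := (_ ^+ k).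
    have -> : eta * ga / 8 * p = 7 / 8 * (eta * ga) * (p / 7) by field.
    by rewrite le_eqVlt; apply/orP; left; apply/eqP; ring.
- by split; [exact: frame_refl | rewrite /suppR z1].
- by rewrite sum_nat_const card_ord /m -addnA.
- move=> s2 [f2 su2]; split; last by rewrite /G subnn expr0; lra.
  split=> //.
  + apply: (@frame_trans _ _ _ [:: 15; 16; 17; 20]%N [:: 18; 23]%N _ s1) => //;
      try exact: sub_all_mem.
    by apply: frame_trans f1; try exact: sub_all_mem; exact: frame_refl.
  + by rewrite /suppR f2.2 // w1.
  + by rewrite /suppR f2.2.
(* p / 7 + (p - p / 7) / 4 = 5 p / 14, which is below p / 2. *)
- rewrite /G subn0 /dz z1 -/(dz zh s) -/p.
  have := epoch_rate; rewrite -/m; set x := (_ ^+ m) => xq.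
  have : x * (p - p / 7) <= 1 / 4 * (p - p / 7) by rewrite ler_wpM2r //; lra.
  lra.
Qed.

Lemma shifted_gram_unit (a : R) : 0 <= a -> (lam + a)%:M - A^T *m A \in unitmx.
Proof.
move=> a0; set B := _ - _.
have BE v : B *m v = H a v.
  by rewrite /B /H HmE mulmxBl mul_scalar_mx mulmxA.
rewrite -row_free_unit -kermx_eq0; apply: contraT => /rowV0Pn [v /sub_kermxP vB v0].
have BT : B^T = B by rewrite /B linearB /= tr_scalar_mx trmx_mul trmxK.
have Hv : H a v^T = 0 by rewrite -BE -BT -trmx_mul vB trmx0.
have := Hm_ge opA a v^T; rewrite -/H Hv.
have -> : dotp v^T 0 = 0 by rewrite -(scale0r 0) dotpZr mul0r.
have vp : 0 < dotp v^T v^T.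
  rewrite lt_def dotp_ge0 dotp_eq0 andbT; apply: contra_neq v0 => E.
  by rewrite -[v]trmxK E trmx0.
by rewrite pmulr_lle0 //; move: mu_gt0; lra.
Qed.

Lemma shifted_gram_solve (a : R) (q : 'cV[R]_d) : 0 <= a ->
  H a (invmx ((lam + a)%:M - A^T *m A) *m q) = q.
Proof.
move=> a0; rewrite /H HmE -mul_scalar_mx mulmxA -mulmxBl mulmxA mulmxV ?mul1mx //.
exact: shifted_gram_unit.
Qed.

Variable ys : 'cV[R]_d.
Hypothesis ysE : H 0 ys = S bl.

Let tau : R := Nn%:R^-1.
Let V (s : state R) : R := lyapunov A lam mu ys (vec d (rmem s 18)) (vec d (rmem s 16)).

Let tau_gt0 : 0 < tau. Proof. by rewrite invr_gt0. Qed.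
Let tau_le : tau <= 1 / 2.
Proof. by rewrite /tau div1r lef_pV2 ?posrE // ler_nat. Qed.
Let ga_tau : 2 * ga * tau ^+ 2 = mu.
Proof. by rewrite gaE /tau; field; rewrite gt_eqF. Qed.

Lemma lyapunov_ge0 x v : 0 <= lyapunov A lam mu ys x v.
Proof.
have h1 : 0 <= dotp (x - ys) (Hm A lam 0 (x - ys)) by apply: (Hm_psd mu_gt0 opA).
have h2 := mulr_ge0 (ltW mu_gt0) (dotp_ge0 (v - ys)).
by rewrite /lyapunov; lra.
Qed.

Definition outer_time : nat :=
  (size Cl * 4 + 3 + (size Cl * 4 + 3 + ((K * (epoch_time + 3) + 3) +
    (size Cl * 8 + N * 12 + 19 + (size Cl * 4 + 3)).+1).+1).+1).+1.

Definition Supps s := [/\ suppR 16 s, suppR 17 s, suppR 18 s, suppR 19 s & suppR 20 s].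

(** An exact proximal step would contract by 1 - tau; half of this gain pays for the error left
    after K epochs. *)
Lemma wp_outer s : Consts s -> Supps s ->
  wp Outer s outer_time
    (fun s' => frame [:: 14; 15; 16; 17; 19; 20]%N mR s s' /\ Supps s')
    V ((1 - tau / 2) * V s).
Proof.
move=> C [s16 s17 s18 s19 s20]; rewrite /outer_time.
pose yf j := (rmem s 18 j + tau * rmem s 16 j) / (1 + tau).
have t1 : 1 + tau != 0 by rewrite gt_eqF // ltr_wpDl // ler01.
have T0 := c_table C.
apply: wpd_seq (wpd_map Cl_uniq (F := yf) T0 s17 _ _) _.
- by move=> j nj; rewrite /yf s18 // s16 // mulr0 addr0 mul0r.
- move=> s1 j f1 jC E7 _; rewrite /= E7 !(f1.2 18%N) // !(f1.2 16%N) // !(f1.2 10%N) //.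
  by rewrite (c_Nr C) div1r.
move=> s1 [f1 y1].
have sy : supp Cl yf by move=> j nj; rewrite /yf s18 // s16 // mulr0 addr0 mul0r.
have C1 : Consts s1.
  apply: Consts_frame C; apply: frame_trans f1; try exact: sub_all_mem.
  exact: frame_refl.
apply: wpd_seq (wpd_map Cl_uniq (F := yf) (c_table C1) _ sy _) _.
- by rewrite f1.2.
- by move=> s2 j f2 jC E7 _; rewrite /= E7 f2.2 // y1.
move=> s2 [f2 z2].
have f02 : frame [:: 15%N] [:: 17; 18]%N s s2.
  apply: (@frame_trans _ _ _ [:: 15%N] [:: 18%N] _ s1) => //; try exact: sub_all_mem.
  by apply: frame_trans f1; try exact: sub_all_mem; exact: frame_refl.
have C2 : Consts s2.
  apply: Consts_frame C; apply: frame_trans f02; try exact: sub_all_mem.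
  exact: frame_refl.
have y2 : rmem s2 17 = yf by rewrite f2.2.
(* The exact proximal minimiser exists only in the analysis, as the target of the epochs. *)
pose zh := invmx ((lam + ga)%:M - A^T *m A) *m (ga *: vec d yf + S bl).
have zhE : H ga zh = ga *: vec d yf + S bl by exact/shifted_gram_solve/ltW.
have yE : (1 + tau) *: vec d yf = vec d (rmem s 18) + tau *: vec d (rmem s 16).
  by apply/colP => j; rewrite !mxE /yf; field.
pose Inv (i : nat) s' := [/\ frame [:: 14; 15; 16; 17; 19; 20]%N [:: 18; 19; 20; 21; 23]%N s2 s',
      suppR 18 s', suppR 19 s' & suppR 20 s'].
pose G (i : nat) s' := 2^-1 ^+ (K - i) * dz zh s'.
have WF := @wp_for R 19%N (iv 13) Epoch K (fun _ => epoch_time) Inv G s2.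
pose be : R := (lam + ga) ^+ 2 / ga.
have be0 : 0 <= be by rewrite divr_ge0 ?sqr_ge0 // ltW.
have VE := lyapunov_ge0 (vec d (rmem s 18)) (vec d (rmem s 16)).
apply: (@wp_seq _ _ _ _ _ _ (Inv K) _ (fun s' => (1 - tau) * V s + be * dz zh s')).
  have WF' : wp (For 19 (iv 13) Epoch) s2 (\sum_(i < K) (epoch_time + 3) + 3)
     (Inv K) (G K) (G 0%N s2).
    apply: WF.
    - by move=> i s3 x [f3 ? ? ?]; split=> //; exact: frame_seti.
    - by [].
    - by move=> i s3 [f3 _ _ _] /=; rewrite f3.1 // (c_K C2).
    - move=> i s3 lt [f3 h18 h19 h20] Ei.
      have C3 : Consts s3.
        apply: Consts_frame C2; apply: frame_trans f3; try exact: sub_all_mem.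
        exact: frame_refl.
      have y3 : rmem s3 17 = yf by rewrite f3.2.
      have h17 : suppR 17 s3 by rewrite /suppR y3.
      have zhE3 : H ga zh = ga *: vec d (rmem s3 17) + S bl by rewrite y3.
      have WE := wp_epoch C3 h17 h18 h19 h20 zhE3.
      have h2 : 0 <= 2^-1 ^+ (K - i.+1) :> R by rewrite exprn_ge0 // invr_ge0.
      apply: (wp_weaken (wp_affine (a := 0) h2 WE)) => //.
      + move=> s4 [f4 k18 k19 k20]; split; last by rewrite add0r.
        split; last by rewrite f4.1.
        by split=> //; apply: frame_trans f4; try exact: sub_all_mem.
      + rewrite /G add0r; have -> : (K - i = (K - i.+1).+1)%N by rewrite subnSK.
        by rewrite exprS; set x := _ ^+ _; lra.
    - split; [exact: frame_refl| by rewrite /suppR z2 | | ].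
        by rewrite /suppR f02.2.
      by rewrite /suppR f02.2.
  apply: (wp_weaken (wp_affine (a := (1 - tau) * V s) be0 WF')).
  - by rewrite sum_nat_const card_ord.
  - by move=> s3 I3; split=> //; rewrite /G subnn expr0 mul1r.
  - rewrite /G subn0 /dz z2.
    have PS := prox_start mu_gt0 mu_le opA tau_gt0 tau_le ga_tau ysE yE zhE.
    rewrite -/(V s) in PS.
    have h2 : 0 < 2 ^+ K :> R by rewrite exprn_gt0.
    have h3 : 0 <= be * (2^-1 ^+ K) by rewrite mulr_ge0 // exprn_ge0 // invr_ge0.
    have h4 := ler_wpM2l h3 PS.
    have V0 : 0 <= V s := VE.
    (* This is [K_ge] rewritten: [be] converts distance to Lyapunov loss, 2^-K comes from the epochs
       and lam / (mu ga) from [prox_start]. *)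
    have h5 : be * 2^-1 ^+ K * (lam / (mu * ga)) <= tau / 2.
      have -> : be * 2^-1 ^+ K * (lam / (mu * ga)) =
         (2 * Nn%:R * (lam + ga) ^+ 2 * lam / (mu * ga ^+ 2)) / 2 ^+ K * (tau / 2).
        rewrite exprVn /be /tau; field.
        by rewrite !gt_eqF.
      rewrite -[leRHS]mul1r ler_wpM2r ?divr_ge0 ?(ltW tau_gt0) //.
      by rewrite ler_pdivrMr // mul1r.
    have h6 := ler_wpM2r V0 h5.
    rewrite mulrA; move: h4 h6; rewrite -!mulrA; lra.
move=> s3 [f3 h18 h19 h20].
have f03 : frame [:: 14; 15; 16; 17; 19; 20]%N mR s s3.
  apply: frame_trans f3; try exact: sub_all_mem.
  by apply: frame_trans f02; try exact: sub_all_mem; exact: frame_refl.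
have C3 : Consts s3.
  by apply: Consts_frame C; apply: frame_trans f03; try exact: sub_all_mem; exact: frame_refl.
(* The update of v uses the exact gradient of f at x', so Sigma (x' + b / lambda) is recomputed by
   one more snapshot. *)
apply: wpd_seq (wpd_snap Cl_uniq (c_data C3) (c_table C3) h18 h19 h20) _.
move=> s4 [f4 w4 u4].
have f04 : frame [:: 14; 15; 16; 17; 19; 20]%N mR s s4.
  by apply: frame_trans f4; try exact: sub_all_mem.
have C4 : Consts s4.
  by apply: Consts_frame C; apply: frame_trans f04; try exact: sub_all_mem; exact: frame_refl.
have z4 : rmem s4 18 = rmem s3 18 by rewrite f4.2.
have v4 : rmem s4 16 = rmem s 16 by rewrite f4.2 // f3.2 // f02.2.
pose x' := rmem s3 18.
pose vf j := (1 - tau) * rmem s 16 j + tau * x' j - tau / mu * (lam * x' j -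
   gram N re ce ae (fun j => x' j + b j / lam) j).
have sv : supp Cl vf.
  move=> j nj; rewrite /vf s16 // /x' h18 // (@supp_gram R N re ce ae Cl Cl_ce) // !mulr0 subr0 mulr0.
  by rewrite !addr0 subr0.
have H4 := @wpd_map R N re Cl SL Cl_uniq s4 16%N (RSub (RAdd (RMul (RSub (RConst 1) tauE) (RGet 16 jE))
  (RMul tauE (RGet 18 jE))) (RMul (RDiv tauE (rv 12)) (RSub (RMul lamE (RGet 18 jE)) (RGet 20 jE))))
  vf (c_table C4).
apply: (wp_weaken (wp_of_wpd (v := (1 - tau) * V s + be * dz zh s3) (H4 _ sv _))) => //.
- by rewrite v4.
- move=> s5 j f5 jC E7 Ev; rewrite /= E7 Ev !(f5.2 18%N) // !(f5.2 20%N) // !(f5.2 12%N) //.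
  rewrite !(f5.2 10%N) // (f5.2 0%N) // (c_Nr C4) (c_mu C4) (d_lam (c_data C4)) z4 u4 v4.
  by rewrite div1r.
- move=> s5 [f5 e5]; split; first split.
  + by apply: frame_trans f5; try exact: sub_all_mem.
  + split.
    * by rewrite /suppR e5.
    * by rewrite /suppR f5.2 // f4.2 // f3.2 // y2.
    * by rewrite /suppR f5.2 // z4.
    * by rewrite /suppR f5.2 // w4.
    * by rewrite /suppR f5.2 // u4; exact: supp_gram.
  + have z5 : rmem s5 18 = x' by rewrite f5.2 // z4.
    rewrite /V z5 e5.
    apply: (@accelerated_step R n d A lam mu mu_gt0 mu_le opA ys bl _ _ (vec d yf) zh ga tau
      tau_gt0 tau_le ga_tau ysE yE zhE).
    rewrite /bl -vecD -(vec_gram sum_entries).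
    by apply/colP => j; rewrite /vf !mxE.
Qed.

(** Since 6 N tau / 2 = 3, the Lyapunov function drops to a quarter. Starting with x = v it is at
    most the squared B-norm error ([lyapunov_diag]), and at the end that error is at most twice it
    ([lyapunov_ge]), hence the factor 1/2. *)
Lemma wp_main s : Consts s -> Supps s -> rmem s 16 = rmem s 18 ->
  wp Main s (6 * Nn * (outer_time + 3) + 3)
    (fun s' => frame mI mR s s' /\ Supps s')
    (fun s' => dotp (vec d (rmem s' 18) - ys) (H 0 (vec d (rmem s' 18) - ys)))
    (1 / 2 * dotp (vec d (rmem s 18) - ys) (H 0 (vec d (rmem s 18) - ys))).
Proof.
move=> C Su zv; pose m := (6 * Nn)%N.
pose Inv (i : nat) s' := frame mI mR s s' /\ Supps s'.
pose G (i : nat) s' := 2 * ((1 - tau / 2) ^+ (m - i) * V s').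
have q0 : 0 <= 1 - tau / 2 by move: tau_le; lra.
apply: (wp_weaken (@wp_for R 18%N (iscale 6 (iv 12)) Outer m (fun _ => outer_time) Inv G s _ _ _ _ _)).
- by move=> i s2 x [f2 su2]; split=> //; exact: frame_seti.
- by [].
- by move=> i s2 [f2 _]; rewrite evali_iscale /= f2.1 // (c_N C).
- move=> i s2 lt [f2 su2] Ei.
  have W2 := wp_outer (Consts_frame f2 C) su2.
  have h2 : 0 <= 2 * (1 - tau / 2) ^+ (m - i.+1) by rewrite mulr_ge0 // exprn_ge0.
  apply: (wp_weaken (wp_affine (a := 0) h2 W2)) => //.
  + move=> s3 [f3 su3]; split; last by rewrite /G add0r mulrA.
    split; last by rewrite f3.1.
    by split=> //; apply: frame_trans f3; try exact: sub_all_mem.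
  + rewrite /G add0r; have -> : (m - i = (m - i.+1).+1)%N by rewrite subnSK.
    rewrite exprS; set x := _ ^+ (m - _).
    by rewrite le_eqVlt; apply/orP; left; apply/eqP; ring.
- by [].
- by rewrite sum_nat_const card_ord.
- move=> s2 [f2 su2]; split=> //.
  by rewrite /G subnn expr0 mul1r; exact: lyapunov_ge.
- rewrite /G subn0 /V zv.
  have L := lyapunov_diag opA ys (vec d (rmem s 18)).
  have g4 : (1 - tau / 2) ^+ m <= 1 / 4.
    apply: geometric_quarter.
    - by move: tau_gt0; lra.
    - by move: tau_le; lra.
    - have -> : m%:R * (tau / 2) = 3 by rewrite /m /tau natrM; field; rewrite gt_eqF.
      exact: lexx.
  have L0 := lyapunov_ge0 (vec d (rmem s 18)) (vec d (rmem s 18)).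
  have := ler_wpM2r L0 g4; rewrite -/H in L; lra.
Qed.

End MainLoop.

(** * Sparse representation of the matrix *)

Section Entries.
Variables (R : realType) (n d : nat) (A : 'M[R]_(n, d)).

Definition ent_row (e : nat) : nat := nth 0%N [seq nat_of_ord p.1 | p <- entries A] e.
Definition ent_col (e : nat) : nat := nth 0%N [seq nat_of_ord p.2 | p <- entries A] e.
Definition ent_val (e : nat) : R := nth 0 [seq A p.1 p.2 | p <- entries A] e.

Lemma entries_uniq : uniq (entries A).
Proof.
apply: filter_uniq; apply: allpairs_uniq; rewrite ?enum_uniq //.
by move=> [a b] [a' b'] _ _.
Qed.

Lemma mem_entries p : (p \in entries A) = (p \in nonzeros A).
Proof.
rewrite mem_filter andb_idr // => _; case: p => i j.
by apply/allpairsP; exists (i, j); rewrite !mem_enum.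
Qed.

Lemma size_entries : size (entries A) = nnz A.
Proof.
rewrite /nnz cardE; apply/eqP; rewrite eqn_leq !uniq_leq_size ?enum_uniq ?entries_uniq //.
  by move=> p; rewrite mem_entries mem_enum.
by move=> p; rewrite mem_entries mem_enum.
Qed.

Lemma sum_entries_gen (F : 'I_n -> 'I_d -> R) :
  (forall i j, A i j = 0 -> F i j = 0) ->
  \sum_i \sum_j F i j = \sum_(p <- entries A) F p.1 p.2.
Proof.
move=> F0; rewrite pair_bigA /= [RHS]big_uniq ?entries_uniq //=.
rewrite [RHS]big_mkcond /=; apply: eq_bigr => -[i j] _ /=.
by rewrite mem_entries inE /=; case: eqP => //= /F0.
Qed.

Lemma sum_nth_entries (F : nat -> nat -> R -> R) :
  \sum_(e < nnz A) F (ent_row e) (ent_col e) (ent_val e) =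
  \sum_(p <- entries A) F p.1 p.2 (A p.1 p.2).
Proof.
rewrite -size_entries.
case E : (entries A) => [|p0 l]; first by rewrite big_nil big_ord0.
rewrite -E (big_nth p0) big_mkord; apply: eq_bigr => e _.
by rewrite /ent_row /ent_col /ent_val !(nth_map p0).
Qed.

Lemma sum_entries (G : nat -> nat -> R) :
  \sum_(i < n) \sum_(j < d) A i j * G i j =
  \sum_(e < nnz A) ent_val e * G (ent_row e) (ent_col e).
Proof.
rewrite (sum_nth_entries (fun r c v => v * G r c)).
by apply: (sum_entries_gen (F := fun i j => A i j * G i j)) => i j ->; rewrite mul0r.
Qed.

Lemma row_sq (i : 'I_n) :
  \sum_j A i j ^+ 2 = \sum_(e < nnz A | ent_row e == i) ent_val e ^+ 2.
Proof.
rewrite [RHS]big_mkcond (sum_nth_entries (fun r c v => if r == i then v ^+ 2 else 0)).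
rewrite -(sum_entries_gen (F := fun i' j => if (i' : nat) == i then A i' j ^+ 2 else 0)).
  rewrite (bigD1 i) //= eqxx [X in _ + X]big1 ?addr0 // => k /negPf nk.
  by rewrite big1 // => j _; rewrite (inj_eq val_inj) nk.
by move=> i' j ->; case: ifP => // _; rewrite expr0n.
Qed.

Lemma frob_sum : \sum_i \sum_j A i j ^+ 2 = \sum_(e < nnz A) ent_val e ^+ 2.
Proof.
rewrite (sum_nth_entries (fun r c v => v ^+ 2)).
by rewrite -(sum_entries_gen (F := fun i' j => A i' j ^+ 2)) // => i j ->; rewrite expr0n.
Qed.

Lemma ent_row_lt e : (e < nnz A)%N -> (ent_row e < n)%N.
Proof.
rewrite -size_entries /ent_row => lt.
have := mem_nth 0%N (s := [seq nat_of_ord p.1 | p <- entries A]) (n := e).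
by rewrite size_map => /(_ lt) /mapP [p _ ->].
Qed.

Lemma ent_col_lt e : (e < nnz A)%N -> (ent_col e < d)%N.
Proof.
rewrite -size_entries /ent_col => lt.
have := mem_nth 0%N (s := [seq nat_of_ord p.2 | p <- entries A]) (n := e).
by rewrite size_map => /(_ lt) /mapP [p _ ->].
Qed.

Lemma ent_inj e e' : (e < nnz A)%N -> (e' < nnz A)%N ->
  ent_row e = ent_row e' -> ent_col e = ent_col e' -> e = e'.
Proof.
rewrite -size_entries => lt lt'.
case E : (entries A) => [|p0 l]; first by rewrite E in lt.
rewrite /ent_row /ent_col !(nth_map p0) // => h1 h2.
apply/eqP; rewrite -(nth_uniq p0 lt lt' entries_uniq); apply/eqP.
by apply/eqP; rewrite -pair_eqE; apply/andP; split; apply/eqP/val_inj.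
Qed.

(** Entries of one row lie in distinct columns, so [ent_col] maps the row injectively into [Cl]. *)
Lemma ent_row_le (Cl : seq nat) (r : nat) :
  (forall e, (e < nnz A)%N -> ent_col e \in Cl) ->
  (size (rowlist ent_row (nnz A) r) <= size Cl)%N.
Proof.
move=> HC; rewrite -(size_map ent_col); apply: uniq_leq_size.
  rewrite map_inj_in_uniq ?rev_uniq ?filter_uniq ?iota_uniq // => e e'.
  rewrite !mem_rev !mem_filter !mem_iota => /andP [/eqP h1 /andP [_ l1]].
  by move=> /andP [/eqP h2 /andP [_ l2]]; apply: ent_inj; rewrite ?h1.
move=> _ /mapP [e + ->]; rewrite mem_rev mem_filter mem_iota => /and3P [_ _ lt].
exact: HC.
Qed.

End Entries.

(** * The program: preparation *)

Definition inc (a : nat) : cmd := SetI a (IConst 0) (IAdd (iv a) (IConst 1)).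
Definition rinc (a : nat) : cmd := SetR a (IConst 0) (RAdd (rv a) (RConst 1)).

(** Cursors are shifted by one, so the zeros of the initial memory already encode empty lists,
    unmarked columns and an empty column list. *)
Definition LinkB : cmd :=
  Seq (SetI 4 (iv 14) (IGet 5 rowE))
 (Seq (SetI 5 rowE (IAdd (iv 14) (IConst 1)))
      (If (BLeI (IGet 6 colE) (IConst 0))
          (Seq (SetI 7 (iv 8) colE) (Seq (inc 8) (SetI 6 colE (IConst 1))))
          Skip)).

(** Rounding up by repeated subtraction: a slot is issued as long as the share still due is
    positive. *)
Definition SlotB : cmd :=
  Seq (SetR 6 (IConst 0) (RDiv (RMul (RMul valE valE) (rv 5)) (rv 4)))
      (While (BNot (BLeR (rv 6) (RConst 0)))
        (Seq (SetI 9 (iv 10) rowE)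
        (Seq (inc 10)
        (Seq (SetR 7 rowE (RAdd (RGet 7 rowE) (RConst 1)))
        (Seq (rinc 8)
             (SetR 6 (IConst 0) (RSub (rv 6) (RConst 1)))))))).

(** Computes M = ceil(nnz / D) without division: cell 21 holds M D, and a new block is opened
    whenever the entry index reaches it. *)
Definition BlockB : cmd :=
  If (BLeI (iv 21) (iv 14))
     (Seq (SetI 21 (IConst 0) (IAdd (iv 21) (iv 8))) (Seq (inc 11) (rinc 9)))
     Skip.

Definition gaE0 : rexpr := RDiv (RMul (rv 12) (RMul (rv 10) (rv 10))) (RConst 2).
Definition WlamE : rexpr := RMul (RConst 32) (RMul (rv 4) lamE).
Definition thetaE : rexpr :=
  RDiv (RMul (RMul (RMul (RConst 2) (rv 10))
                   (RMul (RAdd lamE (rv 13)) (RAdd lamE (rv 13)))) lamE)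
       (RMul (rv 12) (RMul (rv 13) (rv 13))).

Definition Sums : cmd :=
  Seq (For 14 nnzE (SetR 4 (IConst 0) (RAdd (rv 4) (RMul valE valE))))
      (For 14 nnzE (rinc 5)).

(** Both searches go upwards and stop at the first admissible value; the minimality of N and K is
    what bounds them in the running time analysis. *)
Definition Params : cmd :=
  Seq (SetR 12 (IConst 0) (RDiv (RMul (RGet 0 (IConst 1)) lamE) (RConst 200)))
 (Seq (SetI 12 (IConst 0) (IConst 2))
 (Seq (SetR 10 (IConst 0) (RConst 2))
 (Seq (While (BNot (BLeR WlamE (RMul (RMul gaE0 gaE0) (rv 9))))
             (Seq (inc 12) (rinc 10)))
 (Seq (SetR 13 (IConst 0) gaE0)
 (Seq (SetR 14 (IConst 0)
        (RDiv (rv 13) (RAdd WlamE (RMul (RConst 2) (RMul (rv 13) (rv 13))))))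
 (Seq (SetR 11 (IConst 0) (RConst 1))
      (While (BNot (BLeR thetaE (rv 11)))
             (Seq (SetR 11 (IConst 0) (RMul (rv 11) (RConst 2))) (inc 13))))))))).

Definition Start : cmd :=
  Seq (Map 18 (RSub (RGet 3 jE) (RDiv (RGet 2 jE) lamE))) (Map 16 (RGet 18 jE)).

Definition Prep : cmd :=
  Seq Sums (Seq (For 14 nnzE LinkB) (Seq (For 14 nnzE SlotB)
 (Seq (For 14 nnzE BlockB) (Seq Params Start)))).

Section Ceil.
Variable R : realType.
Implicit Types X : R.

Definition nceil X : nat := `|Num.ceil X|%N.

Lemma nceil_gt X x : 0 <= X -> (x < nceil X)%N = (x%:R < X).
Proof.
move=> X0; have c0 : 0 <= Num.ceil X by rewrite ceil_ge0; lra.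
by rewrite -[x%:R]/((x : int)%:~R) -ceil_gt_int -ltz_nat /nceil gez0_abs.
Qed.

Lemma nceil_ge X : 0 <= X -> X <= (nceil X)%:R.
Proof. by move=> X0; rewrite leNgt -nceil_gt // ltnn. Qed.

Lemma nceil_le X : 0 <= X -> (nceil X)%:R <= X + 1.
Proof.
move=> X0; case E : (nceil X) => [|k]; first by rewrite addr_ge0.
by rewrite -natr1 lerD2r ltW // -nceil_gt // E.
Qed.

End Ceil.

Section Prepare.
Variables (R : realType) (N : nat) (re ce : nat -> nat) (ae : nat -> R).
Variables (lam : R) (b : nat -> R).

Fixpoint Clf (i : nat) : seq nat :=
  if i is i'.+1 then
    let l := Clf i' in if ce i' \in l then l else rcons l (ce i')
  else [::].

Lemma Clf_uniq i : uniq (Clf i).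
Proof. by elim: i => [//|i IH] /=; case: ifPn => // ni; rewrite rcons_uniq ni. Qed.

Lemma mem_Clf i j : (j \in Clf i) = (j \in mkseq ce i).
Proof.
elim: i => [//|i IH]; rewrite /mkseq -addn1 iotaD map_cat /= add0n addn1 mem_cat inE -IH /=.
case: ifPn => h; last by rewrite mem_rcons inE orbC.
by case: eqP => [->|_]; rewrite ?h ?orbF.
Qed.

Lemma Clf_ce i e : (e < i)%N -> ce e \in Clf i.
Proof. by move=> lt; rewrite mem_Clf; apply/mapP; exists e => //; rewrite mem_iota. Qed.

Lemma Clf_size i : (size (Clf i) <= i)%N.
Proof. by elim: i => [//|i IH] /=; case: ifP => _; rewrite ?size_rcons // leqW. Qed.

(* Rounding up the ideal number of slots of each entry gives at most [2 N] slots
   in all, so every row is drawn with at least half its ideal probability. *)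
Definition kE (W : R) (e : nat) : nat := nceil (ae e * ae e * N%:R / W).

Fixpoint SLf (W : R) (i : nat) : seq nat :=
  if i is i'.+1 then SLf W i' ++ nseq (kE W i') (re i') else [::].

Lemma size_SLf W i : size (SLf W i) = (\sum_(e < i) kE W e)%N.
Proof.
by elim: i => [|i IH]; rewrite ?big_ord0 // big_ord_recr /= size_cat size_nseq IH.
Qed.

Lemma count_SLf W i r :
  count_mem r (SLf W i) = (\sum_(e < i | re e == r) kE W e)%N.
Proof.
elim: i => [|i IH]; first by rewrite big_ord0.
rewrite big_mkcond big_ord_recr -big_mkcond /= count_cat IH count_nseq /=.
by case: eqP => _; rewrite ?mul1n ?mul0n.
Qed.

Lemma mem_SLf W i r : r \in SLf W i -> exists2 e, (e < i)%N & r = re e.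
Proof.
elim: i => [//|i IH] /=; rewrite mem_cat => /orP [/IH [e lt ->]|].
  by exists e => //; rewrite ltnW.
by rewrite mem_nseq => /andP [_ /eqP ->]; exists i.
Qed.

Lemma chain_ext (nx nx' : nat -> nat) p l :
  (forall e, e \in l -> nx' e = nx e) -> chain nx p l -> chain nx' p l.
Proof.
elim: l p => [//|e l IH] p H /= [-> ch]; split=> //.
rewrite H ?inE ?eqxx //; apply: IH ch => e' he'; apply: H.
by rewrite inE he' orbT.
Qed.

Lemma rowlistS i r : rowlist re i.+1 r =
  if re i == r then i :: rowlist re i r else rowlist re i r.
Proof.
rewrite /rowlist -addn1 iotaD filter_cat /= add0n rev_cat.
by case: ifP => _.
Qed.

Lemma wpd_sums s : Data N re ce ae lam b s -> rmem s 4 0 = 0 -> rmem s 5 0 = 0 ->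
  wpd Sums s (N * 8 + 7) (fun s' => [/\ frame [:: 14%N] [:: 4; 5]%N s s',
    rmem s' 4 0 = \sum_(e < N) ae e * ae e & rmem s' 5 0 = N%:R]).
Proof.
move=> D z4 z5.
have -> : (N * 8 + 7 = ((N * 4 + 3) + (N * 4 + 3)).+1)%N by lia.
apply: wpd_seq (wpd_for_setr (n := N) (ix := fun=> 0%N)
  (vl := fun g i => g 0%N + ae i * ae i) _ _) _.
- by move=> s1 f1 /=; rewrite f1.1 // (d_nnz D).
- by move=> i s1 lt f1 Ei _; rewrite /= Ei !(f1.2 1%N) // (d_val D).
move=> s1 [f1 e1].
have w1 : rmem s1 4 0 = \sum_(e < N) ae e * ae e.
  by rewrite e1 (afold_add (fun=> 0%N) (fun i => ae i * ae i)) z4 add0r.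
apply: wpd_weaken (wpd_for_setr (n := N) (ix := fun=> 0%N)
  (vl := fun g i => g 0%N + 1) _ _) _ _ => //.
- by move=> s2 f2 /=; rewrite f2.1 // f1.1 // (d_nnz D).
move=> s2 [f2 e2]; split.
- by apply: frame_trans f2; try exact: sub_all_mem; apply: frame_trans f1;
    try exact: sub_all_mem; exact: frame_refl.
- by rewrite f2.2.
- rewrite e2 (afold_add (fun=> 0%N) (fun i => 1)) f1.2 // z5 add0r.
  by rewrite sumr_const card_ord.
Qed.

Definition linked i (s : state R) := [/\ imem s 8 0 = size (Clf i),
  forall k, (k < size (Clf i))%N -> imem s 7 k = nth 0%N (Clf i) k,
  forall j, imem s 6 j = (j \in Clf i) :> nat &
  forall r, chain (imem s 4) (imem s 5 r) (rowlist re i r)] : Prop.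

Lemma wpd_link (s : state R) : Data N re ce ae lam b s ->
  imem s 4 = (fun=> 0%N) -> imem s 5 = (fun=> 0%N) -> imem s 6 = (fun=> 0%N) ->
  imem s 8 = (fun=> 0%N) ->
  wpd (For 14 nnzE LinkB) s (N * 13 + 3) (fun s' =>
    frame [:: 4; 5; 6; 7; 8; 14]%N [::] s s' /\ linked N s').
Proof.
move=> D z4 z5 z6 z8.
have -> : (N * 13 + 3 = \sum_(i < N) (10 + 3) + 3)%N by rewrite sum_nat_const card_ord.
apply: (wpd_for (Inv := fun i s' => frame [:: 4; 5; 6; 7; 8; 14]%N [::] s s' /\ linked i s')
  (tb := fun _ => 10%N)).
- by move=> i s1 x [f1 [? ? ? ?]]; split=> //; exact: frame_seti.
- by move=> i s1 [f1 _]; rewrite /= f1.1 // (d_nnz D).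
- move=> i s1 lt [f1 [h8 h7 h6 hc]] Ei.
  have r1 : imem s1 1 = re by rewrite f1.1 // (d_row D).
  have c1 : imem s1 2 = ce by rewrite f1.1 // (d_col D).
  apply: (@wpd_seq _ _ _ _ 1 8 (fun s' => s' = seti s1 4 i (imem s1 5 (re i)))).
    by apply: wpd_seti; rewrite /= Ei r1.
  move=> s2 Es2.
  apply: (@wpd_seq _ _ _ _ 1 6 (fun s' => s' = seti s2 5 (re i) i.+1)).
    by apply: wpd_seti; rewrite Es2 /= /upd /= Ei r1 addn1.
  move=> s3 Es3.
  (* The existing lists contain only indices below i, so writing cell i of array 4 leaves their
     chains intact. *)
  have hc3 r : chain (imem s3 4) (imem s3 5 r) (rowlist re i.+1 r).
    have ce3 l p : (forall e, e \in l -> (e < i)%N) -> chain (imem s1 4) p l ->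
        chain (imem s3 4) p l.
      move=> H; apply: chain_ext => e /H lte.
      by rewrite Es3 Es2 /= /upd /= (ltn_eqF lte).
    have ltl e : e \in rowlist re i r -> (e < i)%N.
      by rewrite mem_rev mem_filter mem_iota => /and3P [].
    rewrite rowlistS; case: (re i =P r) => [Er|nr].
      split; first by rewrite Es3 /= /upd /= Er eqxx.
      have -> : imem s3 4 i = imem s1 5 r by rewrite Es3 Es2 /= /upd /= eqxx Er.
      exact: ce3.
    have -> : imem s3 5 r = imem s1 5 r.
      by rewrite Es3 Es2 /= /upd /=; case: eqP => // E; case: nr.
    exact: ce3.
  have f3 : frame [:: 4; 5; 6; 7; 8; 14]%N [::] s s3.
    by rewrite Es3 Es2; do 2 apply: frame_seti => //.
  have E3 : imem s3 14 0 = i by rewrite Es3 Es2.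
  have c3 : imem s3 2 = ce by rewrite Es3 Es2.
  have h83 : imem s3 8 0 = size (Clf i) by rewrite Es3 Es2.
  have h73 : imem s3 7 = imem s1 7 by rewrite Es3 Es2.
  have h63 j : imem s3 6 j = (j \in Clf i) by rewrite Es3 Es2; exact: h6.
  apply: wp_if => /=; rewrite E3 c3 h63; case: (boolP (ce i \in Clf i)) => //= hi _.
    apply: (@wpd_seq _ _ _ _ 1 3 (fun s' => s' = seti s3 7 (size (Clf i)) (ce i))).
      by apply: wpd_seti; rewrite /= E3 c3 h83.
    move=> s4 Es4.
    apply: (@wpd_seq _ _ _ _ 1 1 (fun s' => s' = seti s4 8 0 (size (Clf i)).+1)).
      by apply: wpd_seti; rewrite Es4 /= /upd /= h83 addn1.
    move=> s5 Es5.
    apply: wpd_seti; rewrite Es5 Es4 /= /upd /= E3 c3; split=> //; split.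
      by do 3 apply: frame_seti => //.
    split=> /=.
    + by rewrite (negPf hi) size_rcons.
    + rewrite (negPf hi) size_rcons /upd /= => k; rewrite ltnS leq_eqVlt nth_rcons h73.
      by case: (ltngtP k (size (Clf i))) => //= hk _; rewrite h7.
    + move=> j; rewrite (negPf hi) mem_rcons inE /upd /=; case: eqP => //= _; exact: h63.
    + exact: hc3.
  apply: wpd_skip => //.
  split=> //; split=> //; split=> //; rewrite /= ?hi //.
  by move=> k hk; rewrite h73 h7.
- split=> //; split=> //=.
  + by rewrite z8.
  + by move=> j; rewrite z6.
  + by move=> r; rewrite z5.
Qed.

Definition slots (l : seq nat) (s : state R) := [/\ imem s 10 0 = size l,
  forall k, (k < size l)%N -> imem s 9 k = nth 0%N l k,
  rmem s 8 0 = (size l)%:R & forall r, rmem s 7 r = (count_mem r l)%:R] : Prop.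

Lemma wpd_slots (W : R) (s : state R) : 0 < W -> Data N re ce ae lam b s ->
  rmem s 4 0 = W -> rmem s 5 0 = N%:R -> slots [::] s ->
  wpd (For 14 nnzE SlotB) s (size (SLf W N) * 10 + N * 6 + 3) (fun s' =>
    frame [:: 9; 10; 14]%N [:: 6; 7; 8]%N s s' /\ slots (SLf W N) s').
Proof.
move=> W0 D w4 n5 sl0.
have -> : (size (SLf W N) * 10 + N * 6 + 3 = \sum_(i < N) (kE W i * 10 + 3 + 3) + 3)%N.
  congr (_ + _)%N; rewrite size_SLf big_distrl /= -[X in (_ + X)%N](_ : (\sum_(i < N) 6)%N = _).
    by rewrite -big_split /=; apply: eq_bigr => e _; rewrite -addnA.
  by rewrite sum_nat_const card_ord.
apply: (wpd_for (Inv := fun i s' => frame [:: 9; 10; 14]%N [:: 6; 7; 8]%N s s' /\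
  slots (SLf W i) s') (tb := fun i => (kE W i * 10 + 3)%N)).
- by move=> i s1 x [f1 [? ? ? ?]]; split=> //; exact: frame_seti.
- by move=> i s1 [f1 _]; rewrite /= f1.1 // (d_nnz D).
- move=> i s1 lt [f1 sl1] Ei.
  pose X := ae i * ae i * N%:R / W.
  have X0 : 0 <= X by rewrite /X -expr2 divr_ge0 ?(ltW W0) // mulr_ge0 // sqr_ge0.
  have -> : (kE W i * 10 + 3 = (1 + (\sum_(x < kE W i) 9.+1).+1).+1)%N.
    by rewrite sum_nat_const card_ord addn3 add1n.
  apply: (@wpd_seq _ _ _ _ _ _ (fun s' => s' = setr s1 6 0 X)).
    by apply: wpd_setr; rewrite /= Ei !(f1.2 1%N) // !(f1.2 4%N) // !(f1.2 5%N) // (d_val D) w4 n5.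
  move=> s2 Es2.
  pose Inv x s' := [/\ frame [:: 9; 10; 14]%N [:: 6; 7; 8]%N s s', imem s' 14 0 = i,
     slots (SLf W i ++ nseq x (re i)) s' & rmem s' 6 0 = X - x%:R].
  apply: (wp_weaken (@wp_while R _ _ (kE W i) (fun=> 9%N) Inv (fun _ _ => 0) s2 _ _ _)) => //.
  + move=> x s3 ltx [f3 E3 [h10 h9 h8 h7] h6]; split.
      by rewrite /= h6 -ltNge subr_gt0 -nceil_gt.
    have r3 : imem s3 1 = re by rewrite f3.1 // (d_row D).
    set l := SLf W i ++ nseq x (re i) in h10 h9 h8 h7.
    have lS : SLf W i ++ nseq x.+1 (re i) = rcons l (re i).
      by rewrite -addn1 nseqD catA cats1.
    apply: (@wpd_seq _ _ _ _ 1 7 (fun s' => s' = seti s3 9 (size l) (re i))).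
      by apply: wpd_seti; rewrite /= E3 r3 h10.
    move=> s4 Es4.
    apply: (@wpd_seq _ _ _ _ 1 5 (fun s' => s' = seti s4 10 0 (size l).+1)).
      by apply: wpd_seti; rewrite Es4 /= /upd /= h10 addn1.
    move=> s5 Es5.
    apply: (@wpd_seq _ _ _ _ 1 3 (fun s' => s' = setr s5 7 (re i) ((count_mem (re i) l)%:R + 1))).
      by apply: wpd_setr; rewrite Es5 Es4 /= /upd /= E3 r3 h7.
    move=> s6 Es6.
    apply: (@wpd_seq _ _ _ _ 1 1 (fun s' => s' = setr s6 8 0 ((size l)%:R + 1))).
      by apply: wpd_setr; rewrite Es6 Es5 Es4 /= /upd /= h8.
    move=> s7 Es7.
    apply: wpd_setr; rewrite Es7 Es6 Es5 Es4 /= /upd /= h6; split.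
    * by do 3 apply: frame_setr => //; do 2 apply: frame_seti => //.
    * by rewrite /= /upd.
    * rewrite lS; split=> /=.
      - by rewrite /upd /= size_rcons.
      - rewrite size_rcons /upd /= => k; rewrite ltnS leq_eqVlt nth_rcons.
        by case: (ltngtP k (size l)) => //= hk _; rewrite h9.
      - by rewrite /upd /= size_rcons -natr1.
      - move=> r; rewrite /upd /= -cats1 count_cat /= addn0 natrD.
        rewrite [re i == r]eq_sym; case: eqP => [->//|_] /=.
        by rewrite h7 addr0.
    * by rewrite /= /upd /= -natr1; ring.
  + move=> s3 [_ _ _ h6]; rewrite /= h6 negbK subr_le0; exact: nceil_ge.
  + rewrite Es2; split=> //.
    * by apply: frame_setr.
    * by rewrite cats0.
    * by rewrite /= /upd /= subr0.
  + by move=> s3 [f3 E3 sl3 _].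
- by [].
Qed.

Lemma wpd_blocks (D M : nat) (s : state R) : (0 < D)%N -> (N <= M * D < N + D)%N ->
  imem s 0 2 = N -> imem s 8 0 = D -> imem s 11 0 = 0%N -> imem s 21 0 = 0%N ->
  rmem s 9 0 = 0 ->
  wpd (For 14 nnzE BlockB) s (N * 9 + 3) (fun s' =>
    [/\ frame [:: 11; 14; 21]%N [:: 9%N] s s', imem s' 11 0 = M & rmem s' 9 0 = M%:R]).
Proof.
move=> D0 /andP [M1 M2] h0 h8 z11 z21 z9.
have -> : (N * 9 + 3 = \sum_(i < N) (6 + 3) + 3)%N by rewrite sum_nat_const card_ord.
(* The inequalities say m = ceil(i / D); such an m is unique, which identifies it with M at the
   end. *)
pose Inv i s' := frame [:: 11; 14; 21]%N [:: 9%N] s s' /\ exists2 m,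
  (i <= m * D < i + D)%N & [/\ imem s' 11 0 = m, rmem s' 9 0 = m%:R & imem s' 21 0 = (m * D)%N].
apply: (wpd_weaken (@wpd_for R 14 nnzE BlockB N (fun=> 6%N) Inv s _ _ _ _)) => //.
- move=> i s1 x [f1 [m hm [? ? ?]]]; split; first exact: frame_seti.
  by exists m.
- by move=> i s1 [f1 _]; rewrite /= f1.1.
- move=> i s1 lt [f1 [m /andP [m1 m2] [h11 h9 h21]]] Ei.
  have h81 : imem s1 8 0 = D by rewrite f1.1.
  apply: wp_if; rewrite /= h21 Ei => hle.
    apply: (@wpd_seq _ _ _ _ 1 3 (fun s' => s' = seti s1 21 0 (m * D + D)%N)).
      by apply: wpd_seti; rewrite /= h21 h81.
    move=> s2 Es2.
    apply: (@wpd_seq _ _ _ _ 1 1 (fun s' => s' = seti s2 11 0 m.+1)).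
      by apply: wpd_seti; rewrite Es2 /= /upd /= h11 addn1.
    move=> s3 Es3.
    apply: wpd_setr; rewrite Es3 Es2 /= h9; split; last by rewrite /= /upd.
    split; first by apply: frame_setr => //; do 2 apply: frame_seti => //.
    exists m.+1; last by split; rewrite /= /upd /= ?natr1 // mulSn addnC.
    rewrite mulSn; apply/andP; split.
      by rewrite -add1n leq_add.
    by rewrite addnC ltn_add2r ltnS.
  apply: wpd_skip => //.
  split=> //; split=> //; exists m => //.
  by rewrite ltnNge hle addSn ltnW.
- by split=> //; exists 0%N; rewrite ?mul0n.
- move=> s1 [f1 [m /andP [m1 m2] [h11 h9 _]]].
  have -> : M = m; last by [].
  apply/eqP; rewrite eqn_leq; apply/andP; split.
    rewrite -ltnS -(ltn_pmul2r D0) mulSn addnC.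
    by apply: leq_trans M2 _; rewrite leq_add2r.
  rewrite -ltnS -(ltn_pmul2r D0) mulSn addnC.
  by apply: leq_trans m2 _; rewrite leq_add2r.
Qed.

End Prepare.

Section Params.
Variables (R : realType) (lam gap W : R) (M Nn K : nat).
Let mu : R := gap * lam / 200.
Let gaf (m : nat) : R := mu * (m%:R * m%:R) / 2.
Let ga := gaf Nn.
Let theta : R := 2 * Nn%:R * ((lam + ga) * (lam + ga)) * lam / (mu * (ga * ga)).
Hypothesis Nn_ge2 : (2 <= Nn)%N.
Hypothesis Nn_ok : 32 * (W * lam) <= gaf Nn * gaf Nn * M%:R.
Hypothesis Nn_min : forall m, (2 <= m < Nn)%N -> ~~ (32 * (W * lam) <= gaf m * gaf m * M%:R).
Hypothesis K_ok : theta <= 2 ^+ K.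
Hypothesis K_min : forall k, (k < K)%N -> ~~ (theta <= 2 ^+ k).

Lemma wpd_params (s : state R) :
  rmem s 0 0 = lam -> rmem s 0 1 = gap -> rmem s 4 0 = W -> rmem s 9 0 = M%:R ->
  imem s 13 0 = 0%N ->
  wpd Params s (Nn * 4 + K * 4 + 15) (fun s' =>
    [/\ frame [:: 12; 13]%N [:: 10; 11; 12; 13; 14]%N s s',
      imem s' 12 0 = Nn, imem s' 13 0 = K &
     [/\ rmem s' 10 0 = Nn%:R, rmem s' 12 0 = mu, rmem s' 13 0 = ga &
         rmem s' 14 0 = ga / (32 * (W * lam) + 2 * (ga * ga))]]).
Proof.
move=> hl hg hW hM hK.
apply: (@wpd_weaken _ _ _ (1 + (1 + (1 + ((\sum_(i < Nn - 2) 3.+1).+1 + (1 + (1 + (1 +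
  (\sum_(i < K) 3.+1).+1).+1).+1).+1).+1).+1).+1).+1); last by move=> s'; exact.
2: { by rewrite !sum_nat_const !card_ord; have := leq_subr 2 Nn; lia. }
apply: (@wpd_seq _ _ _ _ _ _ (fun s' => s' = setr s 12 0 mu)).
  by apply: wpd_setr; rewrite /= hl hg.
move=> s1 Es1.
apply: (@wpd_seq _ _ _ _ _ _ (fun s' => s' = seti s1 12 0 2)); first exact: wpd_seti.
move=> s2 Es2.
apply: (@wpd_seq _ _ _ _ _ _ (fun s' => s' = setr s2 10 0 2)); first exact: wpd_setr.
move=> s3 Es3.
(* The search starts at 2, which guarantees tau <= 1/2. *)
pose P1 i s' := [/\ frame [:: 12%N] [:: 10; 12]%N s s',
   imem s' 12 0 = (i + 2)%N, rmem s' 10 0 = (i + 2)%:R & rmem s' 12 0 = mu].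
apply: (@wpd_seq _ _ _ _ _ _ (P1 (Nn - 2)%N)).
  apply: (@wp_while R _ _ (Nn - 2) (fun=> 3%N) P1 (fun _ _ => 0) s3).
  - move=> i s4 lt [f4 h12 h10 hm]; split.
      rewrite /= h10 hm !(f4.2 4%N) // !(f4.2 0%N) // !(f4.2 9%N) // hW hl hM.
      by apply: Nn_min; rewrite leq_addl /= addnC -ltn_subRL.
    apply: (@wpd_seq _ _ _ _ 1 1 (fun s' => s' = seti s4 12 0 (i.+1 + 2)%N)).
      by apply: wpd_seti; rewrite /= h12 addn1 addSn.
    move=> s5 Es5; apply: wpd_setr; rewrite Es5 /= h10 natr1 -addSn; split=> //.
    + by apply: frame_setr => //; apply: frame_seti.
  - move=> s4 [f4 h12 h10 hm]; rewrite /= h10 hm !(f4.2 4%N) // !(f4.2 0%N) // !(f4.2 9%N) //.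
    by rewrite hW hl hM negbK subnK.
  - rewrite Es3 Es2 Es1; split=> //.
    by apply: frame_setr => //; apply: frame_seti => //; apply: frame_setr.
move=> s4 [f4]; rewrite subnK // => h12 h10 hm.
apply: (@wpd_seq _ _ _ _ _ _ (fun s' => s' = setr s4 13 0 ga)).
  by apply: wpd_setr; rewrite /= h10 hm.
move=> s5 Es5.
pose eta := ga / (32 * (W * lam) + 2 * (ga * ga)).
apply: (@wpd_seq _ _ _ _ _ _ (fun s' => s' = setr s5 14 0 eta)).
  by apply: wpd_setr; rewrite Es5 /= /upd /= !(f4.2 4%N) // !(f4.2 0%N) // hW hl.
move=> s6 Es6.
apply: (@wpd_seq _ _ _ _ _ _ (fun s' => s' = setr s6 11 0 1)); first exact: wpd_setr.
move=> s7 Es7.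
pose P2 i s' := [/\ frame [:: 12; 13]%N [:: 10; 11; 12; 13; 14]%N s s',
      imem s' 12 0 = Nn, imem s' 13 0 = i, rmem s' 11 0 = 2 ^+ i &
     [/\ rmem s' 10 0 = Nn%:R, rmem s' 12 0 = mu, rmem s' 13 0 = ga &
         rmem s' 14 0 = eta]].
apply: (wp_weaken (@wp_while R _ _ K (fun=> 3%N) P2 (fun _ _ => 0) s7 _ _ _)) => //.
- move=> i s8 lt [f8 k12 k13 k11 [k10 km kg ke]]; split.
    by rewrite /= k10 km kg k11 !(f8.2 0%N) // hl; exact: K_min.
  apply: (@wpd_seq _ _ _ _ 1 1 (fun s' => s' = setr s8 11 0 (2 ^+ i.+1))).
    by apply: wpd_setr; rewrite /= k11 exprSr.
  move=> s9 Es9; apply: wpd_seti; rewrite Es9 /= k13 addn1; split=> //.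
  by apply: frame_seti => //; apply: frame_setr.
- move=> s8 [f8 k12 k13 k11 [k10 km kg ke]].
  by rewrite /= k10 km kg k11 !(f8.2 0%N) // hl negbK.
- have fr : frame [:: 12; 13]%N [:: 10; 11; 12; 13; 14]%N s s4.
    by apply: frame_trans f4; try exact: sub_all_mem; exact: frame_refl.
  rewrite Es7 Es6 Es5; split=> //.
  + by do 3 apply: frame_setr => //.
  + by rewrite /= f4.1.
- by move=> s8 [f8 k12 k13 k11 [k10 km kg ke]].
Qed.

End Params.

Lemma wpd_start (R : realType) (N : nat) (re ce : nat -> nat) (ae : nat -> R)
  (Cl SL : seq nat) (lam : R) (b x0 : nat -> R) (s : state R) : uniq Cl ->
  Data N re ce ae lam b s -> Table N re Cl SL s -> rmem s 3 = x0 ->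
  rmem s 18 = (fun=> 0) -> rmem s 16 = (fun=> 0) ->
  wpd Start s (size Cl * 8 + 7) (fun s' =>
    [/\ frame [:: 15%N] [:: 16; 18]%N s s',
      rmem s' 18 = (fun j => if j \in Cl then x0 j - b j / lam else 0) &
      rmem s' 16 = rmem s' 18]).
Proof.
move=> uC D T h3 z18 z16.
have -> : (size Cl * 8 + 7 = ((size Cl * 4 + 3) + (size Cl * 4 + 3)).+1)%N by lia.
set F := fun j => if j \in Cl then _ else _.
have sF : supp Cl F by move=> j /negPf nj; rewrite /F nj.
apply: wpd_seq (wpd_map uC (F := F) T _ sF _) _.
- by rewrite z18.
- move=> s1 j f1 jC E7 _; rewrite /= E7 /F jC !(f1.2 3%N) // !(f1.2 2%N) // !(f1.2 0%N) //.
  by rewrite h3 (d_b D) (d_lam D).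
move=> s1 [f1 e1].
have T1 : Table N re Cl SL s1 by apply: Table_frame f1 T.
apply: wpd_weaken (wpd_map uC (F := F) T1 _ sF _) _ _ => //.
- by rewrite f1.2 // z16.
- by move=> s2 j f2 jC E7 _; rewrite /= E7 f2.2 // e1.
move=> s2 [f2 e2]; split.
- apply: frame_trans f2; try exact: sub_all_mem.
  by apply: frame_trans f1; try exact: sub_all_mem; exact: frame_refl.
- by rewrite f2.2.
- by rewrite e2 f2.2.
Qed.

(** * Correctness and cost of the whole program on a given input *)

Section Run.
Variables (R : realType) (n d : nat) (A : 'M[R]_(n, d)) (lam gap : R).
Variables (bv x0v : 'cV[R]_d) (M Nn K : nat).
Let N := nnz A.
Let re := ent_row A.
Let ce := ent_col A.
Let ae := ent_val A.
Let Cl := Clf ce N.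
Let W : R := frobenius_norm A ^+ 2.
Let SL := SLf N re ae W N.
Let b (j : nat) : R := nth 0 [seq bv j 0 | j <- enum 'I_d] j.
Let x0 (j : nat) : R := nth 0 [seq x0v j 0 | j <- enum 'I_d] j.
Let mu : R := gap * lam / 200.
Let gaf (m : nat) : R := mu * (m%:R * m%:R) / 2.
Let ga := gaf Nn.
Let theta : R := 2 * Nn%:R * ((lam + ga) * (lam + ga)) * lam / (mu * (ga * ga)).
Hypothesis N_gt0 : (0 < N)%N.
Hypothesis mu_gt0 : 0 < mu.
Hypothesis mu_le : mu <= lam.
Hypothesis opA : forall v : 'cV[R]_d, dotp (A *m v) (A *m v) <= (lam - mu) * dotp v v.
Hypothesis lam_W : lam <= 2 * W.
Hypothesis M_ok : (N <= M * size Cl < N + size Cl)%N.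
Hypothesis Nn_ge2 : (2 <= Nn)%N.
Hypothesis Nn_ok : 32 * (W * lam) <= gaf Nn * gaf Nn * M%:R.
Hypothesis Nn_min : forall m, (2 <= m < Nn)%N -> ~~ (32 * (W * lam) <= gaf m * gaf m * M%:R).
Hypothesis K_ok : theta <= 2 ^+ K.
Hypothesis K_min : forall k, (k < K)%N -> ~~ (theta <= 2 ^+ k).

Let W_gt0 : 0 < W. Proof. by move: mu_gt0 mu_le lam_W; lra. Qed.

Let WE : W = \sum_(e < N) ae e * ae e.
Proof. by rewrite /W frobenius_norm_sq frob_sum; apply: eq_bigr => e _; rewrite expr2. Qed.

Lemma SL_size : (size SL <= 2 * N)%N.
Proof.
rewrite size_SLf -(ler_nat R) natr_sum.
apply: (@le_trans _ _ (\sum_(e < N) (ae e * ae e * N%:R / W + 1))).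
  apply: ler_sum => e _; apply: nceil_le.
  by rewrite -expr2 divr_ge0 ?(ltW W_gt0) // mulr_ge0 // sqr_ge0.
rewrite big_split /= -mulr_suml -mulr_suml -WE sumr_const card_ord mulrAC mulfV ?gt_eqF //.
by rewrite mul1r natrM; lra.
Qed.

Let kE_ge e : ae e * ae e * N%:R / W <= (kE N ae W e)%:R.
Proof.
by apply: nceil_ge; rewrite -expr2 divr_ge0 ?(ltW W_gt0) // mulr_ge0 // sqr_ge0.
Qed.

Lemma SL_count (i : 'I_n) :
  (size SL)%:R * \sum_j A i j ^+ 2 <= 2 * W * (count_mem (i : nat) SL)%:R.
Proof.
have N0 : 0 < N%:R :> R by rewrite ltr0n.
have q0 : 0 <= \sum_j A i j ^+ 2 by apply: sumr_ge0 => j _; rewrite sqr_ge0.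
apply: (@le_trans _ _ (2 * N%:R * \sum_j A i j ^+ 2)).
  by rewrite ler_wpM2r // -natrM ler_nat SL_size.
rewrite -mulrA -[leRHS]mulrA ler_pM2l // count_SLf natr_sum row_sq !mulr_sumr.
apply: ler_sum => e _.
have := ler_wpM2l (ltW W_gt0) (kE_ge e).
by rewrite mulrC divfK ?gt_eqF // expr2 mulrC.
Qed.

Lemma SL_gt0 : (0 < size SL)%N.
Proof.
rewrite size_SLf -(ltr_nat R) natr_sum.
apply: (@lt_le_trans _ _ (\sum_(e < N) (ae e * ae e * N%:R / W))).
  rewrite -mulr_suml -mulr_suml -WE mulrAC mulfV ?gt_eqF // mul1r ltr0n //.
by apply: ler_sum => e _; exact: kE_ge.
Qed.

Lemma Cl_gt0 : (0 < size Cl)%N.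
Proof. by have := Clf_ce ce N_gt0; rewrite -/Cl; case: Cl. Qed.

Lemma Cl_le : (size Cl <= d)%N.
Proof.
rewrite -(size_iota 0 d); apply: uniq_leq_size; first exact: Clf_uniq.
move=> j; rewrite mem_Clf => /mapP [e]; rewrite !mem_iota !add0n => /andP [_ lt] -> /=.
exact: ent_col_lt.
Qed.

Lemma A_zero_col (i : 'I_n) (j : 'I_d) : (j : nat) \notin Cl -> A i j = 0.
Proof.
move=> nj; rewrite -(acolE (@sum_entries R n d A) i j) mxE big1 // => e /andP [_ /eqP E].
case/negP: nj; rewrite -E /Cl -/ce; exact: Clf_ce.
Qed.

Let s0 : state R := input A lam gap bv x0v.
Let F (j : nat) : R := if j \in Cl then x0 j - b j / lam else 0.
Let eta : R := ga / (32 * (W * lam) + 2 * ga ^+ 2).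

Lemma input_i0 a : (2 < a)%N -> imem s0 a = fun=> 0%N.
Proof. by move=> ha; apply/funext => i /=; rewrite (nth_default [::]) // nth_nil. Qed.

Lemma input_r0 a : (3 < a)%N -> rmem s0 a = fun=> 0.
Proof. by move=> ha; apply/funext => i /=; rewrite (nth_default [::]) // nth_nil. Qed.

Definition prep_time : nat := ((N * 8 + 7) + ((N * 13 + 3) +
  ((size SL * 10 + N * 6 + 3) + ((N * 9 + 3) +
  ((Nn * 4 + K * 4 + 15) + (size Cl * 8 + 7)).+1).+1).+1).+1).+1.

Lemma wpd_prep : wpd Prep s0 prep_time (fun s =>
  [/\ Consts N re ce ae Cl SL lam mu ga eta b M Nn K s, Supps Cl s,
      rmem s 18 = F & rmem s 16 = rmem s 18]).
Proof.
have D0 : Data N re ce ae lam b s0 by split.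
rewrite /prep_time.
apply: wpd_seq (wpd_sums D0 _ _) _; [by rewrite input_r0 | by rewrite input_r0 |].
move=> s1 [f1 hW1 hN1]; rewrite -WE in hW1.
have D1 : Data N re ce ae lam b s1 by apply: Data_frame f1 D0.
apply: wpd_seq (wpd_link D1 _ _ _ _) _; try by rewrite f1.1 // input_i0.
move=> s2 [f2 [h8 h7 h6 hc]].
have D2 : Data N re ce ae lam b s2 by apply: Data_frame f2 D1.
have Z2i a : (2 < a)%N -> a \notin [:: 4; 5; 6; 7; 8; 14]%N -> imem s2 a = fun=> 0%N.
  move=> ha na; rewrite f2.1 // f1.1 ?input_i0 //.
  by apply: contraNN na; rewrite !inE => /eqP ->.
have Z2r a : (3 < a)%N -> a \notin [:: 4; 5]%N -> rmem s2 a = fun=> 0.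
  by move=> ha na; rewrite f2.2 // f1.2 ?input_r0.
have W2 : rmem s2 4 0 = W by rewrite f2.2.
have N2 : rmem s2 5 0 = N%:R by rewrite f2.2.
apply: wpd_seq (wpd_slots W_gt0 D2 W2 N2 _) _.
  by split=> //; [rewrite Z2i | rewrite Z2r | move=> r; rewrite Z2r].
move=> s3 [f3 [h10 h9 hr8 hr7]].
have D3 : Data N re ce ae lam b s3 by apply: Data_frame f3 D2.
have T3 : Table N re Cl SL s3.
  split=> //; first by rewrite f3.1.
    by move=> i lt; rewrite f3.1 // h7.
  by move=> r; rewrite !f3.1.
apply: wpd_seq (wpd_blocks Cl_gt0 M_ok (d_nnz D3) (d_D T3) _ _ _) _.
- by rewrite f3.1 // Z2i.
- by rewrite f3.1 // Z2i.
- by rewrite f3.2 // Z2r.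
move=> s4 [f4 h11 h9r].
have D4 : Data N re ce ae lam b s4 by apply: Data_frame f4 D3.
have T4 : Table N re Cl SL s4 by apply: Table_frame f4 T3.
have gap4 : rmem s4 0 1 = gap by rewrite f4.2 // f3.2 // f2.2 // f1.2.
have W4 : rmem s4 4 0 = W by rewrite f4.2 // f3.2.
have K4 : imem s4 13 0 = 0%N by rewrite f4.1 // f3.1 // Z2i.
apply: wpd_seq (wpd_params Nn_ge2 Nn_ok Nn_min K_ok K_min (d_lam D4) gap4 W4 h9r K4) _.
move=> s5 [f5 h12 h13 [hr10 hr12 hr13 hr14]].
have D5 : Data N re ce ae lam b s5 by apply: Data_frame f5 D4.
have T5 : Table N re Cl SL s5 by apply: Table_frame f5 T4.
have Z5 a : (3 < a)%N -> a \notin [:: 4; 5; 6; 7; 8; 9; 10; 11; 12; 13; 14]%N ->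
    rmem s5 a = fun=> 0.
  move=> ha; rewrite !inE !negb_or => /and5P [n4 n5 n6 n7 /and5P [n8 n9 n10 n11 /and3P [n12 n13 n14]]].
  rewrite f5.2 ?inE ?negb_or ?n10 ?n11 ?n12 ?n13 ?n14 //.
  rewrite f4.2 ?inE ?n9 // f3.2 ?inE ?negb_or ?n6 ?n7 ?n8 //.
  by rewrite Z2r // ?inE ?negb_or ?n4 ?n5.
have x5 : rmem s5 3 = x0 by rewrite f5.2 // f4.2 // f3.2 // f2.2 // f1.2.
have Cu : uniq Cl := Clf_uniq ce N.
apply: wpd_weaken (wpd_start Cu D5 T5 x5 _ _) _ _ => //; try by rewrite Z5.
move=> s6 [f6 e18 e16]; split=> //.
- split.
  + by apply: Data_frame f6 D5.
  + by apply: Table_frame f6 T5.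
  + by rewrite f6.2.
  + by rewrite f6.2.
  + by rewrite f6.2.
  + by rewrite f6.2.
  + by rewrite f6.1 // f5.1.
  + by rewrite f6.1.
  + by rewrite f6.1.
- have sF : supp Cl (rmem s6 18) by rewrite e18 => j /negPf nj; rewrite nj.
  split=> //; first by rewrite e16.
  + by rewrite f6.2 // Z5.
  + by rewrite f6.2 // Z5.
  + by rewrite f6.2 // Z5.
Qed.

Let B : 'M[R]_d := lam%:M - A^T *m A.
Let xs : 'cV[R]_d := invmx B *m bv.
Let bl : 'cV[R]_d := vec d (fun j => b j / lam).
Let ys : 'cV[R]_d := xs - bl.

Let lam_gt0 : 0 < lam. Proof. exact: lt_le_trans mu_gt0 mu_le. Qed.

Lemma nth_vec (v : 'cV[R]_d) (j : 'I_d) : nth 0 [seq v j 0 | j <- enum 'I_d] j = v j 0.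
Proof. by rewrite (nth_map j) ?size_enum_ord // nth_ord_enum. Qed.

Lemma colBE (u v : 'cV[R]_d) j : (u - v) j 0 = u j 0 - v j 0.
Proof. by rewrite !mxE. Qed.

Lemma lam_bl : lam *: bl = bv.
Proof.
apply/colP => j; rewrite !mxE /b nth_vec; field.
by rewrite gt_eqF.
Qed.

(** Shifting by b / lambda replaces the right-hand side b by Sigma b / lambda, which vanishes on
    zero columns. *)
Lemma ys_eq : Hm A lam 0 ys = A^T *m (A *m bl).
Proof.
have h : Hm A lam 0 xs = bv.
  have := shifted_gram_solve mu_gt0 opA bv (lexx 0); rewrite addr0; exact.
rewrite /ys HmD HmN h HmE addr0 lam_bl; apply/colP => j; rewrite !mxE; ring.
Qed.

Lemma normB_sq (v : 'cV[R]_d) : normB B v ^+ 2 = dotp v (Hm A lam 0 v).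
Proof.
have E : (v^T *m B *m v) 0 0 = dotp v (Hm A lam 0 v).
  by rewrite HmE addr0 dotp_mxE /B -mulmxA mulmxBl mul_scalar_mx -mulmxA.
by rewrite /normB E sqr_sqrtr //; apply: (Hm_psd mu_gt0 opA).
Qed.

(* Off the nonzero columns of [A] the solution is [b / lam], which is what the
   shifted iterates stand for when they vanish there. *)
Lemma start_error : dotp (vec d F - ys) (Hm A lam 0 (vec d F - ys)) <=
  dotp (x0v - xs) (Hm A lam 0 (x0v - xs)).
Proof.
pose u := x0v - xs; pose u' := vec d F - ys.
have ysj (j : 'I_d) : (j : nat) \notin Cl -> ys j 0 = 0.
  move=> nj; have := congr1 (fun v : 'cV[R]_d => v j 0) ys_eq.
  have z (v : 'cV[R]_n) : (A^T *m v) j 0 = 0.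
    by rewrite mxE big1 // => i _; rewrite mxE A_zero_col // mul0r.
  have E : (lam *: ys) j 0 = lam * ys j 0 by rewrite mxE.
  rewrite HmE addr0 /= colBE !z subr0 E => /eqP.
  by rewrite mulf_eq0 gt_eqF //= => /eqP.
have uE (j : 'I_d) : u' j 0 = if (j : nat) \in Cl then u j 0 else 0.
  have -> : u' j 0 = F j - ys j 0 by rewrite /u' colBE [vec _ _ _ _]mxE.
  rewrite /F; case: ifPn => jC.
    by rewrite /u /ys !colBE [bl j 0]mxE /x0 /b !nth_vec; ring.
  by rewrite ysj // subr0.
have AE : A *m u' = A *m u.
  apply/colP => i; rewrite !mxE; apply: eq_bigr => j _; rewrite uE.
  by case: ifPn => // jC; rewrite A_zero_col // !mul0r.
have G v : dotp v (Hm A lam 0 v) = lam * dotp v v - dotp (A *m v) (A *m v).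
  by rewrite HmE addr0 dotpDr dotpZr dotpNr -dotp_adj.
rewrite -/u -/u' !G AE lerD2r ler_pM2l // !dotp_def; apply: ler_sum => j _.
rewrite uE; case: ifP => // _; by rewrite mul0r -expr2 sqr_ge0.
Qed.

Definition total_time : nat :=
  (prep_time + (6 * Nn * (outer_time N Cl M K + 3) + 3)).+1.

Lemma wp_run : wp (Seq Prep Main) s0 total_time
  (fun s => rmem s 2 = b /\ rmem s 0 0 = lam)
  (fun s => dotp (vec d (rmem s 18) - ys) (Hm A lam 0 (vec d (rmem s 18) - ys)))
  (1 / 2 * normB B (x0v - xs) ^+ 2).
Proof.
apply: wpd_seq wpd_prep _ => s [C Su e18 e16].
have M0 : (0 < M)%N.
  by have /andP [h _] := M_ok; move: (leq_trans N_gt0 h); rewrite muln_gt0 => /andP [].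
have gaM : 32 * (W * lam) <= ga ^+ 2 * M%:R by exact: Nn_ok.
have Kok : 2 * Nn%:R * (lam + ga) ^+ 2 * lam / (mu * ga ^+ 2) <= 2 ^+ K by exact: K_ok.
have gaE : ga = mu * Nn%:R ^+ 2 / 2 by [].
have rl r : (size (rowlist re N r) <= size Cl)%N.
  by apply: ent_row_le => e lt; exact: Clf_ce.
have SLlt r : r \in SL -> (r < n)%N.
  by move=> /mem_SLf [e lt ->]; exact: ent_row_lt.
have Wm := @wp_main R n d A N re ce ae Cl SL lam mu W ga eta b M Nn K
  (@sum_entries R n d A) (Clf_uniq ce N) (fun e => @Clf_ce ce N e) rl SLlt SL_gt0
  SL_count mu_gt0 mu_le opA lam_W M0 Nn_ge2 gaE gaM erefl Kok ys ys_eq s C Su e16.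
apply: (wp_weaken Wm) => //.
  move=> s' [f _]; split=> //.
  by rewrite !f.2 // (d_b (c_data C)) (d_lam (c_data C)).
have h2 : 0 <= 1 / 2 :> R by lra.
rewrite normB_sq e18; apply: ler_wpM2l => //; exact: start_error.
Qed.

End Run.

(** * Running time *)

(** Both M D and M are at most 2 N, so 814 = 8 + 12 + 26 + 144 * 2 + 240 * 2. *)
Lemma epoch_time_le N D M : (0 < N)%N -> (D <= N)%N -> (0 < D)%N -> (M * D < N + D)%N ->
  ((D * 8 + N * 12 + 19 + (12 * M * (D * 12 + 20) + 3)).+1 + 3 <= 814 * N)%N.
Proof.
move=> N0 DN D0 MD.
have MD2 : (M * D <= 2 * N)%N by lia.
have M2 : (M <= 2 * N)%N by apply: leq_trans MD2; rewrite leq_pmulr.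
have -> : (12 * M * (D * 12 + 20) = 144 * (M * D) + 240 * M)%N by lia.
lia.
Qed.

Lemma outer_arith N D K E : (0 < N)%N -> (D <= N)%N -> (E + 3 <= 814 * N)%N ->
  ((D * 4 + 3 + (D * 4 + 3 + ((K * (E + 3) + 3) +
    (D * 8 + N * 12 + 19 + (D * 4 + 3)).+1).+1).+1).+1 + 3 <= 814 * (N * K.+1))%N.
Proof.
move=> N0 DN HE.
have : (K * (E + 3) <= K * (814 * N))%N by rewrite leq_mul2l HE orbT.
set Y := (K * (E + 3))%N; have -> : (K * (814 * N) = 814 * (N * K))%N by lia.
by rewrite mulnS; set Z := (N * K)%N; lia.
Qed.

(** The main loop accounts for 6 * 814 = 4884; the remaining 106 pays for the preparation. *)
Lemma total_arith N D Nn K O S : (0 < N)%N -> (D <= N)%N -> (1 < Nn)%N ->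
  (O + 3 <= 814 * (N * K.+1))%N -> (S <= 2 * N)%N ->
  ((N * 8 + 7 + (N * 13 + 3 + (S * 10 + N * 6 + 3 + (N * 9 + 3 +
     (Nn * 4 + K * 4 + 15 + (D * 8 + 7)).+1).+1).+1).+1).+1 +
   (6 * Nn * (O + 3) + 3) < 4990 * (N * Nn * K.+1))%N.
Proof.
move=> N0 DN N1 HO HS.
set X := (N * Nn * K.+1)%N.
have X1 : (2 * (N * K.+1) <= X)%N by rewrite /X mulnAC mulnC leq_mul2l N1 orbT.
have X2 : (2 * N <= X)%N by apply: leq_trans X1; rewrite leq_mul2l leq_pmulr.
have X3 : (2 * K.+1 <= X)%N by apply: leq_trans X1; rewrite leq_mul2l leq_pmull.
have X4 : (Nn <= X)%N.
  by rewrite /X mulnAC leq_pmull // muln_gt0 N0.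
have : (6 * Nn * (O + 3) <= 6 * Nn * (814 * (N * K.+1)))%N by rewrite leq_mul2l HO orbT.
have -> : (6 * Nn * (814 * (N * K.+1)) = 4884 * X)%N by rewrite /X; lia.
move: (6 * Nn * _)%N X X2 X3 X4 {X1 HO} => Y X; lia.
Qed.

Section Numeric.
Variable R : realType.

Lemma powR_quarter (x : R) (k : nat) : 0 <= x -> (x `^ (k%:R / 4)) ^+ 4 = x ^+ k.
Proof.
move=> x0; rewrite -powR_mulrn ?powR_ge0 // -powRrM -powR_mulrn //.
by congr (_ `^ _); field.
Qed.

(* Fourth powers turn the claimed bound into a rational inequality. *)
Lemma work_bound (a D gap Nn c : R) : 0 <= a -> 0 <= D -> 0 < gap -> 0 <= Nn -> 1 <= c ->
  a * Nn ^+ 4 <= c * (D / gap ^+ 2) ->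
  a * Nn <= c * (a `^ (3 / 4) * D `^ (1 / 4) / Num.sqrt gap).
Proof.
move=> a0 D0 g0 N0 c1 H.
set Q := _ / Num.sqrt gap.
have Q0 : 0 <= Q by rewrite /Q divr_ge0 ?sqrtr_ge0 // mulr_ge0 ?powR_ge0.
have c0 : 0 <= c by lra.
have sg : Num.sqrt gap ^+ 4 = gap ^+ 2.
  by rewrite -[4%N]/(2 * 2)%N exprM sqr_sqrtr // ltW.
have Q4 : Q ^+ 4 = a ^+ 3 * (D / gap ^+ 2).
  by rewrite /Q expr_div_n exprMn sg powR_quarter // (@powR_quarter D 1) // expr1 mulrA.
have A0 : a * Nn \is Num.nneg by rewrite nnegrE mulr_ge0.
have B0 : c * Q \is Num.nneg by rewrite nnegrE mulr_ge0.
rewrite -(ler_pXn2r (isT : (0 < 4)%N) A0 B0).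
rewrite [(a * Nn) ^+ 4]exprMn [(c * Q) ^+ 4]exprMn Q4.
have -> : a ^+ 4 * Nn ^+ 4 = a ^+ 3 * (a * Nn ^+ 4) by ring.
apply: (@le_trans _ _ (a ^+ 3 * (c * (D / gap ^+ 2)))).
  by rewrite ler_wpM2l // exprn_ge0.
rewrite mulrCA ler_wpM2r //.
  by rewrite mulr_ge0 ?exprn_ge0 // divr_ge0 // exprn_ge0 // ltW.
by rewrite -{1}[c]expr1 ler_weXn2l.
Qed.

(** Take logarithms at K - 1: 5 comes from the power of X and 2 from passing from K - 1 to K + 1. As
    ln 2 <= ln X, the additive constants are absorbed into multiples of ln X. *)
Lemma log_bound (X c : R) (K : nat) : 1 <= c -> 2 <= X ->
  (forall k, (k < K)%N -> 2 ^+ k <= c * X ^+ 5) ->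
  K.+1%:R <= (7 + ln c / ln 2) / ln 2 * ln X.
Proof.
move=> c1 X2 H.
have l2 : 0 < ln 2 :> R by rewrite ln_gt0 // ltr1n.
have X0 : 0 < X by lra.
have c0 : 0 < c by lra.
have lX : ln 2 <= ln X by rewrite ler_ln ?posrE.
have lc : 0 <= ln c by rewrite ln_ge0.
rewrite mulrAC ler_pdivlMr //.
have q0 : 0 <= ln c / ln 2 by rewrite divr_ge0 // ltW.
have E : ln c <= ln c / ln 2 * ln X.
  by rewrite -mulrA -[leLHS]mulr1 ler_wpM2l // mulrC ler_pdivlMr // mul1r.
case: K H => [|k] H.
  by rewrite mul1r; have := mulr_ge0 q0 (le_trans (ltW l2) lX); lra.
have := H k (ltnSn k); rewrite -ler_ln ?posrE ?mulr_gt0 ?exprn_gt0 //.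
rewrite lnM ?posrE ?exprn_gt0 // !lnXn // -[ln 2 *+ k]mulr_natr -[ln X *+ 5]mulr_natr => h.
have -> : k.+2%:R = k%:R + 2 :> R by rewrite -addn2 natrD.
by lra.
Qed.

Lemma pow2_unbounded (x : R) : exists k : nat, x <= 2 ^+ k.
Proof.
have h := archi_boundP (normr_ge0 x).
exists (Num.bound `|x|); apply: (le_trans (ler_norm x)); apply: (le_trans (ltW h)).
by rewrite -natrX ler_nat ltnW // ltn_expl.
Qed.

End Numeric.

Definition svrg_solver : solver :=
  Solver (Seq Prep Main) (RAdd (RGet 18 (iv ret_var)) (RDiv (RGet 2 (iv ret_var)) lamE)).

(** * Constants, existence of M, N and K, and the final bounds *)

Section Constants.
Variable R : realType.

(** 128 * 200^2 clears 32 W lam against gamma^2 = gap^2 lam^2 m^4 / (4 * 200^2). The 16 below comes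
    from (m + 1)^4 <= (2 m)^4, the 400 from 2 / mu = 400 / (gap lam), and 101 from lam / gamma + 1
    <= 101 / gap. *)
Definition root_const : R := 128 * 200 ^+ 2.
Definition momentum_const : R := 16 * root_const.
Definition epoch_const : R := 400 * 101 ^+ 2 * momentum_const.
Definition time_constant : R :=
  4990%:R * momentum_const * ((7 + ln epoch_const / ln 2) / ln 2).

Lemma root_const_ge1 : 1 <= root_const.
Proof.
have h : 1 <= 200 ^+ 2 :> R by rewrite exprn_ege1 // ler1n.
by rewrite /root_const; move: (_ ^+ 2) h => x h; lra.
Qed.

Lemma momentum_const_ge1 : 1 <= momentum_const.
Proof. by rewrite /momentum_const; move: root_const root_const_ge1 => c h; lra. Qed.

Lemma epoch_const_ge1 : 1 <= epoch_const.
Proof.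
have h : 1 <= 101 ^+ 2 :> R by rewrite exprn_ege1 // ler1n.
have := ler_pM ler01 ler01 h momentum_const_ge1.
by rewrite /epoch_const -mulrA; move: (101 ^+ 2 * momentum_const) => x; lra.
Qed.

Lemma time_constant_gt0 : 0 < time_constant.
Proof.
have l2 : 0 < ln 2 :> R by rewrite ln_gt0 // ltr1n.
have m0 : 0 < momentum_const by exact: lt_le_trans momentum_const_ge1.
have e0 : 0 <= ln epoch_const / ln 2.
  by apply: divr_ge0; [rewrite ln_ge0 // epoch_const_ge1 | exact: ltW].
have q0 : 0 < (7 + ln epoch_const / ln 2) / ln 2.
  by rewrite divr_gt0 //; move: (_ / _) e0 => x e0; lra.
by apply: mulr_gt0 q0; apply: mulr_gt0 m0; rewrite ltr0n.
Qed.

End Constants.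

Section Assembly.
Variables (R : realType) (n d : nat) (A : 'M[R]_(n, d)) (lam gap : R).
Variables (bv x0v : 'cV[R]_d).
Let N := nnz A.
Let D := size (Clf (ent_col A) N).
Let W : R := frobenius_norm A ^+ 2.
Let lam1 : R := spectral_norm A ^+ 2.
Let mu : R := gap * lam / 200.
Hypothesis d_gt1 : (2 <= d)%N.
Hypothesis lam1_gt0 : 0 < lam1.
Hypothesis gap_gt0 : 0 < gap.
Hypothesis gap_le1 : gap <= 1.
Hypothesis lam_gt : (1 + gap / 150) * lam1 < lam.
Hypothesis lam_le : lam <= (1 + gap / 100) * lam1.
Hypothesis nnz_le : N%:R <= d%:R * stable_rank A / gap ^+ 2.

Let gl_gt0 : 0 < gap * lam1. Proof. exact: mulr_gt0. Qed.
Let gl_le : gap * lam1 <= lam1. Proof. by rewrite -[leRHS]mul1r ler_pM2r. Qed.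

Let lam_bounds : [/\ lam1 < lam, lam <= 101 / 100 * lam1 & 0 < lam].
Proof. by move: lam_gt lam_le gl_gt0 gl_le lam1_gt0 => *; split; lra. Qed.

Let mu_gt0 : 0 < mu.
Proof. by have [_ _ l0] := lam_bounds; rewrite divr_gt0 // mulr_gt0. Qed.

(** lam - lam1 exceeds gap lam1 / 150, while mu <= 1.01 gap lam1 / 200. *)
Let lam1_mu : lam1 <= lam - mu.
Proof.
have [_ h _] := lam_bounds; have := ler_wpM2l (ltW gap_gt0) h.
by rewrite /mu; move: lam_gt gl_gt0 => *; lra.
Qed.

Let mu_le : mu <= lam. Proof. by move: lam1_mu lam1_gt0; lra. Qed.

Let opA (v : 'cV[R]_d) : dotp (A *m v) (A *m v) <= (lam - mu) * dotp v v.
Proof.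
by apply: (le_trans (spectral_norm_bound A v)); rewrite ler_wpM2r ?dotp_ge0.
Qed.

Let lam1_W : lam1 <= W.
Proof. by apply: spectral_norm_le; [exact: sqr_ge0 | exact: frobenius_bound]. Qed.

Let W_gt0 : 0 < W. Proof. exact: lt_le_trans lam1_W. Qed.

Let lam_W : lam <= 2 * W.
Proof. by have [_ h _] := lam_bounds; move: lam1_W lam1_gt0; lra. Qed.

Let N_gt0 : (0 < N)%N.
Proof.
rewrite lt0n; apply: contraTneq W_gt0 => N0.
by rewrite /W frobenius_norm_sq frob_sum -/N N0 big_ord0 ltxx.
Qed.

Let srE : stable_rank A = W / lam1. Proof. by []. Qed.

Let sr_gt0 : 0 < stable_rank A. Proof. by rewrite srE divr_gt0. Qed.

(** Each of the d columns is the image of a unit vector, so its squared norm is at most [lam1]. *)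
Let sr_le : stable_rank A <= d%:R.
Proof.
rewrite srE ler_pdivrMr // /W frobenius_norm_sq exchange_big /=.
rewrite -[X in X%:R]card_ord mulr_natl -sumr_const; apply: ler_sum => j _.
have := spectral_norm_bound A (delta_mx j 0).
have -> : dotp (delta_mx j 0 : 'cV[R]_d) (delta_mx j 0) = 1.
  rewrite dotp_def (bigD1 j) //= big1 ?addr0 => [|i /negPf ni].
    by rewrite mxE !eqxx mulr1.
  by rewrite mxE ni mul0r.
rewrite mulr1; apply: le_trans; rewrite dotp_def; apply: ler_sum => i _.
by rewrite -matrix.colE mxE expr2.
Qed.

Let D_gt0 : (0 < D)%N. Proof. exact: Cl_gt0. Qed.
Let D_leN : (D <= N)%N. Proof. exact: Clf_size. Qed.
Let D_led : (D <= d)%N. Proof. exact: Cl_le. Qed.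

Let gaf (m : nat) : R := mu * (m%:R * m%:R) / 2.

Lemma block_exists : exists M, (N <= M * D < N + D)%N.
Proof.
exists (N.-1 %/ D).+1; apply/andP; split.
  by have := ltn_ceil N.-1 D_gt0; rewrite prednK.
by rewrite mulSn addnC ltn_add2r; apply: leq_ltn_trans (leq_divM _ _) _; rewrite prednK.
Qed.

Lemma momentum_exists M : (0 < M)%N -> exists Nn, [/\ (2 <= Nn)%N,
  32 * (W * lam) <= gaf Nn * gaf Nn * M%:R &
  forall m, (2 <= m < Nn)%N -> ~~ (32 * (W * lam) <= gaf m * gaf m * M%:R)].
Proof.
move=> M0.
have M0' : 0 < M%:R :> R by rewrite ltr0n.
have [_ _ l0] := lam_bounds.
pose P m := (2 <= m)%N && (32 * (W * lam) <= gaf m * gaf m * M%:R).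
have ex : exists m, P m.
  (* gamma^2 M equals m^4 mu^2 M / 4, so any m >= X with m >= 1 is admissible. *)
  pose X := 128 * (W * lam) / (mu ^+ 2 * M%:R).
  have m2 : 0 < mu ^+ 2 * M%:R by rewrite mulr_gt0 // exprn_gt0.
  have X0 : 0 <= X by rewrite divr_ge0 ?(ltW m2) // mulr_ge0 // mulr_ge0 // ltW.
  have [k Xk] : exists k : nat, X <= k%:R.
    by exists (Num.bound X); exact/ltW/archi_boundP.
  exists k.+2; rewrite /P /=; set m := k.+2.
  have mX : X <= m%:R.
    by apply: (le_trans Xk); rewrite ler_nat; exact: leqW (leqnSn k).
  have m1 : 1 <= m%:R :> R by rewrite ler1n.
  rewrite ler_pdivrMr // in mX.
  have -> : gaf m * gaf m * M%:R = m%:R ^+ 3 * (m%:R * (mu ^+ 2 * M%:R)) / 4.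
    by rewrite /gaf; field.
  have m3 : 1 <= m%:R ^+ 3 :> R by rewrite exprn_ege1.
  have h0 : 0 <= m%:R * (mu ^+ 2 * M%:R) by rewrite mulr_ge0 // ltW.
  have := ler_wpM2r h0 m3; rewrite mul1r; lra.
case: (ex_minnP ex) => Nn /andP [h1 h2] hmin; exists Nn; split=> // m /andP [m1 m2].
by apply/negP => h; have := hmin m; rewrite /P m1 h leqNgt m2 => /(_ isT).
Qed.

Lemma epochs_exists (th : R) : exists K, th <= 2 ^+ K /\
  forall k, (k < K)%N -> ~~ (th <= 2 ^+ k).
Proof.
case: (ex_minnP (pow2_unbounded th)) => K h hmin; exists K; split=> // k lt.
by apply/negP => hk; have := hmin k hk; rewrite leqNgt lt.
Qed.

Let c3 : R := root_const R.
Let c4 : R := momentum_const R.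
Let c5 : R := epoch_const R.

(** If N > 2, its predecessor fails the test, which bounds its fourth power, and N is at most twice
    its predecessor. If N = 2, the bound is the assumption on nnz(A). The dimension d enters through
    nnz <= M D <= M d. *)
Lemma momentum_bound M Nn : (N <= M * D)%N -> (2 <= Nn)%N ->
  (forall m, (2 <= m < Nn)%N -> ~~ (32 * (W * lam) <= gaf m * gaf m * M%:R)) ->
  N%:R * Nn%:R ^+ 4 <= c4 * (d%:R * stable_rank A / gap ^+ 2).
Proof.
move=> MD N2 Nmin; have [l1 _ l0] := lam_bounds.
set Q := _ / gap ^+ 2.
have Q0 : 0 <= Q by rewrite divr_ge0 ?sqr_ge0 // mulr_ge0 // ltW.
have N0 : 0 < N%:R :> R by rewrite ltr0n.
have [E|N3] : Nn = 2%N \/ (2 < Nn)%N by case: (ltngtP 2%N Nn) N2 => //; auto.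
  rewrite E /c4 /momentum_const -/c3; have := nnz_le; rewrite -/Q => h.
  have := ler_wpM2r Q0 (root_const_ge1 R); rewrite -/c3; move: c3 => c h3; lra.
pose m := Nn.-1.
have Em : Nn = m.+1 by rewrite /m prednK // ltnW // ltnW.
have m2 : (2 <= m)%N by rewrite -ltnS -Em.
have mlt : (m < Nn)%N by rewrite [X in (_ < X)%N]Em.
have H := Nmin m; rewrite m2 mlt -ltNge in H; have {}H := H isT.
have m0 : 0 <= m%:R :> R by [].
have m4 : Nn%:R ^+ 4 <= 16 * m%:R ^+ 4 :> R.
  have -> : 16 * m%:R ^+ 4 = (2 * m%:R) ^+ 4 :> R by ring.
  by rewrite lerXn2r ?nnegrE ?mulr_ge0 // -natrM ler_nat Em mul2n -addnn -addn1 leq_add2l ltnW.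
have DM : N%:R <= M%:R * d%:R :> R.
  by rewrite -natrM ler_nat (leq_trans MD) // leq_mul2l D_led orbT.
have g2 : 0 < gap ^+ 2 by rewrite exprn_gt0.
have H2 : gap ^+ 2 * (m%:R ^+ 4 * M%:R) * lam < c3 * W.
  rewrite -(ltr_pM2r l0).
  have E1 : gaf m * gaf m * M%:R =
      gap ^+ 2 * (m%:R ^+ 4 * M%:R) * lam * lam / (4 * 200 ^+ 2).
    by rewrite /gaf /mu; field.
  move: H; rewrite E1 ltr_pdivrMr ?mulr_gt0 ?exprn_gt0 //.
  by congr (_ < _); rewrite /c3 /root_const; ring.
have H3 : gap ^+ 2 * (m%:R ^+ 4 * M%:R) <= c3 * stable_rank A.
  rewrite srE [leRHS]mulrA ler_pdivlMr //; apply: le_trans (ltW H2).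
  by rewrite ler_wpM2l ?(ltW l1) // mulr_ge0 ?(ltW g2) // mulr_ge0 ?exprn_ge0.
rewrite /Q [leRHS]mulrA ler_pdivlMr //.
have H4 : N%:R * Nn%:R ^+ 4 * gap ^+ 2 <= (M%:R * d%:R) * (16 * m%:R ^+ 4) * gap ^+ 2.
  by rewrite ler_wpM2r ?(ltW g2) // ler_pM ?exprn_ge0.
apply: (le_trans H4).
have d16 : 0 <= 16 * d%:R :> R by rewrite mulr_ge0.
have H5 := ler_wpM2l d16 H3.
have E5 : M%:R * d%:R * (16 * m%:R ^+ 4) * gap ^+ 2 =
  16 * d%:R * (gap ^+ 2 * (m%:R ^+ 4 * M%:R)) :> R by ring.
rewrite E5; apply: (le_trans H5).
by rewrite /c4 /momentum_const -/c3; move: c3 => c; rewrite le_eqVlt; apply/orP; left; apply/eqP; ring.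
Qed.

(** Only a polynomial bound matters, as it ends up inside a logarithm. N >= 2 gives lam / gamma <=
    100 / gap, and N <= nnz N^4 with sr <= d gives N <= c4 d^2 / gap^2; altogether five powers of 1
    / gap. *)
Lemma theta_bound Nn : (2 <= Nn)%N ->
  N%:R * Nn%:R ^+ 4 <= c4 * (d%:R * stable_rank A / gap ^+ 2) ->
  2 * Nn%:R * ((lam + gaf Nn) * (lam + gaf Nn)) * lam / (mu * (gaf Nn * gaf Nn)) <=
  c5 * (d%:R / gap) ^+ 5.
Proof.
move=> N2 HN; pose ga := gaf Nn; rewrite -/ga; have [_ _ l0] := lam_bounds.
have d0 : 1 <= d%:R :> R by rewrite ler1n ltnW.
have n2 : 2 <= Nn%:R :> R by rewrite ler_nat.
have n0 : 0 < Nn%:R :> R by lra.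
have ga0 : 0 < ga by rewrite /ga /gaf divr_gt0 // mulr_gt0 // mulr_gt0.
have g0 : gap != 0 by rewrite gt_eqF.
have r1 : lam / ga <= 100 / gap.
  rewrite ler_pdivrMr // mulrAC ler_pdivlMr //.
  have -> : 100 * ga = gap * lam * (Nn%:R * Nn%:R) / 4 by rewrite /ga /gaf /mu; field.
  have h4 : 4 <= Nn%:R * Nn%:R :> R.
    by have := ler_pM (ler0n _ _) (ler0n _ _) n2 n2; lra.
  have := ler_wpM2l (ltW (mulr_gt0 gap_gt0 l0)) h4; lra.
have r2 : lam / ga + 1 <= 101 / gap.
  have : 1 <= 1 / gap by rewrite ler_pdivlMr // mul1r.
  lra.
have E : 2 * Nn%:R * ((lam + ga) * (lam + ga)) * lam / (mu * (ga * ga)) =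
   400 * (Nn%:R * ((lam / ga + 1) ^+ 2 / gap)).
  by rewrite /mu; field; rewrite g0 !gt_eqF.
rewrite E.
have p0 : 0 <= lam / ga + 1 by rewrite addr_ge0 // divr_ge0 // ltW.
have N1 : 1 <= N%:R :> R by rewrite ler1n.
have NnB : Nn%:R <= c4 * (d%:R ^+ 2 / gap ^+ 2).
  apply: (@le_trans _ _ (N%:R * Nn%:R ^+ 4)).
    rewrite -[leLHS]mul1r ler_pM //.
    by rewrite -{1}[Nn%:R]expr1 ler_weXn2l //; lra.
  apply: (le_trans HN); rewrite ler_wpM2l ?(le_trans ler01 (momentum_const_ge1 R)) // ler_wpM2r ?invr_ge0 ?sqr_ge0 //.
  by rewrite expr2 ler_wpM2l.
have sq : (lam / ga + 1) ^+ 2 <= (101 / gap) ^+ 2.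
  by rewrite lerXn2r ?nnegrE // divr_ge0 // ltW.
have : Nn%:R * ((lam / ga + 1) ^+ 2 / gap) <=
   (c4 * (d%:R ^+ 2 / gap ^+ 2)) * ((101 / gap) ^+ 2 / gap).
  apply: ler_pM => //; first by rewrite mulr_ge0 ?sqr_ge0 // invr_ge0 ltW.
  by rewrite ler_wpM2r // invr_ge0 ltW.
move=> /(ler_wpM2l (ler0n R 400)) h; apply: (le_trans h).
have -> : 400 * (c4 * (d%:R ^+ 2 / gap ^+ 2) * ((101 / gap) ^+ 2 / gap)) =
  c5 * (d%:R ^+ 2 / gap ^+ 5) by rewrite /c5 /epoch_const -/c4; field.
rewrite expr_div_n ler_wpM2l //; first exact: le_trans ler01 (epoch_const_ge1 R).
by rewrite ler_wpM2r ?invr_ge0 ?exprn_ge0 ?(ltW gap_gt0) // ler_weXn2l.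
Qed.

Let X : R := d%:R / gap.

Lemma X_ge2 : 2 <= X.
Proof.
rewrite /X ler_pdivlMr //.
have : 2 <= d%:R :> R by rewrite ler_nat.
by move: gap_le1; lra.
Qed.

Lemma solver_correct : exists t : nat,
  let mu := run svrg_solver t (input A lam gap bv x0v) in
  let B := lam%:M - A^T *m A in
  let xstar := invmx B *m bv in
  [/\ t%:R <= time_constant R *
        (N%:R `^ (3 / 4) * (d%:R * stable_rank A) `^ (1 / 4) / Num.sqrt gap * ln X),
      almost_surely mu (@halted R)
    & expect mu (fun c => normB B (output svrg_solver d c - xstar) ^+ 2)
        <= 1 / 2 * normB B (x0v - xstar) ^+ 2].
Proof.
have [M MD] := block_exists.
have M0 : (0 < M)%N.
  by have /andP [h _] := MD; move: (leq_trans N_gt0 h); rewrite muln_gt0 => /andP [].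
have [Nn [N2 Nok Nmin]] := momentum_exists M0.
have HN := momentum_bound (andP MD).1 N2 Nmin.
have TB := theta_bound N2 HN.
have [K [Kok Kmin]] := epochs_exists (2 * Nn%:R * ((lam + gaf Nn) * (lam + gaf Nn)) * lam /
  (mu * (gaf Nn * gaf Nn))).
have H := @wp_run R n d A lam gap bv x0v M Nn K N_gt0 mu_gt0 mu_le opA lam_W MD N2 Nok Nmin Kok Kmin.
exists (total_time A M Nn K + 0)%N; rewrite /=.
set B := lam%:M - _; set xs := invmx B *m bv.
pose Phi (c : config R) := normB B (output svrg_solver d c - xs) ^+ 2.
have := H [::] 0%N Phi 0 1 ler01; rewrite add0r mul1r => -[s [hb hl]|h1 h2].
  split; first by rewrite /almost_surely /= orbT.
  rewrite expect_dret add0r mul1r /Phi (normB_sq mu_gt0 opA).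
  (* The output undoes the shift, so its error is that of the shifted iterate against [xs] minus b /
     lambda. *)
  have -> : output svrg_solver d ([::], s) - xs = vec d (rmem s 18) -
     (xs - vec d (fun j => nth 0 [seq bv j 0 | j <- enum 'I_d] j / lam)).
    by apply/colP => j; rewrite !colBE !mxE /= /upd /= hb hl; ring.
  exact: lexx.
split=> //.
have Kb k : (k < K)%N -> 2 ^+ k <= c5 * X ^+ 5.
  by move=> /Kmin; rewrite -ltNge => /ltW h; exact: le_trans h TB.
have LB := log_bound (epoch_const_ge1 R) X_ge2 Kb.
have DS : 0 <= d%:R * stable_rank A by rewrite mulr_ge0 // ltW.
have WB := work_bound (ler0n R N) DS gap_gt0 (ler0n R Nn) (momentum_const_ge1 R) HN.
have T : (total_time A M Nn K + 0 <= 4990 * (N * Nn * K.+1))%N.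
  rewrite addn0; apply: total_arith => //.
    by apply: outer_arith => //; apply: epoch_time_le => //; case/andP: MD.
  exact: (SL_size mu_gt0 mu_le lam_W).
apply: (@le_trans _ _ ((4990 * (N * Nn * K.+1))%:R)); first by rewrite ler_nat.
rewrite natrM [(N * Nn * K.+1)%:R]natrM [(N * Nn)%:R]natrM.
rewrite /time_constant -/c4 -/c5; move: (4990%:R : R) (ler0n R 4990) => C0 hC0.
have P0 : 0 <= N%:R * Nn%:R :> R by rewrite mulr_ge0.
have := ler_wpM2l hC0 (ler_pM P0 (ler0n R K.+1) WB LB).
move: (_ / Num.sqrt gap) ((7 + _) / _) => Q q h; apply: (le_trans h).
by rewrite le_eqVlt; apply/orP; left; apply/eqP; rewrite /c4; ring.
Qed.

End Assembly.

Theorem theorem4p7 (R : realType) :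
  exists (P : solver) (C : R), 0 < C /\
  forall (n d : nat) (A : 'M[R]_(n, d)) (eig : seq R) (lambda : R)
    (b x0 : 'cV[R]_d),
  let Sigma := A^T *m A in
  let lambda1 := eig`_0 in
  let lambda2 := eig`_1 in
  let gap := (lambda1 - lambda2) / lambda1 in
  let B := lambda%:M - Sigma in
  let xstar := invmx B *m b in
  (2 <= d)%N ->
  sorted_eigenvalues Sigma eig ->
  0 < gap ->
  (1 + gap / 150) * lambda1 < lambda ->
  lambda <= (1 + gap / 100) * lambda1 ->
  (nnz A)%:R <= d%:R * stable_rank A / gap ^+ 2 ->
  exists t : nat,
    let mu := run P t (input A lambda gap b x0) in
    [/\ t%:R <= C * ((nnz A)%:R `^ (3 / 4) * (d%:R * stable_rank A) `^ (1 / 4)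
                     / Num.sqrt gap * ln (d%:R / gap)),
        almost_surely mu (@halted R)
      & expect mu (fun c => normB B (output P d c - xstar) ^+ 2)
        <= 1 / 2 * normB B (x0 - xstar) ^+ 2].
Proof.
exists svrg_solver, (time_constant R); split; first exact: time_constant_gt0.
move=> n d A eig lambda b x0 Sigma lambda1 lambda2 gap B xstar d2 Seig g0 l1 l2 hn.
have [e0 e1 e0'] := gram_spectrum d2 Seig.
(* For lambda_1 = 0 the quotient defining [gap] would be 0, as the inverse of 0 is 0. *)
have l1_gt0 : 0 < lambda1.
  rewrite lt_def e0' andbT; apply: contraTneq g0 => E.
  by rewrite /gap E invr0 mulr0 ltxx.
(* A Gram matrix has lambda_2 >= 0. *)
have g1 : gap <= 1 by rewrite /gap ler_pdivrMr // mul1r gerBl.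
rewrite /lambda1 e0 in l1 l2 l1_gt0.
exact: (solver_correct b x0 d2 l1_gt0 g0 g1 l1 l2 hn).
Qed.
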